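(* Let $X$ and $X'$ be compact Riemann surfaces of genus $1$, with Arakelov-Green functions $G_X$ and $G_{X'}$, and let $f : X \to X'$ be an isogeny. Let $D$ be a divisor on $X'$. Equip $O_{X'}(D)$ and $O_X(f^*D)$ with their canonical Arakelov metrics and $f^*O_{X'}(D)$ with the pulled-back metric. Then the canonical isomorphism of line bundles $f^*O_{X'}(D) \to O_X(f^*D)$ is an isometry. In particular, for every $P \in X$ one has $G_X(f^*D, P) = G_{X'}(D, f(P))$.
   Context: For a compact connected Riemann surface $X$ of genus $g>0$, let $\mu_X = \frac{i}{2g}\sum_{k}\omega_k\wedge\overline{\omega}_k$, where $\omega_1,\dots,\omega_g$ is an orthonormal basis of $H^0(X,\Omega^1_X)$ for the inner product $\frac{i}{2}\int_X\omega\wedge\overline{\eta}$. The Arakelov-Green function $G = G_X : X\times X\to\mathbb{R}_{\ge 0}$ is the unique function such that: (i) $G(P,Q)^2$ is $C^\infty$ on $X\times X$ and $G$ vanishes only on the diagonal, with multiplicity $1$; (ii) for all $P$, $\partial_Q\overline{\partial}_Q \log G(P,Q)^2 = 2\pi i\,\mu_X(Q)$ for $Q\neq P$; (iii) for all $P$, $\int_X \log G(P,Q)\,\mu_X(Q) = 0$. It is symmetric. For a divisor $D=\sum_R n_R R$ and a point $P$ write $G(D,P) := \prod_R G(R,P)^{n_R}$. The canonical (Arakelov) metric on $O_X(D)$ is defined by declaring that the canonical section $s_D$ has norm $\|s_D\|(Q) = G(D,Q)$. An isogeny is a nonconstant holomorphic map of genus-1 surfaces that is a group homomorphism; $f^*D$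 denotes the pullback divisor. *)

(* Defs.v *)
From HB Require Import structures.
From mathcomp Require Import all_boot all_order all_algebra.
From mathcomp Require Import complex.
From mathcomp Require Import all_classical all_reals all_analysis.

Set Implicit Arguments.
Unset Strict Implicit.
Unset Printing Implicit Defensive.

Import Order.TTheory GRing.Theory Num.Theory.
Import numFieldNormedType.Exports.

Local Open Scope classical_set_scope.
Local Open Scope ring_scope.
Local Open Scope complex_scope.

(* The topology and the normed structure of R[i] are those given by its
   modulus, through the generic instances on R[i]^o. *)
HB.instance Definition _ (R : realType) := GRing.ComAlgebra.copy R[i] R[i]^o.
HB.instance Definition _ (R : realType) := Vector.copy R[i] R[i]^o.
HB.instance Definition _ (R : realType) := NormedModule.copy R[i] R[i]^o.

Definition holomorphic_on (R : realType) (U : set R[i]) (F : R[i] -> R[i]) :=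
  forall z, U z -> derivable F z 1.

(* [Ck k U F] : on the open set U, F is continuous and has continuous iterated
   directional derivatives up to order k. *)
Fixpoint Ck (R : realType) (V : normedModType R) (k : nat)
    (U : set V) (F : V -> R) : Prop :=
  {in U, continuous F} /\
  (if k is k'.+1 then
     forall v, (forall x, U x -> derivable F x v) /\ Ck k' U ('D_v F)
   else True).

Definition smooth_on (R : realType) (V : normedModType R)
    (U : set V) (F : V -> R) := forall k, Ck k U F.

Definition plane_to_C (R : realType) (p : R * R) : R[i] := p.1 +i* p.2.

(* The values of [cinv] outside the open set [cfun @` cdom] are irrelevant. *)
Record chart (R : realType) (X : topologicalType) := Chart {
  cdom : set X;
  cfun :> X -> R[i];
  cinv : R[i] -> X;
  cdom_open : open cdom;
  cimg_open : open (cfun @` cdom);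
  cfunK : forall x, cdom x -> cinv (cfun x) = x;
  cfun_cts : {in cdom, continuous cfun};
  cinv_cts : {in cfun @` cdom, continuous cinv} }.

Definition compatible (R : realType) (X : topologicalType)
    (c1 c2 : chart R X) :=
  holomorphic_on (c1 @` (cdom c1 `&` cdom c2)) (c2 \o cinv c1) /\
  holomorphic_on (c2 @` (cdom c1 `&` cdom c2)) (c1 \o cinv c2).

(* The complex structure is a maximal holomorphic atlas.  The carrier is a
   pointed space only because surfaces are non-empty. *)
Record riemann_surface (R : realType) := RiemannSurface {
  rs_carrier :> ptopologicalType;
  atlas : set (chart R rs_carrier);
  rs_hausdorff : hausdorff_space rs_carrier;
  rs_connected : connected [set: rs_carrier];
  atlas_cover : forall x, exists2 c, atlas c & cdom c x;
  atlas_compatible : forall c1 c2, atlas c1 -> atlas c2 -> compatible c1 c2;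
  atlas_maximal : forall c,
    (forall c', atlas c' -> compatible c c') -> atlas c }.
Arguments atlas {R}.

Section Forms.
Context {R : realType} (X : riemann_surface R).
Local Notation chart := (chart R X).

(* The inverse of the chart c in the real coordinates (x, y), z = x + iy. *)
Definition chart_param (c : chart) (p : R * R) : X := cinv c (plane_to_C p).
Definition chart_image (c : chart) (A : set X) : set (R * R) :=
  @plane_to_C R @^-1` (c @` A).
Definition chart_coord (c : chart) (x : X) : R * R :=
  (complex.Re (c x), complex.Im (c x)).

(* A (1,0)-form, resp. a (1,1)-form, is represented by its coefficient with
   respect to dz, resp. dz /\ dzbar, in every chart z of the atlas; only the
   values at (c, x) with [atlas X c] and [cdom c x] are meaningful. *)
Definition coef_form := chart -> X -> R[i].

Definition holomorphic_form (w : coef_form) :=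
  (forall c, atlas X c -> holomorphic_on (c @` cdom c) (w c \o cinv c)) /\
  (forall c1 c2 x, atlas X c1 -> atlas X c2 -> cdom c1 x -> cdom c2 x ->
     w c1 x = w c2 x * derive1 (c2 \o cinv c1) (c1 x)).

Definition forms_basis (g : nat) (w : 'I_g -> coef_form) :=
  (forall k, holomorphic_form (w k)) /\
  (forall e : coef_form, holomorphic_form e ->
     exists! a : {ffun 'I_g -> R[i]},
       forall c x, atlas X c -> cdom c x -> e c x = \sum_k a k * w k c x).

Definition has_genus (g : nat) := exists w : 'I_g -> coef_form, forms_basis w.

Definition wedge_conj (w e : coef_form) : coef_form :=
  fun c x => w c x * (e c x)^*.

Definition plane_measure :=
  (@lebesgue_measure R \x @lebesgue_measure R)%E.

Definition borel := g_sigma_algebraType (@open X).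

(* The integral over X of the real 2-form given by h c dx /\ dy in the chart c:
   the total mass of the signed measure which is h c dx dy in every chart c. *)
Definition real_integral (h : chart -> X -> R) (I : R) :=
  exists nu : {charge set borel -> \bar R},
    (forall c (A : set borel), atlas X c -> measurable A -> A `<=` cdom c ->
       plane_measure.-integrable (chart_image c A)
         (fun p => (h c (chart_param c p))%:E) /\
       nu A = (\int[plane_measure]_(p in chart_image c A)
                 (h c (chart_param c p))%:E)%E) /\
    nu [set: borel] = I%:E.

(* dz /\ dzbar = -2i dx /\ dy. *)
Definition form_integral (e : coef_form) (I : R[i]) :=
  let h c x := - (2 * 'i * e c x) in
  real_integral (fun c x => complex.Re (h c x)) (complex.Re I) /\
  real_integral (fun c x => complex.Im (h c x)) (complex.Im I).

Definition orthonormal (g : nat) (w : 'I_g -> coef_form) :=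
  forall j k, form_integral (fun c x => 'i / 2 * wedge_conj (w j) (w k) c x)
                            (j == k)%:R.

Definition arakelov_form (mu : coef_form) :=
  exists (g : nat) (w : 'I_g -> coef_form),
    [/\ (0 < g)%N, forms_basis w, orthonormal w &
        mu = fun c x => 'i / (2 * g%:R) *
                        \sum_k wedge_conj (w k) (w k) c x].

(* The second derivative in z and zbar is a quarter of the Laplacian. *)
Definition ddbar (phi : X -> R) : coef_form := fun c x =>
  let F := phi \o chart_param c in
  ((('D_(1, 0) ('D_(1, 0) F) (chart_coord c x) +
     'D_(0, 1) ('D_(0, 1) F) (chart_coord c x)) / 4)%:C).

(* On U x U, U the domain of a coordinate z, the diagonal has the equation
   z(P) - z(Q) = 0. *)
Definition simple_zero_on_diagonal (G : X -> X -> R) :=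
  forall c, atlas X c -> exists2 u : (R * R) * (R * R) -> R,
    smooth_on (chart_image c (cdom c) `*` chart_image c (cdom c)) u &
    forall x y, cdom c x -> cdom c y ->
      0 < u (chart_coord c x, chart_coord c y) /\
      G x y = Normc.normc (c x - c y) * u (chart_coord c x, chart_coord c y).

Definition arakelov_green (G : X -> X -> R) :=
  [/\ forall P Q, 0 <= G P Q,
      forall c1 c2, atlas X c1 -> atlas X c2 ->
        smooth_on (chart_image c1 (cdom c1) `*` chart_image c2 (cdom c2))
          (fun p => G (chart_param c1 p.1) (chart_param c2 p.2) ^+ 2),
      forall P Q, G P Q = 0 <-> P = Q,
      simple_zero_on_diagonal G &
      exists2 mu, arakelov_form mu & forall P,
        (forall c Q, atlas X c -> cdom c Q -> Q != P ->
           ddbar (fun x => ln (G P x ^+ 2)) c Q = 2 * pi%:C * 'i * mu c Q) /\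
        form_integral (fun c Q => (ln (G P Q))%:C * mu c Q) 0].

Definition is_divisor (D : X -> int) := finite_set [set x | D x != 0].

(* Since 0^-1 = 0, the value of G(D, P) is 0 also at the points P where
   D P < 0, at which it is infinite in the usual convention. *)
Definition green_div (G : X -> X -> R) (D : X -> int) (P : X) : R :=
  \big[*%R/1]_(S \in [set S | D S != 0]) G S P ^ D S.

End Forms.

Section Groups.
Context {R : realType} (X : riemann_surface R).

Record group_law := GroupLaw {
  gzero : X;
  gopp : X -> X;
  gadd : X -> X -> X;
  gaddA : associative gadd;
  gaddC : commutative gadd;
  gadd0 : left_id gzero gadd;
  gaddN : left_inverse gzero gopp gadd;
  gadd_cts : continuous (fun p : X * X => gadd p.1 p.2);
  gopp_cts : continuous gopp;
  gadd_holomorphic : forall c1 c2 c3 x y,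
    atlas X c1 -> atlas X c2 -> atlas X c3 ->
    cdom c1 x -> cdom c2 y -> cdom c3 (gadd x y) ->
    differentiable
      (fun p : R[i] * R[i] => c3 (gadd (cinv c1 p.1) (cinv c2 p.2)))
      (c1 x, c2 y);
  gopp_holomorphic : forall c1 c2 x,
    atlas X c1 -> atlas X c2 -> cdom c1 x -> cdom c2 (gopp x) ->
    derivable (c2 \o gopp \o cinv c1) (c1 x) 1 }.

End Groups.

Section Maps.
Context {R : realType} (X X' : riemann_surface R).

Definition holomorphic_map (f : X -> X') :=
  continuous f /\
  forall c c', atlas X c -> atlas X' c' ->
    holomorphic_on (c @` (cdom c `&` f @^-1` cdom c')) (c' \o f \o cinv c).

Definition isogeny (L : group_law X) (L' : group_law X') (f : X -> X') :=
  [/\ holomorphic_map f, exists x y, f x != f y &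
      forall x y, f (gadd L x y) = gadd L' (f x) (f y)].

Definition has_zero_of_order (F : R[i] -> R[i]) (a : R[i]) (n : nat) :=
  exists2 l : R[i], l != 0 & F z / (z - a) ^+ n @[z --> a^'] --> l.

Definition ramification_index (f : X -> X') (x : X) : nat :=
  xget 0%N [set e | forall c c', atlas X c -> atlas X' c' ->
    cdom c x -> cdom c' (f x) ->
    has_zero_of_order (fun z => c' (f (cinv c z)) - c' (f x)) (c x) e].

Definition pullback_div (f : X -> X') (D : X' -> int) : X -> int :=
  fun x => D (f x) * (ramification_index f x)%:Z.

End Maps.

(* A line bundle L with a Hermitian metric, presented by its fibres: germs of
   sections are represented by elements of S, the fibre of L at P is the
   quotient of [germ P] by the subspace [null P] of the germs whose value at P
   is zero, and [norm P s] is the norm of the value at P of the section s. *)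
Record metrized_bundle (R : realType) (X : Type) (S : lmodType R[i]) :=
  MetrizedBundle {
    germ : X -> set S;
    null : X -> set S;
    norm : X -> S -> R }.

(* The fibre of f^*L at P is the fibre of L at f P, with the same norm. *)
Definition pullback_bundle (R : realType) (X X' : Type) (S : lmodType R[i])
    (f : X -> X') (L : metrized_bundle X' S) : metrized_bundle X S :=
  MetrizedBundle (germ L \o f) (null L \o f) (norm L \o f).

(* phi induces for every P a linear bijection, preserving norms, from the fibre
   of L at P to the fibre of L' at P. *)
Definition isometric_isomorphism (R : realType) (X : Type)
    (S S' : lmodType R[i]) (L : metrized_bundle X S)
    (L' : metrized_bundle X S') (phi : S -> S') :=
  linear phi /\
  forall P,
    [/\ forall s, germ L P s -> germ L' P (phi s),
        forall s, germ L P s -> (null L P s <-> null L' P (phi s)),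
        forall s', germ L' P s' ->
          exists2 s, germ L P s & null L' P (s' - phi s) &
        forall s, germ L P s -> norm L' P (phi s) = norm L P s].

Section OD.
Context {R : realType} (X : riemann_surface R).

(* Germs at P of sections of O_X(D): the functions h holomorphic on a punctured
   neighbourhood of P and such that h * z^(D P) extends holomorphically to P,
   z being a coordinate centred at P (that is, ord_P h + D P >= 0 or h = 0).
   The value h P itself is irrelevant. *)
Definition OD_germ (D : X -> int) (P : X) (h : X -> R[i]) :=
  (\forall Q \near P^', forall c, atlas X c -> cdom c Q ->
     derivable (h \o cinv c) (c Q) 1) /\
  (forall c, atlas X c -> cdom c P ->
     cvg (h (cinv c z) * (z - c P) ^ D P @[z --> (c P)^'])).

Definition OD_null (D : X -> int) (P : X) (h : X -> R[i]) :=
  forall c, atlas X c -> cdom c P ->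
    h (cinv c z) * (z - c P) ^ D P @[z --> (c P)^'] --> (0 : R[i]).

(* The section of O_X(D) given by the meromorphic function h is h * s_D, where
   the canonical section s_D is given by 1; as |s_D|(Q) = G(D, Q), its norm is
   |h(Q)| G(D, Q) for Q near P, Q != P, extended by continuity to P. *)
Definition OD_norm (G : X -> X -> R) (D : X -> int) (P : X) (h : X -> R[i])
    : R :=
  lim (Normc.normc (h Q) * green_div G D Q @[Q --> P^']).

Definition OD (G : X -> X -> R) (D : X -> int)
    : metrized_bundle X (X -> R[i] : lmodType R[i]) :=
  MetrizedBundle (OD_germ D) (OD_null D) (OD_norm G D).

End OD.

(* On meromorphic functions the canonical map f^*O_X'(D) -> O_X(f^*D) is
   composition with f; it maps f^*s_D to s_(f^*D). *)
Definition canonical_map (R : realType) (X X' : riemann_surface R)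
    (f : X -> X') (h : X' -> R[i]) : X -> R[i] := h \o f.

(* Main.v *)
Require Import Defs.
From mathcomp Require Import all_boot all_order all_algebra.
From mathcomp Require Import complex finmap.
From mathcomp Require Import all_classical all_reals all_analysis.
From mathcomp Require Import ring lra.

(* Let Q be a point of X' and phi = sum_{f s = Q} ln G(s, .)^2 - ln G'(Q, f .)^2.
   The logarithmic singularities on the fibre cancel because f is a local
   biholomorphism, and the pullback of the holomorphic form on X' is a constant
   multiple a of the one on X, so that off the fibre the Laplacian of phi is a
   constant multiple of the canonical form: it has a constant sign and phi is
   constant by the maximum principle.  Integrating phi against the
   canonical form of X, whose pushforward to X' is a multiple of the canonical
   form of X', shows that the constant is 0 by the normalisation of G and G'.
   This yields G(f^*D, P) = G'(D, f P), hence the isometry, f being unramified.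

   Pulling back a holomorphic form requires the derivative of a transition map to
   be holomorphic.  Instead of Goursat's theorem, this uses the smoothness of G^2
   and its simple zero on the diagonal. *)

(** A map is holomorphic when it is complex differentiable at every point; the derivative is not
    known to be continuous, so the inverse function theorem does not apply directly. The group laws
    take its place. They carry any point to any other, so f' vanishes everywhere or nowhere, f is
    injective near every point because its kernel is discrete, and the holomorphic form w has no
    zero because its translates are multiples of it. The fibres are cosets of the kernel, so the
    preimage of a small open set is a disjoint union of translates of one sheet. Charts of X are
    taken of the form c' o f, with c' a chart of X'. In them f is the identity, and forms,
    Laplacians and singularities on X and X' are compared in the same coordinate. The Laplacian of
    phi is |a|^2 - #f^{-1}(Q) times the positive density 4 pi |w|^2. Its sign decides whether phi or
    -phi is subharmonic, only in the weak sense; the Green functions of X themselves supply the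
    perturbation that makes the inequality strict. *)

Set Implicit Arguments.
Unset Strict Implicit.
Unset Printing Implicit Defensive.

Import Order.TTheory GRing.Theory Num.Theory.
Import numFieldNormedType.Exports.

Local Open Scope classical_set_scope.
Local Open Scope ring_scope.
Local Open Scope complex_scope.

(** * Wirtinger derivatives *)

Section complex_plane.
Context {R : realType}.
Implicit Types (z w a b d : R[i]) (F H : R[i] -> R[i]).
Local Notation "'N z" := (Normc.normc z) (at level 10, z at level 8).

Lemma normcE_norm z : `|z| = ('N z)%:C.
Proof. by rewrite normc_def; case: z. Qed.

Lemma normcD z w : 'N (z + w) <= 'N z + 'N w.
Proof. exact: le_normcD. Qed.

Lemma normc_opp z : 'N (- z) = 'N z. Proof. exact: (normcN z). Qed.

Lemma normcB z w : 'N (z - w) = 'N (w - z).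
Proof. by rewrite -normc_opp opprB. Qed.

Lemma normc_ge0 z : 0 <= 'N z.
Proof. by case: z => x y; exact: sqrtr_ge0. Qed.

Lemma normc_eq0 z : ('N z == 0) = (z == 0).
Proof.
by apply/eqP/eqP => [/Normc.eq0_normc//|->]; exact: Normc.normc0.
Qed.

Lemma normc_gt0 z : (0 < 'N z) = (z != 0).
Proof. by rewrite lt_def normc_ge0 andbT normc_eq0. Qed.

Lemma normc_conj z : 'N (conjc z) = 'N z.
Proof. by case: z => x y /=; rewrite sqrrN. Qed.

Lemma normc_real (x : R) : 'N (x%:C) = `|x|.
Proof. by rewrite /= expr0n addr0 sqrtr_sqr. Qed.

Lemma normc_Re z : `|complex.Re z| <= 'N z.
Proof.
by case: z => x y /=; rewrite -sqrtr_sqr ler_sqrt ?lerDl ?addr_ge0 ?sqr_ge0.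
Qed.

Lemma normc_Im z : `|complex.Im z| <= 'N z.
Proof.
by case: z => x y /=; rewrite -sqrtr_sqr ler_sqrt ?lerDr ?addr_ge0 ?sqr_ge0.
Qed.

Lemma normc_leD z : 'N z <= `|complex.Re z| + `|complex.Im z|.
Proof.
rewrite {1}[z]complexE (le_trans (normcD _ _))// Normc.normcM !normc_real.
by rewrite /= expr0n expr1n add0r sqrtr1 mul1r.
Qed.

Lemma normc_sqr z : ('N z ^+ 2)%:C = z * conjc z.
Proof. by rewrite -sqr_normc normcE_norm -rmorphXn. Qed.

(** The norm of [R[i]] is [R[i]]-valued, so its balls have complex radii. A positive complex number
    is real, which allows real radii throughout. *)
Lemma nearCP (P : set R[i]) z :
  (\forall w \near z, P w) <->
  exists2 r : R, 0 < r & forall w, 'N (w - z) < r -> P w.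
Proof.
split=> [/nbhs_ballP[e /= e0 eP]|[r r0 rP]].
  have e_real : e = (complex.Re e)%:C.
    by rewrite RRe_real// realE ltW.
  exists (complex.Re e); first by move: e0; rewrite {1}e_real ltcR.
  move=> w wz; apply: eP; rewrite -ball_normE /= distrC normcE_norm e_real.
  by rewrite ltcR.
apply/nbhs_ballP; exists r%:C => /=; first by rewrite ltcR.
move=> w; rewrite -ball_normE /= distrC normcE_norm ltcR; exact: rP.
Qed.

Lemma near_planeP (P : set (R * R)) (p : R * R) :
  (\forall q \near p, P q) <->
  exists2 r : R, 0 < r &
    forall q, `|q.1 - p.1| < r -> `|q.2 - p.2| < r -> P q.
Proof.
split=> [/nbhs_ballP[e /= e0 eP]|[r r0 rP]].
  exists e => // q q1 q2; apply: eP; split.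
    by rewrite -ball_normE /= distrC.
  by rewrite -ball_normE /= distrC.
apply/nbhs_ballP; exists r => //= q [].
by rewrite -!ball_normE /= => q1 q2; apply: rP; rewrite distrC.
Qed.

Definition C_to_plane z : R * R := (complex.Re z, complex.Im z).

Lemma C_to_planeK : cancel C_to_plane (@plane_to_C R).
Proof. by case. Qed.

Lemma plane_to_CK : cancel (@plane_to_C R) C_to_plane.
Proof. by case. Qed.

Lemma ReB z w : complex.Re (z - w) = complex.Re z - complex.Re w.
Proof. by case: z w => [? ?] [? ?]. Qed.

Lemma ImB z w : complex.Im (z - w) = complex.Im z - complex.Im w.
Proof. by case: z w => [? ?] [? ?]. Qed.

Lemma near_plane_to_C (P : set R[i]) (p : R * R) :
  (\forall q \near p, P (plane_to_C q)) <->
  (\forall z \near plane_to_C p, P z).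
Proof.
split=> [/near_planeP[r r0 rP]|/nearCP[r r0 rP]].
  apply/nearCP; exists r => // w wr; rewrite -[w]C_to_planeK; apply: rP => /=.
    by apply: le_lt_trans wr; rewrite (le_trans _ (normc_Re _))// ReB.
  by apply: le_lt_trans wr; rewrite (le_trans _ (normc_Im _))// ImB.
apply/near_planeP; exists (r / 2); first lra.
move=> q q1 q2; apply: rP; apply: le_lt_trans (normc_leD _) _.
by rewrite ReB ImB /=; lra.
Qed.

Lemma near_C_to_plane (P : set (R * R)) z :
  (\forall w \near z, P (C_to_plane w)) <->
  (\forall q \near C_to_plane z, P q).
Proof.
have := near_plane_to_C (P \o C_to_plane) (C_to_plane z).
by rewrite C_to_planeK => <-; split; apply: filterS => q; rewrite /= plane_to_CK.
Qed.

Lemma continuous_plane_to_C : continuous (@plane_to_C R).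
Proof. by move=> p A /near_plane_to_C. Qed.

Lemma continuous_C_to_plane : continuous C_to_plane.
Proof. by move=> p A /near_C_to_plane. Qed.

Lemma continuousCP (T : topologicalType) (f : T -> R[i]) x :
  {for x, continuous f} <->
  forall e : R, 0 < e -> \forall y \near x, 'N (f y - f x) < e.
Proof.
split=> [fx e e0|fx A /nearCP[r r0 rA]].
  by have /fx : nbhs (f x) [set w | (Normc.normc (w - f x)) < e] by apply/nearCP; exists e.
by have := fx r r0; apply: filterS => y /rA.
Qed.

(* [wder F z a b]: F is differentiable at z over the reals, with Wirtinger
   derivatives a = dF/dz and b = dF/dzbar. *)
Definition wder F z a b := forall e : R, 0 < e ->
  \forall w \near z,
    'N (F w - F z - a * (w - z) - b * conjc (w - z) ) <= e * 'N (w - z).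

Definition cder F z d := wder F z d 0.

Lemma cderE F z d : cder F z d <-> forall e : R, 0 < e ->
  \forall w \near z, 'N (F w - F z - d * (w - z)) <= e * 'N (w - z).
Proof.
by split=> Fz e e0; apply: filterS (Fz e e0) => w; rewrite mul0r subr0.
Qed.

Lemma is_derive_cder F z d : is_derive z 1 F d <-> cder F z d.
Proof.
have key w : w != z ->
    'N (d - (w - z)^-1 *: (F w - F z)) = 'N (F w - F z - d * (w - z)) / 'N (w - z).
  move=> wz; have wz0 : w - z != 0 by rewrite subr_eq0.
  rewrite -Normc.normcV -Normc.normcM normcB; congr Normc.normc.
  by rewrite /GRing.scale /=; field.
rewrite cderE; split=> [[Fz <-] e e0|Fz].
  have /cvgrPdist_le/(_ e%:C) := Fz.
  rewrite ltcR => /(_ e0); rewrite near_withinE => /nearCP[r r0 rF].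
  apply/nearCP; exists r => // w wr.
  have [->|wz] := eqVneq w z; first by rewrite !subrr mulr0 subrr Normc.normc0 mulr0.
  have := rF (w - z); rewrite subr0 => /(_ wr); rewrite subr_eq0 => /(_ wz) /=.
  rewrite scaler1 subrK -/(derive F z 1) normcE_norm lecR => h.
  have wz0 : w - z != 0 by rewrite subr_eq0.
  rewrite -ler_pdivrMr ?normc_gt0// -Normc.normcV -Normc.normcM.
  apply: le_trans h; rewrite normcB le_eqVlt; apply/orP; left; apply/eqP.
  by congr Normc.normc; rewrite /GRing.scale /=; field.
have : h^-1 *: ((F \o shift z) (h *: 1) - F z) @[h --> 0^'] --> d.
  apply/cvgrPdist_le => e e0.
  have e_real : e = (complex.Re e)%:C by rewrite RRe_real// realE ltW.
  move: e0; rewrite e_real ltcR => e0; have /nearCP[r r0 rF] := Fz _ e0.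
  rewrite near_withinE; apply/nearCP; exists r => // h hr h0.
  rewrite /= scaler1 normcE_norm lecR.
  have hz : h + z != z by rewrite -subr_eq0 addrK.
  have := key _ hz; rewrite addrK => ->.
  rewrite ler_pdivrMr ?normc_gt0//.
  by have := rF (h + z); rewrite addrK => /(_ _); apply; rewrite subr0 in hr.
move=> Fl; split; first by apply/cvg_ex; exists d.
exact: cvg_lim Fl.
Qed.

Lemma derivable_cderP F z : derivable F z 1 <-> exists d, cder F z d.
Proof.
split=> [/derivableP/is_derive_cder Fz|[d /is_derive_cder []//]].
by exists ('D_1 F z).
Qed.

Lemma derive1_cder F z d : cder F z d -> derive1 F z = d.
Proof. by move/is_derive_cder => [_ <-]; rewrite derive1E. Qed.

Lemma derivable_cder F z : derivable F z 1 -> cder F z (derive1 F z).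
Proof. by move/derivable_cderP => [d Fd]; rewrite (derive1_cder Fd). Qed.

Lemma wder_near_eq F H z a b :
  (\forall w \near z, F w = H w) -> wder F z a b -> wder H z a b.
Proof.
move=> FH Fz e e0; have FHz := nbhs_singleton FH.
by near=> w; rewrite -(near FH w)// -FHz; near: w; exact: Fz.
Unshelve. all: by end_near. Qed.

Lemma wder_lip F z a b : wder F z a b ->
  \forall w \near z, 'N (F w - F z) <= ('N a + 'N b + 1) * 'N (w - z).
Proof.
move=> /(_ 1 ltr01); apply: filterS => w; rewrite mul1r => Fw.
rewrite -[F w - F z](subrK (a * (w - z) + b * conjc (w - z))).
apply: le_trans (normcD _ _) _; rewrite opprD addrA.
have := normcD (a * (w - z)) (b * conjc (w - z)).
by rewrite !Normc.normcM normc_conj; lra.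
Qed.

Lemma wder_small F z a b : wder F z a b ->
  forall e : R, 0 < e -> \forall w \near z, 'N (F w - F z) <= e.
Proof.
move=> /wder_lip/nearCP[r r0 rF] e e0; apply/nearCP.
have C0 : 0 < 'N a + 'N b + 1 by have := normc_ge0 a; have := normc_ge0 b; lra.
exists (Num.min r (e / ('N a + 'N b + 1))); first by rewrite lt_min r0 divr_gt0.
move=> w; rewrite lt_min => /andP[wr we]; apply: le_trans (rF _ wr) _.
by rewrite mulrC -ler_pdivlMr ?ltW.
Qed.

Lemma wder_continuous F z a b : wder F z a b -> {for z, continuous F}.
Proof.
move=> Fz; apply/continuousCP => e e0.
have e20 : 0 < e / 2 by lra.
by apply: filterS (wder_small Fz e20) => w wz; lra.
Qed.

Lemma wder_comp F H z a b d : wder H (F z) a b -> cder F z d ->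
  wder (H \o F) z (a * d) (b * conjc d).
Proof.
move=> Hz Fz e e0.
have a0 := normc_ge0 a; have b0 := normc_ge0 b; have d0 := normc_ge0 d.
(* [e1] pays for the remainder of H, carried through |F w - F z| <= (|d| + 1) |w - z|; [e2] pays for
   the remainder of F, which is multiplied by at most |a| + |b|. *)
pose e1 := e / 2 / ('N d + 1); pose e2 := e / 2 / ('N a + 'N b + 1).
have e10 : 0 < e1 by rewrite !divr_gt0//; lra.
have e20 : 0 < e2 by rewrite !divr_gt0//; lra.
have e1E : e1 * ('N d + 1) = e / 2 by rewrite divfK//; lra.
have e2E : e2 * ('N a + 'N b + 1) = e / 2 by rewrite divfK//; lra.
have Fcz := wder_continuous Fz.
near=> w.
have H1 : 'N (H (F w) - H (F z) - a * (F w - F z) - b * conjc (F w - F z))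
    <= e1 * 'N (F w - F z).
  by near: w; apply: (Fcz _ (Hz _ e10)).
have H2 : 'N (F w - F z) <= ('N d + 1) * 'N (w - z).
  by near: w; have := wder_lip Fz; apply: filterS => w; rewrite Normc.normc0 addr0.
have H3 : 'N (F w - F z - d * (w - z)) <= e2 * 'N (w - z).
  by near: w; move/cderE : Fz; apply.
rewrite (_ : _ - _ - _ - _ =
  (H (F w) - H (F z) - a * (F w - F z) - b * conjc (F w - F z)) +
  (a * (F w - F z - d * (w - z)) + b * conjc (F w - F z - d * (w - z)))); last first.
  by rewrite /= !rmorphB rmorphM; ring.
apply: le_trans (normcD _ _) _.
have := normcD (a * (F w - F z - d * (w - z))) (b * conjc (F w - F z - d * (w - z))).
rewrite !Normc.normcM normc_conj => H4.
have wz0 := normc_ge0 (w - z).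
have H5 : ('N a + 'N b) * 'N (F w - F z - d * (w - z)) <= e / 2 * 'N (w - z).
  rewrite -e2E; apply: (@le_trans _ _ (('N a + 'N b) * (e2 * 'N (w - z)))).
    by rewrite ler_wpM2l// addr_ge0.
  have : 0 <= e2 * 'N (w - z) by rewrite mulr_ge0// ltW.
  nra.
have H6 : e1 * 'N (F w - F z) <= e / 2 * 'N (w - z).
  rewrite -e1E -mulrA ler_wpM2l// ltW//.
lra.
Unshelve. all: by end_near. Qed.

Lemma cder_comp F H z d d' : cder H (F z) d' -> cder F z d ->
  cder (H \o F) z (d' * d).
Proof. by move=> Hz Fz; have := wder_comp Hz Fz; rewrite mul0r. Qed.

Lemma wder_mul F H z a b a' b' : wder F z a b -> wder H z a' b' ->
  wder (fun w => F w * H w) z (F z * a' + a * H z) (F z * b' + b * H z).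
Proof.
move=> Fz Hz e e0.
have F0 := normc_ge0 (F z); have H0 := normc_ge0 (H z).
have C0 : 0 < 'N a + 'N b + 1 by have := normc_ge0 a; have := normc_ge0 b; lra.
pose e1 := e / 3 / ('N (F z) + 1); pose e2 := e / 3 / ('N (H z) + 1).
pose e3 := e / 3 / ('N a + 'N b + 1).
have e10 : 0 < e1 by rewrite !divr_gt0//; lra.
have e20 : 0 < e2 by rewrite !divr_gt0//; lra.
have e30 : 0 < e3 by rewrite !divr_gt0//; lra.
have e1E : e1 * ('N (F z) + 1) = e / 3 by rewrite divfK//; lra.
have e2E : e2 * ('N (H z) + 1) = e / 3 by rewrite divfK//; lra.
have e3E : e3 * ('N a + 'N b + 1) = e / 3 by rewrite divfK//; lra.
near=> w.
have wz0 := normc_ge0 (w - z).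
have H1 : 'N (F w - F z - a * (w - z) - b * conjc (w - z)) <= e2 * 'N (w - z).
  by near: w; apply: Fz.
have H2 : 'N (H w - H z - a' * (w - z) - b' * conjc (w - z)) <= e1 * 'N (w - z).
  by near: w; apply: Hz.
have H3 : 'N (F w - F z) <= ('N a + 'N b + 1) * 'N (w - z).
  by near: w; exact: wder_lip Fz.
have H4 : 'N (H w - H z) <= e3 by near: w; exact: wder_small Hz _ e30.
rewrite (_ : _ - _ - _ - _ =
  F z * (H w - H z - a' * (w - z) - b' * conjc (w - z)) +
  (H z * (F w - F z - a * (w - z) - b * conjc (w - z)) +
   (F w - F z) * (H w - H z))); last by ring.
apply: le_trans (normcD _ _) _.
apply: le_trans (lerD (lexx _) (normcD _ _)) _.
rewrite !Normc.normcM.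
have := ler_wpM2l F0 H2; have := ler_wpM2l H0 H1.
have := ler_pM (normc_ge0 _) (normc_ge0 _) H3 H4.
have : 0 <= e1 * 'N (w - z) by rewrite mulr_ge0// ltW.
have : 0 <= e2 * 'N (w - z) by rewrite mulr_ge0// ltW.
have -> : ('N a + 'N b + 1) * 'N (w - z) * e3 = e / 3 * 'N (w - z).
  by rewrite -e3E; ring.
have -> : e * 'N (w - z) = e1 * ('N (F z) + 1) * 'N (w - z) +
  (e2 * ('N (H z) + 1) * 'N (w - z) + e / 3 * 'N (w - z)).
  by rewrite e1E e2E; field.
rewrite !mulrDr !mulrDl !mulr1 ![e1 * 'N (F z) * _]mulrAC ![e2 * 'N (H z) * _]mulrAC.
rewrite [_ * 'N (F z)]mulrC [_ * 'N (H z)]mulrC; lra.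
Unshelve. all: by end_near. Qed.

Lemma wder_inv F z a b : F z != 0 -> wder F z a b ->
  wder (fun w => (F w)^-1) z (- a / F z ^+ 2) (- b / F z ^+ 2).
Proof.
move=> Fz0 Fz e e0.
have f0 : 0 < 'N (F z) by rewrite normc_gt0.
set f := 'N (F z) in f0.
pose C := 'N a + 'N b + 1.
have C0 : 0 < C by rewrite /C; have := normc_ge0 a; have := normc_ge0 b; lra.
pose e1 := e * (f / 2 * f ^+ 2) / (2 * f).
(* The bound f / 2 keeps |F w| >= f / 2, hence the denominator away from 0; the other bound controls
   the product of the two increments. *)
pose e2 := Num.min (f / 2) (e * (f / 2 * f ^+ 2) / (2 * C)).
have f20 : 0 < f / 2 * f ^+ 2 by rewrite mulr_gt0 ?exprn_gt0//; lra.
have e10 : 0 < e1 by rewrite divr_gt0 ?mulr_gt0.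
have e20 : 0 < e2 by rewrite lt_min !divr_gt0// mulr_gt0.
have e1E : f * e1 = e * (f / 2 * f ^+ 2) / 2 by rewrite /e1; field; lra.
near=> w.
have wz0 := normc_ge0 (w - z).
have H1 : 'N (F w - F z - a * (w - z) - b * conjc (w - z)) <= e1 * 'N (w - z).
  by near: w; apply: Fz.
have : 'N (F w - F z) <= e2 by near: w; exact: wder_small Fz _ e20.
rewrite le_min => /andP[H2 H3].
have Fw : f / 2 <= 'N (F w).
  have := normcD (F w) (F z - F w); rewrite addrC subrK normcB -/f; lra.
have Fw0 : F w != 0 by rewrite -normc_gt0; lra.
have H4 : 'N (a * (w - z) + b * conjc (w - z)) <= C * 'N (w - z).
  apply: le_trans (normcD _ _) _; rewrite !Normc.normcM normc_conj /C; lra.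
rewrite (_ : _ - _ - _ - _ =
  (- F z * (F w - F z - a * (w - z) - b * conjc (w - z)) +
  (F w - F z) * (a * (w - z) + b * conjc (w - z))) / (F w * F z ^+ 2)); last first.
  by field; rewrite Fw0 Fz0.
rewrite !Normc.normcM Normc.normcV !Normc.normcM -/f.
rewrite ler_pdivrMr; last by rewrite !mulr_gt0// normc_gt0.
apply: le_trans (normcD _ _) _; rewrite !Normc.normcM normc_opp -/f.
have H5 : f * 'N (F w - F z - a * (w - z) - b * conjc (w - z)) <=
    e * (f / 2 * f ^+ 2) / 2 * 'N (w - z).
  by rewrite -e1E -mulrA ler_wpM2l// ltW.
have H6 : 'N (F w - F z) * 'N (a * (w - z) + b * conjc (w - z)) <=
    e * (f / 2 * f ^+ 2) / 2 * 'N (w - z).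
  apply: le_trans (ler_pM (normc_ge0 _) (normc_ge0 _) H3 H4) _.
  by rewrite le_eqVlt; apply/orP; left; apply/eqP; field; lra.
apply: le_trans (lerD H5 H6) _.
apply: (@le_trans _ _ (e * 'N (w - z) * (f / 2 * f ^+ 2))).
  by rewrite le_eqVlt; apply/orP; left; apply/eqP; field.
have FzE : 'N (F z ^+ 2) = f ^+ 2 by rewrite !expr2 Normc.normcM.
rewrite ler_wpM2l// ?mulr_ge0 ?(ltW e0)// ?FzE ler_wpM2r//.
by rewrite exprn_ge0// ltW.
Unshelve. all: by end_near. Qed.

End complex_plane.

(** * Mean value inequality and differentiability of the derivative of a primitive *)

Section complex_calculus.
Context {R : realType}.
Implicit Types (z w a b d : R[i]) (F H : R[i] -> R[i]).
Local Notation "'N z" := (Normc.normc z) (at level 10, z at level 8).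

Lemma cder_quadratic p b c z :
  cder (fun w => b * (w - p) + c * (w - p) ^+ 2) z (b + 2 * c * (z - p)).
Proof.
apply/cderE => e e0; apply/nearCP.
have c0 := normc_ge0 c.
exists (e / ('N c + 1)) => [|w wz]; first by rewrite divr_gt0//; lra.
rewrite (_ : _ - _ - _ = c * (w - z) * (w - z)); last by ring.
rewrite !Normc.normcM ler_wpM2r ?normc_ge0//.
have wz0 := normc_ge0 (w - z).
move: wz; rewrite ltr_pdivlMr; last lra.
nra.
Qed.

Lemma wder_sub F H z a b a' b' : wder F z a b -> wder H z a' b' ->
  wder (fun w => F w - H w) z (a - a') (b - b').
Proof.
move=> Fz Hz e e0; have e20 : 0 < e / 2 by lra.
have := Hz _ e20; have := Fz _ e20; apply: filterS2 => w Fw Hw.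
rewrite (_ : _ - _ - _ - _ = (F w - F z - a * (w - z) - b * conjc (w - z)) -
  (H w - H z - a' * (w - z) - b' * conjc (w - z))); last by ring.
by apply: le_trans (normcD _ _) _; rewrite normc_opp; lra.
Qed.

Lemma cder_sub F H z d d' : cder F z d -> cder H z d' ->
  cder (fun w => F w - H w) z (d - d').
Proof. by move=> Fz Hz; have := wder_sub Fz Hz; rewrite subr0. Qed.

(** Tested on the increments t and i t with t real, the difference of the two expansions bounds |(a
    - a') + (b - b')| and |(a - a') - (b - b')| by every e > 0. *)
Lemma wder_unique F z a b a' b' : wder F z a b -> wder F z a' b' ->
  a = a' /\ b = b'.
Proof.
move=> Fz Fz'.
have [] : 'N ((a - a') + (b - b')) <= 0 /\ 'N ((a - a') - (b - b')) <= 0.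
  suff key e : 0 < e -> 'N ((a - a') + (b - b')) <= e /\
      'N ((a - a') - (b - b')) <= e.
    by split; apply/ler_addgt0Pr => e e0; rewrite add0r; have [] := key _ e0.
  move=> e0; have e20 : 0 < e / 2 by lra.
  have /nearCP[r r0 rF] : \forall w \near z,
      'N ((a - a') * (w - z) + (b - b') * conjc (w - z)) <= e * 'N (w - z).
    have := Fz' _ e20; have := Fz _ e20; apply: filterS2 => w Fw Fw'.
    rewrite (_ : (a - a') * _ + _ = (F w - F z - a' * (w - z) - b' * conjc (w - z)) -
      (F w - F z - a * (w - z) - b * conjc (w - z))); last by ring.
    by apply: le_trans (normcD _ _) _; rewrite normc_opp; lra.
  pose t := (r / 2)%:C : R[i].
  have Nt : 'N t = r / 2 by rewrite normc_real gtr0_norm//; lra.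
  have Ni : 'N ('i%C : R[i]) = 1 by rewrite /= expr0n expr1n add0r sqrtr1.
  have addzK u : z + u - z = u by ring.
  split.
    have := rF (z + t); rewrite addzK Nt => /(_ _)/wrap[]; first lra.
    rewrite [conjc t]conjc_real -mulrDl Normc.normcM Nt.
    by rewrite ler_pM2r//; lra.
  have := rF (z + 'i%C * t); rewrite addzK Normc.normcM Ni mul1r Nt.
  move=> /(_ _)/wrap[]; first lra.
  rewrite (_ : (a - a') * _ + _ = ((a - a') - (b - b')) * ('i%C * t)); last first.
    have -> : conjc ('i%C * t) = - ('i%C * t).
      by rewrite /t /=; congr (_ +i* _); ring.
    by ring.
  by rewrite !Normc.normcM Ni mul1r Nt ler_pM2r//; lra.
have N0 z0 : 'N z0 <= 0 -> z0 = 0.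
  by move=> z00; apply/eqP; rewrite -normc_eq0 eq_le z00 normc_ge0.
move=> /N0 h1 /N0 h2.
have h3 : 2 * (a - a') = 0.
  rewrite (_ : 2 * _ = (a - a' + (b - b')) + (a - a' - (b - b'))); last by ring.
  by rewrite h1 h2 addr0.
have aa : a - a' = 0.
  by move/eqP: h3; rewrite mulf_eq0 pnatr_eq0 => /= /eqP.
split; apply/eqP; rewrite -subr_eq0; first exact/eqP.
by rewrite -[X in X == _]add0r -{1}aa h1.
Qed.

Lemma is_derive_realP (g : R -> R) (s d : R) : is_derive s 1 g d <->
  forall e : R, 0 < e ->
    \forall t \near s, `|g t - g s - d * (t - s)| <= e * `|t - s|.
Proof.
have key (d' t : R) : t != s ->
    `|g t - g s - d' * (t - s)| = `|d' - (t - s)^-1 *: (g t - g s)| * `|t - s| :> R.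
  move=> ts; have ts0 : t - s != 0 by rewrite subr_eq0.
  rewrite -normrM distrC; congr Num.norm.
  by rewrite /GRing.scale /=; field.
split=> [[gs <-] e e0|gs].
  have /cvgrPdist_le/(_ e e0) := gs.
  rewrite near_withinE => /nbhs_ballP[r r0 rg].
  apply/nbhs_ballP; exists r => // t; rewrite /ball/= => tr.
  have [->|ts] := eqVneq t s; first by rewrite !subrr mulr0 subrr normr0 mulr0.
  have ts0 : t - s != 0 by rewrite subr_eq0.
  have tr0 : ball (0 : R) r (t - s) by rewrite -ball_normE/= sub0r opprB.
  have := rg (t - s) tr0 ts0; rewrite /= -/(derive g s 1) => h.
  rewrite scaler1 subrK in h; rewrite key//.
  exact: (ler_wpM2r (normr_ge0 (t - s)) h).
have : h^-1 *: ((g \o shift s) (h *: 1) - g s) @[h --> 0^'] --> d.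
  apply/cvgrPdist_le => e e0.
  have /nbhs_ballP[r /= r0 rF] := gs _ e0.
  rewrite near_withinE; apply/nbhs_ballP; exists r => // h; rewrite -ball_normE/=.
  rewrite sub0r normrN => hr h0; rewrite scaler1.
  have hz : h + s != s by rewrite -subr_eq0 addrK.
  have hr0 : ball s r (h + s).
    by rewrite -ball_normE/= opprD addrCA subrr addr0 normrN.
  by have := rF (h + s) hr0; rewrite key// addrK ler_pM2r// normr_gt0.
move=> Fl; split; first by apply/cvg_ex; exists d.
exact: cvg_lim Fl.
Qed.

(** With u = F q - F p, the real mean value theorem applies to s |-> Re (conj u * F (p + s (q -
    p))), whose increment over [0, 1] is |u|^2. *)
Lemma cder_mean_value F p q (M : R) :
  (forall s : R, 0 <= s <= 1 ->
     exists2 d, cder F (p + s%:C * (q - p)) d & 'N d <= M) ->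
  'N (F q - F p) <= M * 'N (q - p).
Proof.
move=> FM; have [->|Fpq] := eqVneq (F q) (F p).
  rewrite subrr Normc.normc0 mulr_ge0 ?normc_ge0//.
  have [|d _] := FM 0; first by rewrite lexx ler01.
  exact/le_trans/normc_ge0.
set u := F q - F p.
have u0 : 0 < 'N u by rewrite normc_gt0 subr_eq0.
pose g (s : R) := complex.Re (conjc u * F (p + s%:C * (q - p))).
have dg (s : R) : 0 <= s <= 1 -> exists2 dg : R, is_derive s 1 g dg &
    `|dg| <= 'N u * (M * 'N (q - p)).
  move=> s01; have [d Fd dM] := FM _ s01.
  exists (complex.Re (conjc u * (d * (q - p)))); last first.
    apply: le_trans (normc_Re _) _; rewrite !Normc.normcM normc_conj.
    by rewrite ler_wpM2l ?normc_ge0// ler_wpM2r// normc_ge0.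
  apply/is_derive_realP => e e0.
  have L0 := normc_ge0 (q - p).
  pose e1 := e / ('N u * 'N (q - p) + 1).
  have L1 : 0 <= 'N u * 'N (q - p) by rewrite mulr_ge0// ltW.
  have e10 : 0 < e1 by rewrite divr_gt0//; lra.
  have /nearCP[r r0 rF] := (cderE _ _ _).1 Fd _ e10.
  apply/nbhs_ballP; exists (r / ('N (q - p) + 1)) => /=.
    by rewrite divr_gt0//; lra.
  move=> t; rewrite -ball_normE/= distrC ltr_pdivlMr; last lra.
  move=> ts; have ts0 := normr_ge0 (t - s).
  have tsE : p + t%:C * (q - p) - (p + s%:C * (q - p)) = (t - s)%:C * (q - p).
    by rewrite rmorphB /=; ring.
  have := rF (p + t%:C * (q - p)); rewrite tsE Normc.normcM normc_real.
  move=> /(_ _)/wrap[]; first nra.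
  move=> h.
  rewrite /g (_ : _ - _ - _ = complex.Re (conjc u * (F (p + t%:C * (q - p)) -
    F (p + s%:C * (q - p)) - d * ((t - s)%:C * (q - p))))); last first.
    rewrite -ReB; have -> : complex.Re (conjc u * (d * (q - p))) * (t - s) =
        complex.Re (conjc u * (d * (q - p)) * (t - s)%:C).
      by case: (conjc u * _) => x y /=; rewrite mulr0 subr0.
    by rewrite -ReB; congr complex.Re; ring.
  apply: le_trans (normc_Re _) _; rewrite Normc.normcM normc_conj.
  apply: le_trans (ler_wpM2l (normc_ge0 _) h) _.
  rewrite (_ : e = e1 * ('N u * 'N (q - p) + 1)); last by rewrite divfK//; lra.
  have : 0 <= e1 * `|t - s| by rewrite mulr_ge0// ltW.
  nra.
have [dg' dg'E] : exists dg' : R -> R, forall s : R, 0 <= s <= 1 ->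
    is_derive s 1 g (dg' s) /\ `|dg' s| <= 'N u * (M * 'N (q - p)).
  exists (fun s => 'D_1 g s) => s /dg[d gd dM]; have [gs gE] := gd.
  by split; [exact: derivableP | rewrite gE].
have [|||c c01] := @MVT_segment _ g dg' 0 1.
- by [].
- by move=> x /[!in_itv]/= /andP[x0 x1]; apply: (dg'E _ _).1; rewrite !ltW.
- apply: derivable_within_continuous => x /[!in_itv]/= x01.
  by have [[]] := dg'E _ x01.
rewrite subr0 mulr1 /g rmorph0 mul0r addr0 rmorph1 mul1r [p + _]addrC subrK.
rewrite -ReB -mulrBr -/u mulrC -normc_sqr /= => gE.
have := (dg'E c _).2; rewrite -gE => /(_ _)/wrap[]; first by rewrite in_itv in c01.
by rewrite ger0_norm ?exprn_ge0 ?(ltW u0)// expr2 ler_pM2l.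
Qed.

(** The increment of T from z to z + t + i t is computed along both ways round a square. With g
    replaced by its affine approximation the two results differ by 2 i b t^2, and each of the four
    edges has an error of at most 2 e t^2; hence |b| <= 4 e for every e > 0. *)
Lemma wder_primitive T g z a b :
  (\forall w \near z, cder T w (g w)) -> wder g z a b -> b = 0.
Proof.
move=> Tg gz; apply/eqP; rewrite -normc_eq0 eq_le normc_ge0 andbT.
suff key e : 0 < e -> 'N b <= 4 * e.
  apply/ler_addgt0Pr => e e0; rewrite add0r.
  by have := key (e / 4); rewrite [4 * _]mulrC divfK//; apply; lra.
move=> e0.
have /nearCP[r r0 rT] : \forall w \near z, cder T w (g w) /\
    'N (g w - g z - a * (w - z) - b * conjc (w - z)) <= e * 'N (w - z).
  by have := gz _ e0; move: Tg; apply: filterS2 => w; split.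
(* Every point of the square lies within 2 t < r of z. *)
pose t := r / 3.
have t0 : 0 < t by rewrite /t; lra.
(* On an axis-parallel edge starting at p, conj (w - p) = s * (w - p). *)
have edge (p v : R[i]) (s : R) : conjc v = s%:C * v -> 'N v = t ->
    (forall k : R, 0 <= k <= 1 -> 'N (p + k%:C * v - z) <= 2 * t) ->
    'N (T (p + v) - T p - ((g z + a * (p - z) + b * conjc (p - z)) * v +
       (a + s%:C * b) / 2 * v ^+ 2)) <= 2 * e * t ^+ 2.
  move=> vs vt pv.
  (* On the edge, the affine approximation of g is the derivative of the quadratic polynomial [Q],
     so the mean value inequality for T - Q bounds the error. *)
  pose Q w := (g z + a * (p - z) + b * conjc (p - z)) * (w - p) +
    (a + s%:C * b) / 2 * (w - p) ^+ 2.
  have pvK : p + v - p = v by ring.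
  have := @cder_mean_value (fun w => T w - Q w) p (p + v) (2 * e * t).
  have -> : T (p + v) - Q (p + v) - (T p - Q p) = T (p + v) - T p -
      ((g z + a * (p - z) + b * conjc (p - z)) * v + (a + s%:C * b) / 2 * v ^+ 2).
    by rewrite /Q pvK subrr; field.
  rewrite pvK vt (_ : 2 * e * t * t = 2 * e * t ^+ 2); last by ring.
  apply=> k k01; have kz := pv _ k01.
  have [|Tk gk] := rT (p + k%:C * v); first by rewrite /t in kz t0 *; lra.
  eexists; first exact: (cder_sub Tk (cder_quadratic _ _ _ _)).
  rewrite (_ : _ - _ = g (p + k%:C * v) - g z - a * (p + k%:C * v - z) -
    b * conjc (p + k%:C * v - z)); last first.
    have -> : conjc (p + k%:C * v - z) = conjc (p - z) + k%:C * (s%:C * v).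
      rewrite -vs (_ : p + k%:C * v - z = (p - z) + k%:C * v); last by ring.
      rewrite rmorphD rmorphM; congr (_ + _ * _); exact: conjc_real.
    by field.
  by apply: le_trans gk _; rewrite [2 * e]mulrC -mulrA ler_wpM2l ?(ltW e0).
have Ni : 'N ('i%C : R[i]) = 1 by rewrite /= expr0n expr1n add0r sqrtr1.
have Nt : 'N (t%:C : R[i]) = t by rewrite normc_real gtr0_norm.
have Nit : 'N ('i%C * t%:C : R[i]) = t by rewrite Normc.normcM Ni mul1r.
have conj_it : conjc ('i%C * t%:C) = (-1)%:C * ('i%C * t%:C) :> R[i].
  by rewrite /=; congr (_ +i* _); ring.
have Nk (k : R) : 0 <= k <= 1 -> 'N (k%:C : R[i]) <= 1.
  by move=> /andP[k0 k1]; rewrite normc_real ger0_norm.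
have conj_t : conjc (t%:C) = 1%:C * t%:C :> R[i] by rewrite conjc_real mul1r.
have bound (k : R) u v : 0 <= k <= 1 -> 'N u <= t -> 'N v = t ->
    'N (z + u + k%:C * v - z) <= 2 * t.
  move=> /Nk k1 ut vt; rewrite addrAC [z + u]addrC addrK.
  by apply: le_trans (normcD _ _) _; rewrite Normc.normcM vt; nra.
have e0' : 0 <= e * t ^+ 2 by rewrite mulr_ge0 ?exprn_ge0// ltW.
have {Ni} itE : ('i%C * t%:C) ^+ 2 = - t%:C ^+ 2 :> R[i].
  by rewrite exprMn sqr_i mulN1r.
have z0E : z = z + 0 by rewrite addr0.
have N0 : 'N (0 : R[i]) <= t by rewrite Normc.normc0 ltW.
have := edge z t%:C 1 conj_t Nt.
move=> /(_ _)/wrap[]; first by move=> k k01; rewrite {1}z0E; exact: bound.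
move=> E1.
have := edge (z + t%:C) ('i%C * t%:C) (-1) conj_it Nit.
move=> /(_ _)/wrap[]; first by move=> k k01; apply: bound; rewrite ?Nt.
move=> E2.
have := edge z ('i%C * t%:C) (-1) conj_it Nit.
move=> /(_ _)/wrap[]; first by move=> k k01; rewrite {1}z0E; exact: bound.
move=> E3.
have := edge (z + 'i%C * t%:C) t%:C 1 conj_t Nt.
move=> /(_ _)/wrap[]; first by move=> k k01; apply: bound; rewrite ?Nit.
move=> E4.
have addzK u : z + u - z = u by ring.
rewrite !addzK conj_t conj_it [z + 'i%C * t%:C + t%:C]addrAC in E1 E2 E3 E4.
rewrite !subrr conjc0 in E1 E3.
move: E1 E2 E3 E4; rewrite !itE rmorph1 rmorphN rmorph1 mulN1r.
set X1 := _ - _ - _; set X2 := _ - _ - _; set X3 := _ - _ - _.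
set X4 := _ - _ - _ => E1 E2 E3 E4.
have sumX : (X3 + X4) - (X1 + X2) = 2 * 'i%C * b * t%:C ^+ 2.
  rewrite /X1 /X2 /X3 /X4; set i := 'i%C; set s := t%:C.
  by field.
have : 'N (2 * 'i%C * b * t%:C ^+ 2) <= 8 * e * t ^+ 2.
  rewrite -sumX; apply: le_trans (normcD _ _) _; rewrite normc_opp.
  have := normcD X1 X2; have := normcD X3 X4; lra.
rewrite !Normc.normcM.
have -> : 'N (2 : R[i]) = 2.
  by rewrite (_ : 2 = (2 : R)%:C) ?normc_real ?gtr0_norm// rmorphD rmorph1.
have Ni' : 'N ('i%C : R[i]) = 1 by rewrite /= expr0n expr1n add0r sqrtr1.
by rewrite Ni' !Nt mulr1 -expr2 ler_pM2r ?exprn_gt0//; lra.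
Qed.

End complex_calculus.

(** * Directional derivatives and smooth functions *)

Section directional.
Context {R : realType}.
Local Notation "'N z" := (Normc.normc z) (at level 10, z at level 8).

Lemma is_derive_slice (V W : normedModType R) (g : V -> W) (x v : V) (s : R) (d : W) :
  is_derive (x + s *: v) v g d <-> is_derive s 1 (fun t : R => g (x + t *: v)) d.
Proof.
have E : (fun h : R => h^-1 *: ((g \o shift (x + s *: v)) (h *: v) - g (x + s *: v))) =
    (fun h : R => h^-1 *: (((fun t : R => g (x + t *: v)) \o shift s) (h *: 1) -
       g (x + s *: v))).
  apply/funext => h /=; congr (_ *: (g _ - _)).
  by rewrite [h *: 1]mulr1 scalerDl addrCA.
by split=> [] [dg <-]; split; rewrite /derivable /derive ?E// -E.
Qed.

Lemma mean_value_sym (g dg : R -> R) (h : R) :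
  (forall s : R, `|s| <= `|h| -> is_derive s 1 g (dg s)) ->
  exists2 c, `|c| <= `|h| & g h - g 0 = dg c * h.
Proof.
move=> dgE; have cg (a b : R) : (forall s, a <= s <= b -> `|s| <= `|h|) ->
    {within `[a, b], continuous g}.
  move=> ab; apply: derivable_within_continuous => x; rewrite in_itv/= => /ab hx.
  by have [] := dgE _ hx.
have [h0|h0] := leP 0 h.
  have hs s : 0 <= s <= h -> `|s| <= `|h|.
    by move=> /andP[s0 sh]; rewrite !ger0_norm.
  have [s s0h|c c0h gE] := @MVT_segment _ g dg 0 h h0 _ (cg _ _ hs).
    by apply: dgE; apply: hs; move: s0h; rewrite in_itv/= => /andP[*]; rewrite !ltW.
  rewrite in_itv/= in c0h.
  by exists c; [exact: hs|rewrite gE subr0].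
have hs s : h <= s <= 0 -> `|s| <= `|h|.
  by move=> /andP[s0 sh]; rewrite !ler0_norm ?lerN2// ltW.
have [s s0h|c c0h gE] := @MVT_segment _ g dg h 0 (ltW h0) _ (cg _ _ hs).
  by apply: dgE; apply: hs; move: s0h; rewrite in_itv/= => /andP[*]; rewrite !ltW.
rewrite in_itv/= in c0h.
by exists c; [exact: hs|rewrite -opprB gE sub0r mulrN opprK].
Qed.

Lemma directional_bound (V : normedModType R) (B : V -> R) (x v : V) (h D e : R) :
  (forall s : R, `|s| <= `|h| -> derivable B (x + s *: v) v /\
     `|'D_v B (x + s *: v) - D| <= e) ->
  `|B (x + h *: v) - B x - D * h| <= e * `|h|.
Proof.
move=> hB; have [s sh|c ch gE] := @mean_value_sym (fun t : R => B (x + t *: v))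
    (fun t : R => 'D_v B (x + t *: v)) h.
  by have [dB _] := hB _ sh; apply: (is_derive_slice B x v s _).1; exact: derivableP.
rewrite scale0r addr0 in gE; rewrite gE -mulrBl normrM.
by have [_] := hB _ ch; exact: ler_wpM2r.
Qed.

(** This is dA/dz = (A_x - i A_y) / 2; as A is real, dA/dzbar is its conjugate. *)
Definition wirtinger (A : R * R -> R) (p : R * R) : R[i] :=
  ('D_(1, 0) A p / 2) -i* ('D_(0, 1) A p / 2).

(** The increment is split along the axis-parallel path through (p.1, q.2). On each edge the mean
    value theorem replaces it by a partial derivative at a nearby point, close to that at p by
    continuity. *)
Lemma wder_plane (A : R * R -> R) (p : R * R) :
  (\forall q \near p, derivable A q (1, 0)) ->
  (\forall q \near p, derivable A q (0, 1)) ->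
  {for p, continuous ('D_(1, 0) A)} -> {for p, continuous ('D_(0, 1) A)} ->
  wder (fun z => (A (C_to_plane z))%:C) (plane_to_C p)
    (wirtinger A p) (conjc (wirtinger A p)).
Proof.
move=> dx dy cx cy e e0; have e20 : 0 < e / 2 by lra.
have /near_planeP[r r0 rP] : \forall q \near p,
    (derivable A q (1, 0) /\ derivable A q (0, 1)) /\
    (`|'D_(1, 0) A q - 'D_(1, 0) A p| <= e / 2 /\
     `|'D_(0, 1) A q - 'D_(0, 1) A p| <= e / 2).
  have /cvgrPdist_le/(_ _ e20) hx := cx; have /cvgrPdist_le/(_ _ e20) hy := cy.
  apply: filterS2 (filterI dx dy) (filterI hx hy) => q [? ?] [h1 h2].
  by rewrite distrC in h1; rewrite distrC in h2.
apply/nearCP; exists r => // w wr.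
rewrite -(C_to_planeK w) in wr *.
move: (C_to_plane w) wr => q wr; rewrite !plane_to_CK.
pose h := q.1 - p.1; pose k := q.2 - p.2.
have hN : `|h| <= 'N (plane_to_C q - plane_to_C p).
  by rewrite (le_trans _ (normc_Re _))// ReB.
have kN : `|k| <= 'N (plane_to_C q - plane_to_C p).
  by rewrite (le_trans _ (normc_Im _))// ImB.
have b1 := @directional_bound _ A (p.1, q.2) (1, 0) h ('D_(1, 0) A p) (e / 2).
have b2 := @directional_bound _ A p (0, 1) k ('D_(0, 1) A p) (e / 2).
have E1 (s : R) : (p.1, q.2) + s *: (1, 0) = (p.1 + s, q.2).
  by congr pair; rewrite /= ?[_ *: 1]mulr1 ?scaler0 ?addr0.
have E2 (s : R) : p + s *: (0, 1) = (p.1, p.2 + s).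
  by case: (p) => p1 p2; congr pair; rewrite /= ?[_ *: 1]mulr1 ?scaler0 ?addr0.
have {}b1 : `|A q - A (p.1, q.2) - 'D_(1, 0) A p * h| <= e / 2 * `|h|.
  have -> : q = (p.1, q.2) + h *: (1, 0).
    by rewrite E1 /h addrC subrK; case: (q).
  rewrite [(_ + _).2]/= scaler0 addr0.
  apply: b1 => s sh; rewrite E1.
  have [|| [? ?] [? ?]] := rP (p.1 + s, q.2).
  - by rewrite /= (_ : p.1 + s - p.1 = s); [lra|ring].
  - by rewrite /= -/k; lra.
  - by split.
have {}b2 : `|A (p.1, q.2) - A p - 'D_(0, 1) A p * k| <= e / 2 * `|k|.
  have -> : (p.1, q.2) = p + k *: (0, 1) by rewrite E2 /k addrC subrK.
  apply: b2 => s sh; rewrite E2.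
  have [|| [? ?] [? ?]] := rP (p.1, p.2 + s).
  - by rewrite /= subrr normr0.
  - by rewrite /= (_ : p.2 + s - p.2 = s); [lra|ring].
  - by split.
rewrite (_ : _ - _ - _ - _ = (A q - A (p.1, q.2) - 'D_(1, 0) A p * h +
    (A (p.1, q.2) - A p - 'D_(0, 1) A p * k))%:C); last first.
  by rewrite /plane_to_C /wirtinger /h /k; congr (_ +i* _); rewrite /=; field.
rewrite normc_real; apply: le_trans (ler_normD _ _) _; nra.
Qed.

(** On the line through p, the first derivative vanishes at the maximum. If d were positive, it
    would be at least d s / 2 for small s > 0, and the function would increase strictly to the right
    of p. *)
Lemma second_derivative_at_max (V : normedModType R) (B : V -> R) (p v : V) (d : R) :
  (\forall q \near p, derivable B q v) -> is_derive p v ('D_v B) d ->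
  (\forall q \near p, B q <= B p) -> d <= 0.
Proof.
move=> dB d2B maxB; rewrite leNgt; apply/negP => d0.
pose g (s : R) := B (p + s *: v); pose g1 (s : R) := 'D_v B (p + s *: v).
have line : p + s *: v @[s --> (0 : R)] --> p.
  rewrite -[X in _ --> X]addr0 -[X in _ --> p + X](scale0r v).
  by apply: cvgD; [exact: cvg_cst|apply: cvgZr_tmp; exact: cvg_id].
have g0 : g 0 = B p by rewrite /g scale0r addr0.
have : \forall s \near (0 : R), is_derive (s : R) 1 g (g1 s) /\ g s <= g 0.
  have h1 : \forall s \near (0 : R), derivable B (p + s *: v) v.
    exact: (line _ dB).
  have h2 : \forall s \near (0 : R), B (p + s *: v) <= B p.
    exact: (line _ maxB).
  apply: filterS2 h1 h2 => s dBs Bs; split; last by rewrite g0; exact: Bs.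
  by apply: (is_derive_slice B p v s _).1; exact: derivableP.
have d2g : is_derive (0 : R) 1 g1 d.
  by apply: (is_derive_slice ('D_v B) p v 0 d).1; rewrite scale0r addr0.
have d20 : 0 < d / 2 by lra.
have /is_derive_realP/(_ _ d20) := d2g.
move=> hd hn.
have : \forall s \near (0 : R), (is_derive (s : R) 1 g (g1 s) /\ g s <= g 0) /\
    `|g1 s - g1 0 - d * (s - 0)| <= d / 2 * `|s - 0|.
  exact: filterI hn hd.
move=> /nbhs_ballP[r /= r0 rP].
have {}rP (s : R) : `|s| < r -> [/\ is_derive s 1 g (g1 s), g s <= g 0 &
    `|g1 s - g1 0 - d * s| <= d / 2 * `|s|].
  move=> sr; have [|[h1 h2] h3] := rP s; first by rewrite -ball_normE /= sub0r normrN.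
  by rewrite subr0 in h3; split; [exact: h1|exact: h2|exact: h3].
have g10 : g1 0 = 0.
  have ab (t : R) : t \in `]- (r / 2), r / 2[%R -> `|t| < r.
    by rewrite in_itv/= => /andP[t1 t2]; rewrite ltr_norml; lra.
  have dmax : is_derive (0 : R) 1 g 0.
    apply: (@derive1_at_max _ g (- (r / 2)) (r / 2)).
    - lra.
    - by move=> t /ab/rP[[]].
    - by rewrite in_itv/=; lra.
    - by move=> t /ab/rP[].
  have r00 : `|0 : R| < r by rewrite normr0.
  by have [[_ <-] _ _] := rP 0 r00; case: dmax.
have r20 : 0 < r / 2 by lra.
have rr (s : R) : 0 <= s <= r / 2 -> `|s| < r.
  by move=> /andP[s0 sr]; rewrite ger0_norm//; lra.
have dg' (s : R) : s \in `]0, r / 2[%R -> is_derive s 1 g (g1 s).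
  by rewrite in_itv/= => /andP[s0 sr]; have [] := rP s; rewrite ?rr// !ltW.
have cg' : {within `[0, r / 2], continuous g}.
  apply: derivable_within_continuous => s; rewrite in_itv/= => s0.
  by have [[]] := rP s (rr _ s0).
have [c c0r gE] := @MVT _ g g1 0 (r / 2) r20 dg' cg'.
have /andP[c0 cr] : 0 < c < r / 2 by rewrite in_itv in c0r.
have cr' : `|c| < r by rewrite gtr0_norm//; lra.
have [_ _] := rP c cr'; rewrite g10 subr0.
rewrite (gtr0_norm c0) ler_norml => /andP[h1 _].
have r2r : `|r / 2| < r by rewrite gtr0_norm//; lra.
have [_ h2 _] := rP _ r2r.
have : 0 < g1 c * (r / 2 - 0) by rewrite subr0 mulr_gt0//; nra.
lra.
Qed.

(** The derivative of the slice along v is a slice of the derivative of g along (0, v), hence the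
    induction on k with g generalised. *)
Lemma smooth_on_slice (V W : normedModType R) (U : set V) (U' : set W)
    (g : V * W -> R) (p : V) :
  smooth_on (U `*` U') g -> U p -> smooth_on U' (fun q => g (p, q)).
Proof.
move=> sg Up k; move: (sg k) => {sg}; elim: k g => [|k IH] g /= [cg dg].
  split=> // q; rewrite inE => Uq.
  apply: (@cvg_comp _ _ _ (fun q => (p, q)) g _ (nbhs (p, q))).
    by apply: cvg_pair; [exact: cvg_cst|exact: cvg_id].
  by apply: cg; rewrite inE.
split.
  move=> q; rewrite inE => Uq.
  apply: (@cvg_comp _ _ _ (fun q => (p, q)) g _ (nbhs (p, q))).
    by apply: cvg_pair; [exact: cvg_cst|exact: cvg_id].
  by apply: cg; rewrite inE.
move=> v; have [dgv Ckv] := dg (0, v).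
have E q : (fun h : R => h^-1 *: (((fun q => g (p, q)) \o shift q) (h *: v) - g (p, q)))
    = (fun h : R => h^-1 *: ((g \o shift (p, q)) (h *: (0, v)) - g (p, q))).
  apply/funext => h /=; congr (_ *: (g _ - _)).
  by congr pair; rewrite /= scaler0 add0r.
split=> [q Uq|]; first by rewrite /derivable E; apply: dgv.
by have := IH _ Ckv; congr (Ck k U' _); apply/funext => q; rewrite /derive -E.
Qed.

(** Derivability is asked near p and not only at p, so that the function ['D_v B] which is
    differentiated again consists of genuine derivatives. *)
Definition derivable2 (V : normedModType R) (B : V -> R) (p v : V) (l : R) :=
  (\forall q \near p, derivable B q v) /\ is_derive p v ('D_v B) l.

Lemma smooth_derivable2 (V : normedModType R) (U : set V) (B : V -> R) (p v : V) :
  open U -> smooth_on U B -> U p -> derivable2 B p v ('D_v ('D_v B) p).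
Proof.
move=> oU sB Up; have [_ /(_ v)[dB [_ /(_ v)[d2B _]]]] := sB 2%N.
split; last by apply/derivableP/d2B.
by apply: filterS (open_nbhs_nbhs (conj oU Up)) => q /dB.
Qed.

Lemma derivable2D (V : normedModType R) (A B : V -> R) p v a b :
  derivable2 A p v a -> derivable2 B p v b -> derivable2 (A \+ B) p v (a + b).
Proof.
move=> [dA d2A] [dB d2B]; split.
  by apply: filterS2 dA dB => q; exact: derivableD.
have : is_derive p v ('D_v A + 'D_v B) (a + b) by exact: is_deriveD.
apply: near_eq_is_derive; apply: filterS2 dA dB => q qA qB.
by rewrite [RHS]deriveD.
Qed.

Lemma derivable2Z (V : normedModType R) (A : V -> R) p v (k a : R) :
  derivable2 A p v a -> derivable2 (fun q => k * A q) p v (k * a).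
Proof.
move=> [dA d2A]; split.
  by apply: filterS dA => q; exact: (@derivableZ _ _ _ _ k).
have : is_derive p v (k *: 'D_v A) (k *: a) by exact: is_deriveZ.
apply: near_eq_is_derive; apply: filterS dA => q qA.
exact: (esym (deriveZ k qA)).
Qed.

Lemma derivable2_near (V : normedModType R) (A B : V -> R) p v a :
  (\forall q \near p, A q = B q) -> derivable2 A p v a -> derivable2 B p v a.
Proof.
move=> /near_join AB [dA d2A]; split.
  by apply: filterS2 AB dA => q; exact: near_eq_derivable.
apply: near_eq_is_derive d2A; apply: filterS AB => q; exact: near_eq_derive.
Qed.

Lemma is_derive_ln_comp (V : normedModType R) (A : V -> R) p v a :
  0 < A p -> is_derive p v A a -> is_derive p v (fun q => ln (A q)) (a / A p).
Proof.
move=> A0 dA.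
have dA0 : is_derive (0 : R) 1 (fun t : R => A (p + t *: v)) a.
  by apply: (is_derive_slice A p v 0 a).1; rewrite scale0r addr0.
have p0 : p = p + (0 : R) *: v by rewrite scale0r addr0.
rewrite {1}p0; apply: (is_derive_slice (fun q => ln (A q)) p v 0 _).2.
have [dAd dAE] := dA0; have [dl lE] : is_derive (A p) 1 (@ln R) (A p)^-1.
  exact: is_derive1_ln.
have cE := @derive1_comp R (fun t : R => A (p + t *: v)) (@ln R) 0.
rewrite /= -p0 !derive1E dAE lE in cE.
split; last by rewrite mulrC; apply: cE.
apply/derivable1_diffP/(@differentiable_comp _ _ _ _ (fun t : R => A (p + t *: v)) (@ln R)).
  exact/derivable1_diffP.
by rewrite -p0; exact/derivable1_diffP.
Qed.

Lemma derivable2_ln (V : normedModType R) (A : V -> R) p v a :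
  0 < A p -> {for p, continuous A} -> derivable2 A p v a ->
  exists l, derivable2 (fun q => ln (A q)) p v l.
Proof.
move=> A0 cA [dA d2A].
have A0n : \forall q \near p, 0 < A q by have /cvgr_gt := cA; apply.
have dln : \forall q \near p, is_derive q v (fun q => ln (A q)) ('D_v A q / A q).
  by apply: filterS2 A0n dA => q Aq dAq; apply: is_derive_ln_comp => //; exact: derivableP.
have [_ dAp] := nbhs_singleton dln.
have dAp0 := nbhs_singleton dA.
exists ('D_v (fun q => 'D_v A q * (A q)^-1) p); split.
  by apply: filterS dln => q [].
have : is_derive p v (fun q => 'D_v A q * (A q)^-1) ('D_v (fun q => 'D_v A q * (A q)^-1) p).
  apply: derivableP; apply: derivableM; first by case: d2A.
  by apply: derivableV => //; rewrite gt_eqF.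
by apply: near_eq_is_derive; apply: filterS dln => q [_ ->].
Qed.

End directional.

(** * Charts and transition maps *)

Section charts.
Context {R : realType} (X : topologicalType).
Implicit Types (c : chart R X) (x : X).

Lemma chart_imgP c z : (c @` cdom c) z -> cdom c (cinv c z) /\ c (cinv c z) = z.
Proof. by move=> [x cx <-]; rewrite cfunK. Qed.

Lemma near_cdom c x : cdom c x -> \forall y \near x, cdom c y.
Proof. by move=> cx; apply: open_nbhs_nbhs; split=> //; exact: cdom_open. Qed.

Lemma near_cinv c x (P : set X) : cdom c x -> (\forall y \near x, P y) ->
  \forall z \near c x, [/\ cdom c (cinv c z), c (cinv c z) = z & P (cinv c z)].
Proof.
move=> cx Px.
have imgx : (c @` cdom c) (c x) by exists x.
have h1 : \forall z \near c x, (c @` cdom c) z.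
  by apply: open_nbhs_nbhs; split=> //; exact: cimg_open.
have h2 : \forall z \near c x, P (cinv c z).
  have /(_ P) := @cinv_cts _ _ c (c x) (mem_set imgx).
  by rewrite cfunK//; apply.
by apply: filterS2 h1 h2 => z /chart_imgP[].
Qed.

Lemma near_cfun c x (P : set R[i]) : cdom c x -> (\forall z \near c x, P z) ->
  \forall y \near x, cdom c y /\ P (c y).
Proof.
move=> cx Px; apply: filterI; first exact: near_cdom.
exact: (@cfun_cts _ _ c x (mem_set cx) P Px).
Qed.

End charts.

Section surfaces.
Context {R : realType}.
Local Notation "'N z" := (Normc.normc z) (at level 10, z at level 8).

Section transition.
Context (X : riemann_surface R).
Implicit Types (c : chart R X) (x : X).

Lemma transition_derivable c1 c2 x : atlas X c1 -> atlas X c2 ->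
  cdom c1 x -> cdom c2 x -> cder (c2 \o cinv c1) (c1 x) (derive1 (c2 \o cinv c1) (c1 x)).
Proof.
move=> a1 a2 x1 x2; apply: derivable_cder.
by have [h _] := atlas_compatible a1 a2; apply: h; exists x.
Qed.

Lemma transition_near_derivable c1 c2 x : atlas X c1 -> atlas X c2 ->
  cdom c1 x -> cdom c2 x -> \forall z \near c1 x,
  cder (c2 \o cinv c1) z (derive1 (c2 \o cinv c1) z).
Proof.
move=> a1 a2 x1 x2; have := near_cinv x1 (near_cdom x2).
apply: filterS => z [d1 zE d2]; rewrite -zE; exact: transition_derivable.
Qed.

Lemma transition_cfun_inv c1 c2 x : cdom c1 x -> cdom c2 x ->
  \forall z \near c1 x, cinv c2 (c2 (cinv c1 z)) = cinv c1 z.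
Proof.
move=> x1 x2; have := near_cinv x1 (near_cdom x2).
by apply: filterS => z [_ _ /cfunK].
Qed.

Lemma chain_rule_chart (F : X -> R[i]) c1 c2 x d : atlas X c1 -> atlas X c2 ->
  cdom c1 x -> cdom c2 x -> cder (F \o cinv c2) (c2 x) d ->
  cder (F \o cinv c1) (c1 x) (d * derive1 (c2 \o cinv c1) (c1 x)).
Proof.
move=> a1 a2 x1 x2 Fd.
have : cder ((F \o cinv c2) \o (c2 \o cinv c1)) (c1 x)
    (d * derive1 (c2 \o cinv c1) (c1 x)).
  by apply: cder_comp; [rewrite /= cfunK|exact: transition_derivable].
apply: wder_near_eq; have := transition_cfun_inv x1 x2.
by apply: filterS => z /= ->.
Qed.

Lemma cder_id (z : R[i]) : cder id z 1.
Proof.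
apply/cderE => e e0; apply: filterE => w.
by rewrite mul1r subrr Normc.normc0 mulr_ge0 ?normc_ge0 ?ltW.
Qed.

Lemma cder_cfun c x : cdom c x -> cder (c \o cinv c) (c x) 1.
Proof.
move=> cx; apply: wder_near_eq (cder_id _).
have := near_cinv cx (near_cdom cx).
by apply: filterS => z [_ /= -> _].
Qed.

Lemma transition_derive_inv c1 c2 x : atlas X c1 -> atlas X c2 ->
  cdom c1 x -> cdom c2 x ->
  derive1 (c1 \o cinv c2) (c2 x) * derive1 (c2 \o cinv c1) (c1 x) = 1.
Proof.
move=> a1 a2 x1 x2.
have := chain_rule_chart a1 a2 x1 x2 (transition_derivable a2 a1 x2 x1).
by move=> /wder_unique /(_ (cder_cfun x1)) [].
Qed.

Lemma transition_derive_neq0 c1 c2 x : atlas X c1 -> atlas X c2 ->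
  cdom c1 x -> cdom c2 x -> derive1 (c2 \o cinv c1) (c1 x) != 0.
Proof.
move=> a1 a2 x1 x2; apply/eqP => d0.
by have /eqP := transition_derive_inv a1 a2 x1 x2; rewrite d0 mulr0 eq_sym oner_eq0.
Qed.

Lemma chart_image_open c : open (chart_image c (cdom c)).
Proof.
apply: open_comp; last exact: cimg_open.
by move=> p _; exact: continuous_plane_to_C.
Qed.

Lemma chart_coordE c x : chart_coord c x = C_to_plane (c x). Proof. by []. Qed.

Lemma chart_paramK c x : cdom c x -> chart_param c (chart_coord c x) = x.
Proof. by move=> cx; rewrite /chart_param chart_coordE C_to_planeK cfunK. Qed.

Lemma chart_image_coord c x : cdom c x -> chart_image c (cdom c) (chart_coord c x).
Proof. by move=> cx; exists x; rewrite // chart_coordE C_to_planeK. Qed.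

Lemma near_chart_param c x (P : set X) : cdom c x -> (\forall y \near x, P y) ->
  \forall q \near chart_coord c x, [/\ cdom c (chart_param c q),
    chart_coord c (chart_param c q) = q & P (chart_param c q)].
Proof.
move=> cx Px; rewrite chart_coordE.
have := near_cinv cx Px; rewrite -[c x in X in X -> _]C_to_planeK => /near_plane_to_C.
apply: filterS => q [h1 h2 h3]; split=> //.
by rewrite chart_coordE h2 plane_to_CK.
Qed.

End transition.

Lemma smooth_on_derive (V : normedModType R) (U : set V) (B : V -> R) v :
  smooth_on U B -> smooth_on U ('D_v B).
Proof. by move=> sB k; have [_ /(_ v)[]] := sB k.+1. Qed.

Lemma smooth_on_continuous (V : normedModType R) (U : set V) (B : V -> R) x :
  smooth_on U B -> U x -> {for x, continuous B}.
Proof. by move=> sB Ux; have [cB _] := sB 0%N; apply: cB; rewrite inE. Qed.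

Lemma smooth_on_derivable (V : normedModType R) (U : set V) (B : V -> R) x v :
  smooth_on U B -> U x -> derivable B x v.
Proof. by move=> sB Ux; have [_ /(_ v)[]] := sB 1%N; move=> + _; apply. Qed.

Lemma smooth_wder (U : set (R * R)) (A : R * R -> R) p : open U -> smooth_on U A ->
  U p -> wder (fun z => (A (C_to_plane z))%:C) (plane_to_C p)
    (wirtinger A p) (conjc (wirtinger A p)).
Proof.
move=> oU sA Up; have Un := open_nbhs_nbhs (conj oU Up).
apply: wder_plane.
- by apply: filterS Un => q; exact: smooth_on_derivable.
- by apply: filterS Un => q; exact: smooth_on_derivable.
- by apply: smooth_on_continuous Up; exact: smooth_on_derive.
- by apply: smooth_on_continuous Up; exact: smooth_on_derive.
Qed.

Lemma wder_cst (a z : R[i]) : wder (fun _ => a) z 0 0.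
Proof.
move=> e e0; apply: filterE => w.
by rewrite subrr !mul0r !subr0 Normc.normc0 mulr_ge0 ?normc_ge0 ?ltW.
Qed.

Lemma wirtinger_wder (U : set (R * R)) (A : R * R -> R) p : open U -> smooth_on U A ->
  U p -> exists a b, wder (fun z => wirtinger A (C_to_plane z)) (plane_to_C p) a b.
Proof.
move=> oU sA Up.
have hx := smooth_wder oU (smooth_on_derive ((1 : R, 0 : R) : R * R) sA) Up.
have hy := smooth_wder oU (smooth_on_derive ((0 : R, 1 : R) : R * R) sA) Up.
have := wder_sub (wder_mul hx (wder_cst (1 / 2) _)) (wder_mul hy (wder_cst ('i%C / 2) _)).
move=> h; eexists; eexists; apply: wder_near_eq h; apply: filterE => z.
have -> : 2 = (2 : R)%:C by rewrite rmorphD rmorph1.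
by rewrite /wirtinger /=; congr (_ +i* _); field.
Qed.

(** * Holomorphy of the derivative of a transition map *)

Section green.
Context (X : riemann_surface R) (G : X -> X -> R).
Hypothesis smoothG : forall c1 c2, atlas X c1 -> atlas X c2 ->
  smooth_on (chart_image c1 (cdom c1) `*` chart_image c2 (cdom c2))
    (fun p => G (chart_param c1 p.1) (chart_param c2 p.2) ^+ 2).
Hypothesis zeroG : simple_zero_on_diagonal G.
Implicit Types (c : chart R X) (x : X).

Lemma green_smooth P c : atlas X c ->
  smooth_on (chart_image c (cdom c)) (fun q => G P (chart_param c q) ^+ 2).
Proof.
move=> ac; have [c0 ac0 cP] := atlas_cover P.
have := smooth_on_slice (smoothG ac0 ac) (chart_image_coord cP).
by rewrite /= chart_paramK.
Qed.

(** The gradient of G(P, .)^2 vanishes at P itself, so P is taken at a small real displacement t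
    from x. There G(P, q)^2 = |p - q|^2 u(p, q)^2 has x-derivative - 2 t u (u - t D), with D the
    derivative of u in its second variable, and u > 0 dominates t D. *)
Lemma green_gradient_neq0 c x : atlas X c -> cdom c x ->
  exists P, 'D_(1, 0) (fun q => G P (chart_param c q) ^+ 2) (chart_coord c x) != 0.
Proof.
move=> ac cx; have [u su uE] := zeroG ac.
set S := chart_image c (cdom c) in su; pose q0 := chart_coord c x.
have Sq0 : S q0 by exact: chart_image_coord.
have u0 : 0 < u (q0, q0) by have [] := uE _ _ cx cx.
have su' : smooth_on (S `*` S) ('D_((0 : R * R), ((1 : R), (0 : R))) u).
  exact: smooth_on_derive.
set u' := 'D_(0, (1, 0)) u in su'.
have SSq0 : (S `*` S) (q0, q0) by [].
pose e1 : R * R := (1, 0).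
have line1 : q0 + t *: e1 @[t --> (0 : R)] --> q0.
  rewrite -[X in _ --> X]addr0 -[X in _ --> q0 + X](scale0r e1).
  by apply: cvgD; [exact: cvg_cst|apply: cvgZr_tmp; exact: cvg_id].
have line : (q0 + t *: e1, q0) @[t --> (0 : R)] --> (q0, q0).
  exact: (cvg_pair line1 (cvg_cst _)).
have cu := cvg_comp _ _ line (smooth_on_continuous su SSq0).
have cu' := cvg_comp _ _ line (smooth_on_continuous su' SSq0).
have h1 : \forall t \near (0 : R), u (q0, q0) / 2 < u (q0 + t *: e1, q0).
  by have /cvgr_gt := cu; apply; lra.
have h2 : \forall t \near (0 : R), `|u' (q0 + t *: e1, q0)| < `|u' (q0, q0)| + 1.
  by have /cvgr_norm_lt := cu'; apply; rewrite ltrDl.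
have h3 : \forall t \near (0 : R), S (q0 + t *: e1).
  exact: (line1 _ (open_nbhs_nbhs (conj (@chart_image_open _ c) Sq0))).
have : \forall t \near (0 : R), (u (q0, q0) / 2 < u (q0 + t *: e1, q0) /\
    `|u' (q0 + t *: e1, q0)| < `|u' (q0, q0)| + 1) /\ S (q0 + t *: e1).
  exact: filterI (filterI h1 h2) h3.
move=> /nbhs_ballP[r /= r0 rP].
have n0 := normr_ge0 (u' (q0, q0)).
have D0 : 0 < `|u' (q0, q0)| + 1 by lra.
pose b := u (q0, q0) / 2 / (`|u' (q0, q0)| + 1).
have b0 : 0 < b by rewrite !divr_gt0.
have bE : b * (`|u' (q0, q0)| + 1) = u (q0, q0) / 2 by rewrite divfK// gt_eqF.
(* The bound r / 2 keeps p where the estimates on u and u' hold; the bound [b] gives |t D| <= u(q0,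
   q0) / 2 < u(p, q0). *)
pose t := Num.min (r / 2) b.
have t0 : 0 < t by rewrite lt_min b0 divr_gt0.
have tr : t <= r / 2 by rewrite ge_min lexx.
have tb : t <= b by rewrite ge_min lexx orbT.
have [|[{}h1 {}h2] {}h3] := rP t.
  by rewrite -ball_normE /= sub0r normrN gtr0_norm//; lra.
pose p := q0 + t *: e1; rewrite -/p in h1 h2 h3.
have [cP cPE] : cdom c (chart_param c p) /\ c (chart_param c p) = plane_to_C p.
  exact: chart_imgP.
exists (chart_param c p).
have nE (z : R[i]) : 'N z ^+ 2 = complex.Re z ^+ 2 + complex.Im z ^+ 2.
  by case: z => a a'; rewrite /= sqr_sqrtr// addr_ge0 ?sqr_ge0.
pose B (q : R * R) := ((p.1 - q.1) ^+ 2 + (p.2 - q.2) ^+ 2) * u (p, q) ^+ 2.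
have AB : \forall q \near q0, B q = G (chart_param c p) (chart_param c q) ^+ 2.
  have := open_nbhs_nbhs (conj (@chart_image_open _ c) Sq0).
  apply: filterS => q Sq; have [cq cqE] := chart_imgP Sq.
  have [_ ->] := uE _ _ cP cq; rewrite exprMn nE ReB ImB.
  have -> : chart_coord c (chart_param c p) = p.
    by rewrite chart_coordE cPE plane_to_CK.
  have qE : chart_coord c (chart_param c q) = q.
    by rewrite chart_coordE cqE plane_to_CK.
  by rewrite qE cPE cqE.
pose D := u' (p, q0).
pose w (s : R) := u (p, q0 + s *: e1).
have dw : is_derive (0 : R) 1 w D.
  have : is_derive (p, q0) (0, e1) u D.
    by apply: derivableP; apply: smooth_on_derivable su _.
  have {1}-> : (p, q0) = (p, q0) + (0 : R) *: (0, e1) by rewrite scale0r addr0.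
  move=> /(is_derive_slice u (p, q0) (0, e1) 0 D).1; congr is_derive.
  apply/funext => s; rewrite /w; congr (u _); congr pair => /=.
  by rewrite scaler0 addr0.
have dt : is_derive (0 : R) 1 (fun s : R => t - s) (0 - 1).
  exact: (@is_deriveB _ _ _ (cst t) id).
have := is_deriveM (is_deriveM dt dt) (is_deriveM dw dw).
set d := (X in is_derive _ _ _ X) => dB.
have {}dB : is_derive q0 e1 B d.
  have {1}-> : q0 = q0 + (0 : R) *: e1 by rewrite scale0r addr0.
  apply: (is_derive_slice B q0 e1 0 d).2; move: dB; congr is_derive.
  apply/funext => s.
  have E1 : p.1 - (q0 + s *: e1).1 = t - s.
    by rewrite /p /= /GRing.scale /= !mulr1; ring.
  have E2 : p.2 - (q0 + s *: e1).2 = 0.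
    by rewrite /p /= /GRing.scale /= !mulr0 subrr.
  by rewrite /B E1 E2 expr0n /= addr0 !expr2.
have [_ ->] := near_eq_is_derive AB dB.
have -> : d = - 2 * t * u (p, q0) * (u (p, q0) - t * D).
  have w0 : w 0 = u (p, q0) by rewrite /w scale0r addr0.
  rewrite (_ : d = ((t - 0) * (t - 0)) * (w 0 * D + w 0 * D) +
    (w 0 * w 0) * ((t - 0) * (0 - 1) + (t - 0) * (0 - 1)))//.
  by rewrite w0; ring.
have tD : `|t * D| <= u (q0, q0) / 2.
  rewrite normrM (gtr0_norm t0) -bE; apply: ler_pM => //; [exact: ltW|exact: ltW].
have := ler_norm (t * D) => tD'.
by rewrite !mulf_neq0//; lra.
Qed.

(** For A = G(P, .)^2 the chain rule reads dA/dz1 = (dA/dz2 o T) T'. With P chosen so that dA/dz2 is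
    not 0 at x, T' is a quotient of functions differentiable over the reals. Its zbar-derivative is
    0 because T is a primitive of T'. *)
Lemma transition_derivable2 c1 c2 x : atlas X c1 -> atlas X c2 ->
  cdom c1 x -> cdom c2 x -> derivable (derive1 (c2 \o cinv c1)) (c1 x) 1.
Proof.
move=> a1 a2 x1 x2; have [P dP] := green_gradient_neq0 a2 x2.
pose A c (q : R * R) := G P (chart_param c q) ^+ 2.
pose T := c2 \o cinv c1; pose D c (z : R[i]) := wirtinger (A c) (C_to_plane z).
have sA c (ac : atlas X c) : smooth_on (chart_image c (cdom c)) (A c) := green_smooth P ac.
have Tx : T (c1 x) = c2 x by rewrite /T /= cfunK.
have Dx : D c2 (T (c1 x)) != 0.
  rewrite Tx; apply: contra_neq dP => /(congr1 (@complex.Re R)) /= /eqP.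
  by rewrite mulf_eq0 invr_eq0 pnatr_eq0 orbF => /eqP.
have DA c y (ac : atlas X c) (cy : cdom c y) :
    wder (fun z => (A c (C_to_plane z))%:C) (c y) (D c (c y)) (conjc (D c (c y))).
  have := smooth_wder (@chart_image_open _ c) (sA _ ac) (chart_image_coord cy).
  by rewrite /D chart_coordE C_to_planeK.
have DD c y (ac : atlas X c) (cy : cdom c y) : exists a b, wder (D c) (c y) a b.
  have := wirtinger_wder (@chart_image_open _ c) (sA _ ac) (chart_image_coord cy).
  by rewrite chart_coordE C_to_planeK.
have Tn := transition_near_derivable a1 a2 x1 x2.
have Tc := wder_continuous (nbhs_singleton Tn).
have xn := near_cinv x1 (near_cdom x2).
have DE : \forall z \near c1 x, D c1 z = D c2 (T z) * derive1 T z.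
  apply: filterS2 xn Tn => z [z1 zE z2] dT.
  have h1 := DA _ _ a1 z1; rewrite zE in h1.
  have h2 := wder_comp (DA _ _ a2 z2 : wder _ (T z) _ _) dT.
  have h3 : \forall v \near z, ((fun z => (A c2 (C_to_plane z))%:C) \o T) v =
      (A c1 (C_to_plane v))%:C.
    have := near_cinv z1 (near_cdom z2); rewrite zE; apply: filterS => v [v1 vE v2].
    by rewrite /= /T /A /chart_param !C_to_planeK /= cfunK.
  by have [<- _] := wder_unique (wder_near_eq h3 h2) h1.
have [a [b Dab]] := DD _ _ a1 x1; have [a' [b' Dab']] := DD _ _ a2 x2.
rewrite -Tx in Dab'.
have D2T := wder_comp Dab' (nbhs_singleton Tn).
have D2T0 : \forall z \near c1 x, D c2 (T z) != 0.
  have : \forall z \near c1 x,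
      'N (D c2 (T z) - D c2 (T (c1 x))) < 'N (D c2 (T (c1 x))).
    by have /continuousCP := wder_continuous D2T; apply; rewrite normc_gt0.
  apply: filterS => z h.
  by apply/eqP => h0; move: h; rewrite h0 sub0r normc_opp ltxx.
have hT := wder_mul Dab (@wder_inv _ (D c2 \o T) _ _ _ Dx D2T).
have h4 : \forall z \near c1 x, D c1 z * (D c2 (T z))^-1 = derive1 T z.
  by apply: filterS2 DE D2T0 => z -> h; rewrite mulrAC mulfV ?mul1r.
have {}hT := wder_near_eq h4 hT.
have b0 := wder_primitive Tn hT.
apply/derivable_cderP; eexists; move: hT; rewrite b0; exact.
Qed.

End green.
End surfaces.

(** * Local biholomorphisms and isogenies *)

Section complex_inverse.
Context {R : realType}.
Implicit Types (z w d : R[i]) (F H : R[i] -> R[i]).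
Local Notation "'N z" := (Normc.normc z) (at level 10, z at level 8).

Lemma cder_expansive F z d : d != 0 -> cder F z d ->
  \forall w \near z, 'N d / 2 * 'N (w - z) <= 'N (F w - F z).
Proof.
rewrite -normc_gt0 => d0 /cderE Fz; have d20 : 0 < 'N d / 2 by lra.
apply: filterS (Fz _ d20) => w h.
have := normcD (d * (w - z) - (F w - F z)) (F w - F z).
have := normcB (d * (w - z)) (F w - F z).
by rewrite subrK Normc.normcM; lra.
Qed.

Lemma cder_isolated F z d : d != 0 -> cder F z d ->
  \forall w \near z, F w = F z -> w = z.
Proof.
move=> d0 Fz; apply: filterS (cder_expansive d0 Fz) => w h FwE.
move: h; rewrite FwE subrr Normc.normc0 => h.
have d0' : 0 < 'N d / 2 by rewrite -normc_gt0 in d0; lra.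
have : 'N (w - z) <= 0 by rewrite -(pmulr_rle0 _ d0').
move=> h'; apply/eqP; rewrite -subr_eq0 -normc_eq0 eq_le h'.
exact: normc_ge0.
Qed.

(* A holomorphic function with non-zero derivative can be moved towards any
   value it does not take, as in the proof of the minimum modulus principle. *)
Lemma cder_min_modulus F z d v : d != 0 -> cder F z d ->
  (\forall w \near z, 'N (F z - v) <= 'N (F w - v)) -> F z = v.
Proof.
move=> d0 /cderE Fz Fmin; apply/eqP; rewrite -subr_eq0 -normc_eq0.
apply/negPn/negP => m0'; have m0 : 0 < 'N (F z - v).
  by rewrite lt_def m0' normc_ge0.
have dn : 0 < 'N d by rewrite normc_gt0.
have e0 : 0 < 'N d / 2 by lra.
have /nearCP[r r0 rP] : \forall w \near z, 'N (F z - v) <= 'N (F w - v) /\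
    'N (F w - F z - d * (w - z)) <= 'N d / 2 * 'N (w - z).
  exact: filterI Fmin (Fz _ e0).
set m := 'N (F z - v) in m0.
(* The point w = z - s (F z - v) / d would bring F from distance m of v to at most (1 - s) m + s m /
   2 < m. The second bound on [s] keeps w within r / 2 of z. *)
pose s := Num.min (1 / 2) (r / 2 * 'N d / m).
have s0 : 0 < s by rewrite lt_min !divr_gt0 ?mulr_gt0//; lra.
have s1 : s <= 1 / 2 by rewrite ge_min lexx.
have s2 : s <= r / 2 * 'N d / m by rewrite ge_min lexx orbT.
have s3 : s * m / 'N d <= r / 2.
  by rewrite ler_pdivrMr// -ler_pdivlMr.
pose w := z - s%:C * (F z - v) / d.
have wz : w - z = - (s%:C * (F z - v) / d) by rewrite /w; ring.
have Nwz : 'N (w - z) = s * m / 'N d.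
  by rewrite wz normc_opp !Normc.normcM normc_real Normc.normcV gtr0_norm.
have [|h1 h2] := rP w; first by rewrite Nwz; lra.
have FwE : F w - v = (F w - F z - d * (w - z)) + (1 - s)%:C * (F z - v).
  by rewrite wz rmorphB rmorph1; field.
have := normcD (F w - F z - d * (w - z)) ((1 - s)%:C * (F z - v)).
rewrite -FwE Normc.normcM normc_real ger0_norm; last by lra.
have h3 : 'N d / 2 * 'N (w - z) = s * m / 2.
  by rewrite Nwz; field; rewrite gt_eqF.
rewrite h3 in h2; rewrite -/m in h1 *; have : 0 < s * m by rewrite mulr_gt0.
by nra.
Qed.

Lemma cder_inverse F H w d : d != 0 -> cder F (H w) d -> {for w, continuous H} ->
  (\forall v \near w, F (H v) = v) -> cder H w d^-1.
Proof.
move=> d0 Fd cH FH; apply/cderE => e e0.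
have dn : 0 < 'N d by rewrite normc_gt0.
pose e1 := e * ('N d / 2) * 'N d.
have e10 : 0 < e1 by rewrite !mulr_gt0//; lra.
have h1 := cH _ (cder_expansive d0 Fd); have h2 := cH _ ((cderE _ _ _).1 Fd _ e10).
have FHw := nbhs_singleton FH.
apply: filterS3 FH h1 h2 => v FHv h1 h2; rewrite /= FHv FHw in h1 h2.
rewrite (_ : _ - _ - _ = - d^-1 * (v - w - d * (H v - H w))); last by field.
rewrite Normc.normcM normc_opp Normc.normcV mulrC ler_pdivrMr//.
apply: le_trans h2 _; rewrite [leRHS]mulrAC.
rewrite (_ : e1 * _ = e * 'N d * ('N d / 2 * 'N (H v - H w))); last first.
  by rewrite /e1; ring.
by rewrite ler_wpM2l// mulr_ge0// ltW.
Qed.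

End complex_inverse.

Section local_coordinates.
Context {R : realType}.
Local Notation "'N z" := (Normc.normc z) (at level 10, z at level 8).

Section one_map.
Context (X Y : riemann_surface R) (h : X -> Y).
Implicit Types (x : X).

(* h is locally biholomorphic: the coordinates of Y, composed with h, are
   coordinates of X. *)
Definition local_biholomorphism := forall x c' (W : set X),
  atlas Y c' -> cdom c' (h x) -> nbhs x W ->
  exists c, [/\ atlas X c, cdom c x, cdom c `<=` W, cdom c `<=` h @^-1` cdom c' &
    cfun c = c' \o h].

Lemma open_chart_image (Z : topologicalType) (c : chart R Z) (V : set Z) :
  open V -> V `<=` cdom c -> open (c @` V).
Proof.
move=> oV Vc; rewrite openE => _ [y Vy <-].
have := near_cinv (Vc _ Vy) (open_nbhs_nbhs (conj oV Vy)).
by apply: filterS => z [_ zE Vz]; exists (cinv c z).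
Qed.

(** Here the maximality of the atlas enters: c' o h on U is compatible with every chart as soon as h
    and its inverse k on U are holomorphic in charts. *)
Lemma chart_of_map c' (U : set X) (k : Y -> X) :
  atlas Y c' -> open U -> open (h @` U) -> h @` U `<=` cdom c' ->
  (forall x, U x -> k (h x) = x) ->
  (forall x, U x -> {for x, continuous h}) ->
  (forall x, U x -> {for h x, continuous k}) ->
  (forall c x, atlas X c -> U x -> cdom c x ->
     derivable (c' \o h \o cinv c) (c x) 1) ->
  (forall c x, atlas X c -> U x -> cdom c x ->
     derivable (c \o k \o cinv c') (c' (h x)) 1) ->
  exists c, [/\ atlas X c, cdom c = U & cfun c = c' \o h].
Proof.
move=> a' oU oV Vc kh ch ck hol1 hol2.
have Uc x : U x -> cdom c' (h x) by move=> Ux; apply: Vc; exists x.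
have o1 : open ((c' \o h) @` U).
  by rewrite -image_comp; exact: open_chart_image.
have K1 x : U x -> (k \o cinv c') ((c' \o h) x) = x.
  by move=> Ux; rewrite /= cfunK ?kh//; exact: Uc.
have c1 : {in U, continuous (c' \o h)}.
  move=> x /[!inE] Ux; apply: continuous_comp; first exact: ch.
  by apply: (@cfun_cts _ _ c'); rewrite inE; exact: Uc.
have c2 : {in (c' \o h) @` U, continuous (k \o cinv c')}.
  move=> _ /[!inE] -[x Ux <-]; apply: continuous_comp.
    by apply: (@cinv_cts _ _ c'); rewrite inE; exists (h x) => //; exact: Uc.
  by rewrite /= cfunK; [exact: ck|exact: Uc].
exists (Chart oU o1 K1 c1 c2); split => //.
apply: atlas_maximal => c ac; split => /= z.
- by move=> [x [Ux cx] <-]; exact: hol2.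
- by move=> [x [Ux cx] <-]; exact: hol1.
Qed.

Hypothesis hloc : local_biholomorphism.

Lemma local_biholomorphism_cinv c c' (z : R[i]) : cdom c `<=` h @^-1` cdom c' ->
  cfun c = c' \o h -> (c @` cdom c) z -> h (cinv c z) = cinv c' z.
Proof.
move=> cc' cE /chart_imgP[cz zE].
by rewrite -[in RHS]zE cE /= cfunK//; exact: cc'.
Qed.

Lemma local_biholomorphism_open x (W : set X) : nbhs x W -> nbhs (h x) (h @` W).
Proof.
move=> Wx; have [c' a' cx'] := atlas_cover (h x).
have [c [ac cx cW cc' cE]] := hloc a' cx' Wx.
have imx : (c @` cdom c) (c' (h x)) by exists x => //; rewrite cE.
have := near_cfun cx' (open_nbhs_nbhs (conj (@cimg_open _ _ c) imx)).
apply: filterS => y [cy' yc].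
exists (cinv c (c' y)); first by apply: cW; have [] := chart_imgP yc.
by rewrite (local_biholomorphism_cinv cc' cE yc) cfunK.
Qed.

Lemma local_biholomorphism_inj x :
  exists U : set X, [/\ open U, U x & forall y z, U y -> U z -> h y = h z -> y = z].
Proof.
have [c' a' cx'] := atlas_cover (h x).
have [c [ac cx cW cc' cE]] := hloc a' cx' (filterT : nbhs x setT).
exists (cdom c); split; [exact: cdom_open|exact: cx|].
by move=> y z cy cz hyz; rewrite -(cfunK cy) -(cfunK cz) cE /= hyz.
Qed.

Lemma local_biholomorphism_continuous : continuous h.
Proof.
move=> x W Wx; have [c' a' cx'] := atlas_cover (h x).
have [c [ac cx cW cc' cE]] := hloc a' cx' (filterT : nbhs x setT).
have := near_cinv cx' Wx; rewrite -[c' (h x)]/((c' \o h) x) -cE.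
move=> /(near_cfun cx); apply: filterS => y [cy [_ _ +]].
by rewrite cE /= cfunK//; exact: cc'.
Qed.

End one_map.

Section translations.
Context (X : riemann_surface R) (L : group_law X).
Implicit Types (c : chart R X) (a x : X).
Local Notation "a +% b" := (gadd L a b) (at level 50, left associativity).
Local Notation "-% a" := (gopp L a) (at level 35).

Lemma gaddKl a x : -% a +% (a +% x) = x.
Proof. by rewrite gaddA gaddN gadd0. Qed.

Lemma gaddNKl a x : a +% (-% a +% x) = x.
Proof. by rewrite gaddA (gaddC _ a) gaddN gadd0. Qed.

Lemma gaddI a : injective (gadd L a).
Proof. by move=> x y /(congr1 (gadd L (-% a))); rewrite !gaddKl. Qed.

Lemma translation_continuous a : continuous (gadd L a).
Proof.
move=> x; apply: (@cvg_comp _ _ _ (fun y => (a, y)) (fun p => gadd L p.1 p.2) _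
  (nbhs (a, x))); last exact: (@gadd_cts _ _ L (a, x)).
exact: (cvg_pair (cvg_cst a) cvg_id).
Qed.

Lemma translation_derivable a c c' x : atlas X c -> atlas X c' -> cdom c x ->
  cdom c' (a +% x) -> derivable (c' \o gadd L a \o cinv c) (c x) 1.
Proof.
move=> ac ac' cx cax; have [ca aca cca] := atlas_cover a.
have := gadd_holomorphic aca ac ac' cca cx cax.
set F := (fun p : R[i] * R[i] => _) => dF; apply/derivable1_diffP.
have -> : c' \o gadd L a \o cinv c = F \o (fun z => (ca a, z)).
  by apply/funext => z; rewrite /F /= cfunK.
by apply: differentiable_comp; [apply: differentiable_pair|].
Qed.

Lemma translation_local_biholomorphism a : local_biholomorphism (gadd L a).
Proof.
move=> x c' W ac' cx' Wx.
pose U := W° `&` (gadd L a @^-1` cdom c').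
have oU : open U.
  apply: openI; first exact: open_interior.
  apply: open_comp; last exact: cdom_open.
  by move=> y _; exact: translation_continuous.
have UE : gadd L a @` U = gadd L (-% a) @^-1` U.
  apply/seteqP; split => [_ [y Uy <-]|y Uy] /=; first by rewrite gaddKl.
  by exists (-% a +% y); rewrite // gaddNKl.
have [|||||||||c [ac cU cE]] := @chart_of_map X X (gadd L a) c' U (gadd L (-% a)).
- by [].
- by [].
- rewrite UE; apply: open_comp => // y _; exact: translation_continuous.
- by move=> _ [y [_ cy] <-].
- by move=> y _; exact: gaddKl.
- by move=> y _; exact: translation_continuous.
- by move=> y _; exact: translation_continuous.
- by move=> c y ac [_ cy'] cy; exact: translation_derivable.
- move=> c y ac [_ cy'] cy; apply: translation_derivable => //.
  by rewrite gaddKl.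
exists c; rewrite cU; split; [exact: ac| | | |exact: cE].
- by rewrite /U; split => //; exact: nbhs_interior.
- by move=> y [/interior_subset].
- by move=> y [].
Qed.

End translations.

(** * Isogenies are open and locally biholomorphic *)

Section isogenies.
Context (X Y : riemann_surface R) (L : group_law X) (L' : group_law Y) (f : X -> Y).
Hypothesis cX : compact [set: X].
Hypothesis isog : isogeny L L' f.
Implicit Types (x : X).
Local Notation "a +% b" := (gadd L a b) (at level 50, left associativity).
Local Notation "-% a" := (gopp L a) (at level 35).

Lemma isogeny_continuous : continuous f.
Proof. by case: isog => -[]. Qed.

Lemma isogenyD x y : f (x +% y) = gadd L' (f x) (f y).
Proof. by case: isog. Qed.

Lemma isogeny_cder c c' x : atlas X c -> atlas Y c' -> cdom c x -> cdom c' (f x) ->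
  cder (c' \o f \o cinv c) (c x) (derive1 (c' \o f \o cinv c) (c x)).
Proof.
move=> ac ac' cx cx'; apply: derivable_cder.
by case: isog => -[_ h] _ _; apply: h => //; exists x.
Qed.

(** With a = x2 - x1, f is the composite of translation by -a, f, and translation by f a. The chain
    rule at x2 then passes through the derivative of f at x1. *)
Lemma isogeny_derive0 c1 c1' x1 c2 c2' x2 :
  atlas X c1 -> atlas Y c1' -> cdom c1 x1 -> cdom c1' (f x1) ->
  atlas X c2 -> atlas Y c2' -> cdom c2 x2 -> cdom c2' (f x2) ->
  derive1 (c1' \o f \o cinv c1) (c1 x1) = 0 ->
  derive1 (c2' \o f \o cinv c2) (c2 x2) = 0.
Proof.
move=> a1 a1' d1 d1' a2 a2' d2 d2' df0.
pose a := x2 +% -% x1.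
have aE y : gadd L' (f a) (f (-% a +% y)) = f y by rewrite -isogenyD gaddNKl.
have x1E : -% a +% x2 = x1.
  apply: (@gaddI X L a); rewrite gaddNKl /a -gaddA gaddN.
  by rewrite gaddC gadd0.
have h1 := isogeny_cder a1 a1' d1 d1'; rewrite df0 in h1.
have d1x : cdom c1 (-% a +% x2) by rewrite x1E.
have d2x : cdom c2' (gadd L' (f a) (f x1)) by rewrite -x1E aE.
have h2 := derivable_cder (translation_derivable a2 a1 d2 d1x).
have h3 := derivable_cder (translation_derivable a1' a2' d1' d2x).
have E1 : (c1 \o gadd L (-% a) \o cinv c2) (c2 x2) = c1 x1.
  by rewrite /= cfunK// x1E.
have E2 : (c1' \o f \o cinv c1) (c1 x1) = c1' (f x1) by rewrite /= cfunK.
rewrite -E2 in h3; have := cder_comp h3 h1; rewrite mulr0 -E1 => h4.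
have := cder_comp h4 h2; rewrite mul0r => h5.
apply: derive1_cder; apply: wder_near_eq h5.
have n1 : \forall y \near x1, cdom c1 y /\ cdom c1' (f y).
  apply: filterI; first exact: near_cdom.
  exact: (isogeny_continuous (near_cdom d1')).
have : \forall y \near x2, cdom c1 (-% a +% y) /\ cdom c1' (f (-% a +% y)).
  by rewrite -x1E in n1; exact: (translation_continuous n1).
move=> /(near_cinv d2); apply: filterS => z [_ _ [z1 z2]].
by rewrite /= cfunK// cfunK// aE.
Qed.

(** A zero of the derivative at one point propagates to all points, so f is locally constant by the
    mean value inequality, hence constant since X is connected; an isogeny is not. *)
Lemma isogeny_derive_neq0 c c' x : atlas X c -> atlas Y c' -> cdom c x ->
  cdom c' (f x) -> derive1 (c' \o f \o cinv c) (c x) != 0.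
Proof.
move=> ac ac' cx cx'; apply/eqP => df0.
have loc y : \forall z \near y, f z = f y.
  have [c1 a1 d1] := atlas_cover y; have [c2 a2 d2] := atlas_cover (f y).
  pose T := c2 \o f \o cinv c1.
  have : \forall z \near c1 y, cdom c2 (f (cinv c1 z)) /\ cder T z 0.
    have := near_cinv d1 (isogeny_continuous (near_cdom d2)).
    apply: filterS => z [z1 zE z2]; split => //.
    have := isogeny_cder a1 a2 z1 z2; rewrite zE.
    have := isogeny_derive0 ac ac' cx cx' a1 a2 z1 z2 df0; rewrite zE /T.
    by move=> ->.
  move=> /nearCP[r r0 rP].
  have rT w : 'N (w - c1 y) < r -> T w = T (c1 y).
    move=> wr; apply/eqP; rewrite -subr_eq0 -normc_eq0 eq_le normc_ge0 andbT.
    rewrite -(mul0r ('N (w - c1 y))); apply: cder_mean_value => s /andP[s0 s1].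
    exists 0; last by rewrite Normc.normc0.
    have [|_ h] := rP (c1 y + s%:C * (w - c1 y)); last exact: h.
    rewrite [c1 y + _]addrC addrK Normc.normcM normc_real ger0_norm//.
    by apply: le_lt_trans wr; rewrite ler_piMl// normc_ge0.
  have : \forall w \near c1 y, T w = T (c1 y) /\ cdom c2 (f (cinv c1 w)).
    by apply/nearCP; exists r => // w wr; split; [exact: rT|have [] := rP w wr].
  move=> /(near_cfun d1); apply: filterS => z [z1 [zE z2]].
  move: zE z2; rewrite /T /= !cfunK// => zE z2.
  by rewrite -(cfunK z2) zE cfunK.
have [_ [x1 [x2 /eqP f12]] _] := isog; apply: f12.
have ofc (P : set Y) : open (f @^-1` P).
  by rewrite openE => y Py; apply: filterS (loc y) => z /= ->.
have : [set z | f z = f x2] = [set: X].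
  apply: (@rs_connected _ X); first by exists x2.
  - by exists (f @^-1` [set f x2]); [exact: ofc|rewrite setTI].
  - exists (f @^-1` [set f x2]); last by rewrite setTI.
    by rewrite -[X in closed X]setCK; apply: open_closedC; exact: (ofc (~` [set f x2])).
by move/seteqP => [_ /(_ x1 I)].
Qed.

(** A non-zero derivative at the origin only shows that the origin is isolated in the kernel. Near x
    this suffices: if f y = f z then -y + z lies in the kernel and is close to the origin. *)
Lemma isogeny_locally_injective x :
  exists U : set X, [/\ open U, U x & forall y z, U y -> U z -> f y = f z -> y = z].
Proof.
pose o := gzero L.
have [c ac co] := atlas_cover o; have [c' ac' co'] := atlas_cover (f o).
have d0 := isogeny_derive_neq0 ac ac' co co'.
have ker : \forall k \near o, f k = f o -> k = o.
  have /(near_cfun co) := cder_isolated d0 (isogeny_cder ac ac' co co').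
  apply: filterS => k [ck kE] fk; rewrite -(cfunK ck) -[RHS](cfunK co).
  by rewrite kE //= !cfunK// fk.
have h : \forall p \near (x, x), f (-% p.1 +% p.2) = f o -> -% p.1 +% p.2 = o.
  have cD : {for (x, x), continuous (fun p : X * X => -% p.1 +% p.2)}.
    apply: (@cvg_comp _ _ _ (fun p : X * X => (-% p.1, p.2))
      (fun p => gadd L p.1 p.2) _ (nbhs (-% x, x))).
      apply: (@cvg_pair _ _ _ _ (nbhs (-% x)) (nbhs x)).
        apply: (@cvg_comp _ _ _ (fun p : X * X => p.1) (gopp L) _ (nbhs x)).
          exact: cvg_fst.
        exact: gopp_cts.
      exact: cvg_snd.
    exact: (@gadd_cts _ _ L (-% x, x)).
  have := cD [set k | f k = f o -> k = o]; rewrite /= gaddN.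
  by move=> /(_ ker).
have [[U V] /= [Ux Vx] UV] := h.
exists ((U `&` V)°); split; first exact: open_interior.
  exact: (filterI Ux Vx).
move=> y z /interior_subset [Uy Vy] /interior_subset [Uz Vz] fyz.
have := UV (y, z) (conj Uy Vz) => /=; rewrite isogenyD -fyz -isogenyD gaddN.
by move=> /(_ erefl) yz; rewrite -(gaddNKl L y z) yz gaddC gadd0.
Qed.

(** Let K be a compact neighbourhood of x on which f is injective, and m > 0 a lower bound of the
    distance from f to f x, in the chart c', off the interior of V. For y within m / 2 of f x, the
    distance from f to y has its minimum over K in the interior of V, and [cder_min_modulus] makes
    that minimum 0. *)
Lemma isogeny_open x (W : set X) : nbhs x W -> nbhs (f x) (f @` W).
Proof.
move=> Wx; have [c' ac' cx'] := atlas_cover (f x).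
have [U [oU Ux Uinj]] := isogeny_locally_injective x.
pose A := (U `&` W) `&` f @^-1` cdom c'.
have Ax : nbhs x A.
  apply: filterI; last exact: (isogeny_continuous (near_cdom cx')).
  by apply: filterI => //; exact: open_nbhs_nbhs.
have [V Vx VA] := compact_regular (@rs_hausdorff _ X) cX filterT Ax.
pose K := closure V.
have cK : compact K by apply: (subclosed_compact _ cX) => //; exact: closed_closure.
have Kx : K x by apply: subset_closure; exact: nbhs_singleton.
have KA : K `<=` A by [].
pose B := K `&` ~` V°.
have cB : compact B.
  apply: (compact_closedI cK); rewrite -[X in closed X]setCK setCK.
  by apply: open_closedC; exact: open_interior.
have dist_cts w : {within K, continuous (fun y => 'N (c' (f y) - w))}.
  apply: continuous_in_subspaceT => y /[!inE] /KA [_ cy'] S.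
  move=> /nbhs_ballP[e /= e0 eS].
  have /continuousCP/(_ e e0) : {for y, continuous (c' \o f)}.
    apply: continuous_comp; first exact: isogeny_continuous.
    by apply: (@cfun_cts _ _ c'); rewrite inE.
  apply: filterS => z zy; apply: eS; rewrite -ball_normE /=.
  have h1 := normcD (c' (f z) - w) (c' (f y) - c' (f z)).
  have h2 := normcD (c' (f y) - w) (c' (f z) - c' (f y)).
  have h3 := normcB (c' (f y)) (c' (f z)).
  rewrite [_ + (_ - _)]addrC subrKA in h1; rewrite [_ + (_ - _)]addrC subrKA in h2.
  by rewrite /= in zy; rewrite ltr_norml; lra.
have [m m0 mB] : exists2 m : R, 0 < m & forall y, B y -> m <= 'N (c' (f y) - c' (f x)).
  have [->|/set0P B0] := eqVneq B set0; first by exists 1.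
  have dB : {within B, continuous (fun y => 'N (c' (f y) - c' (f x)))}.
    by apply: continuous_subspaceW (dist_cts _) => y [].
  have [y /[!inE] By ymin] := compact_EVT_min B0 cB dB.
  exists ('N (c' (f y) - c' (f x))); last by move=> z Bz; apply: ymin; rewrite inE.
  rewrite normc_gt0 subr_eq0; apply/eqP => /(congr1 (cinv c')).
  have [Ky nVy] := By; have [[Uy _] cy'] := KA _ Ky.
  rewrite !cfunK// => /(Uinj _ _ Uy Ux) yx; apply: nVy; rewrite yx.
  exact: Vx.
have m20 : 0 < m / 2 by lra.
have near_fx : \forall w \near c' (f x), 'N (w - c' (f x)) < m / 2.
  by apply/nearCP; exists (m / 2).
apply: filterS (near_cfun cx' near_fx) => y [cy' yx].
have K0 : K !=set0 by exists x.
have [k /[!inE] Kk kmin] := compact_EVT_min K0 cK (dist_cts (c' y)).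
have [[Uk Wk] ck'] := KA _ Kk; exists k => //.
have kx : 'N (c' (f k) - c' y) < m / 2.
  by apply: le_lt_trans (kmin x _) _; rewrite ?inE// normcB.
have Vk : V° k.
  apply: contrapT => nVk; have := mB k (conj Kk nVk).
  have := normcD (c' (f k) - c' y) (c' y - c' (f x)).
  by rewrite subrKA; lra.
have [c ac ck] := atlas_cover k.
suff: c' (f k) = c' y by move=> /(congr1 (cinv c')); rewrite !cfunK.
have := cder_min_modulus (v := c' y) (isogeny_derive_neq0 ac ac' ck ck')
  (isogeny_cder ac ac' ck ck').
rewrite /= cfunK//; apply.
have := near_cinv ck (open_nbhs_nbhs (conj (open_interior V) Vk)).
apply: filterS => z [_ _ Vz]; apply: kmin; rewrite inE.
by apply: subset_closure; exact: interior_subset.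
Qed.

Lemma isogeny_surjective y : exists x, f x = y.
Proof.
have : f @` [set: X] = [set: Y].
  apply: (@rs_connected _ Y); first by exists (f point); exists point.
  - exists (f @` [set: X]); last by rewrite setTI.
    by rewrite openE => _ [x _ <-]; exact: isogeny_open filterT.
  - exists (f @` [set: X]); last by rewrite setTI.
    apply: compact_closed; first exact: rs_hausdorff.
    apply: continuous_compact cX; apply: continuous_subspaceT.
    exact: isogeny_continuous.
by move/seteqP => [_ /(_ y I)] [x _ <-]; exists x.
Qed.

Lemma isogeny_chart (c' : chart R Y) (U : set X) : atlas Y c' -> open U ->
  U `<=` f @^-1` cdom c' -> (forall y z, U y -> U z -> f y = f z -> y = z) ->
  exists c, [/\ atlas X c, cdom c = U & cfun c = c' \o f].
Proof.
move=> ac' oU Uc' Uinj.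
(* The inverse of f on U; outside f(U) it takes the default value [point], and only its values near
   f(U) are examined. *)
pose k (y : Y) := xget point [set u | U u /\ f u = y].
have kf u : U u -> k (f u) = u.
  move=> Uu; rewrite /k; case: xgetP => [v _ [Uv fv]|/(_ u)/=]; first exact: Uinj.
  by move=> /(_ (conj Uu erefl)).
apply: (@chart_of_map _ _ f c' U k).
- exact: ac'.
- exact: oU.
- rewrite openE => _ [u Uu <-]; apply: isogeny_open.
  by apply: open_nbhs_nbhs.
- by move=> _ [u /Uc' cu <-].
- exact: kf.
- by move=> u _; exact: isogeny_continuous.
- move=> u Uu S; rewrite kf// => Su.
  have h : nbhs (f u) (f @` (S `&` U)).
    by apply: isogeny_open; apply: filterI => //; exact: open_nbhs_nbhs.
  have sub : f @` (S `&` U) `<=` k @^-1` S by move=> _ [v [Sv Uv] <-]; rewrite /= kf.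
  exact: (filterS sub h).
- move=> c u ac /Uc' cu' cu.
  by apply/derivable_cderP; eexists; exact: isogeny_cder.
- move=> c u ac Uu cu; have cu' := Uc' _ Uu.
  apply/derivable_cderP; eexists.
  have d0 := isogeny_derive_neq0 ac ac' cu cu'.
  have k0 : (c \o k \o cinv c') (c' (f u)) = c u by rewrite /= cfunK// kf.
  apply: (@cder_inverse _ (c' \o f \o cinv c) _ _ _ d0).
  + by rewrite k0; exact: isogeny_cder.
  + apply/continuousCP => e e0; rewrite k0.
    have nu : \forall z \near u, 'N (c z - c u) < e.
      have := @cfun_cts _ _ c u (mem_set cu).
      by move=> /continuousCP; apply.
    have nV : nbhs (f u) (f @` ([set z | 'N (c z - c u) < e] `&` U)).
      by apply: isogeny_open; apply: filterI => //; exact: open_nbhs_nbhs.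
    have := near_cinv cu' nV; apply: filterS => z [_ _ [v [vu Uv] /= <-]].
    by rewrite kf.
  + have nU : nbhs (f u) (f @` (cdom c `&` U)).
      apply: isogeny_open; apply: filterI; first exact: near_cdom.
      exact: open_nbhs_nbhs.
    have := near_cinv cu' nU; apply: filterS => z [_ zE [v [cv Uv] /= vE]].
    by rewrite -vE kf// cfunK// vE.
Qed.

Lemma isogeny_local_biholomorphism : local_biholomorphism f.
Proof.
move=> x c' W ac' cx' Wx.
have [U0 [oU0 U0x Uinj]] := isogeny_locally_injective x.
pose U := (U0 `&` W°) `&` (f @^-1` cdom c').
have oU : open U.
  apply: openI; first by apply: openI => //; exact: open_interior.
  by apply: open_comp; [move=> y _; exact: isogeny_continuous|exact: cdom_open].
have [||c [ac cU cE]] := @isogeny_chart c' U ac' oU.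
- by move=> y [].
- by move=> y z [[Uy _] _] [[Uz _] _]; exact: Uinj.
exists c; rewrite cU; split; [exact: ac| | | |exact: cE].
- by rewrite /U; split => //; split => //; exact: nbhs_interior.
- by move=> y [[_ /interior_subset]].
- by move=> y [].
Qed.

End isogenies.
End local_coordinates.

(** * Holomorphic forms and fibres *)

Section forms.
Context {R : realType}.
Local Notation "'N z" := (Normc.normc z) (at level 10, z at level 8).

Lemma mulr_conj_normc (z : R[i]) : z * (z^*)%R = ('N z ^+ 2)%:C.
Proof. by rewrite normc_sqr. Qed.

(** The canonical form comes with a basis of its own, of unspecified length g. Two of its members
    would both be multiples of the single form given by genus 1, hence linearly dependent. *)
Lemma forms_basis_size (X : riemann_surface R) (g : nat) (w : 'I_g -> coef_form X) :
  has_genus X 1 -> forms_basis w -> (g <= 1)%N.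
Proof.
move=> [w1 [hw1 bw1]] [hw bw]; case: g w hw bw => [|[|g]] w hw bw //; exfalso.
pose i : 'I_g.+2 := ord0; pose j : 'I_g.+2 := lift ord0 ord0.
have ij : i != j by [].
have aE k : exists a : R[i], forall c x, atlas X c -> cdom c x ->
    w k c x = a * w1 ord0 c x.
  have [a [aE _]] := bw1 _ (hw k); exists (a ord0) => c x ac cx.
  by rewrite aE// big_ord1.
have [ai aiE] := aE i; have [aj ajE] := aE j.
(* [A] and [B] are two expressions of w_j: the obvious one, and either w_j + w_i if w_i = 0, or (aj
   / ai) w_i otherwise. *)
pose A : {ffun 'I_g.+2 -> R[i]} := [ffun k => (k == j)%:R].
pose B : {ffun 'I_g.+2 -> R[i]} := if ai == 0 then [ffun k => (k == j)%:R + (k == i)%:R]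
  else [ffun k => (k == i)%:R * (aj / ai)].
have delta k c x (b : R[i]) : \sum_l (l == k)%:R * b * w l c x = b * w k c x.
  rewrite (bigD1 k)//= eqxx mul1r big1 ?addr0// => l /negbTE ->.
  by rewrite !mul0r.
have [C [_ Cuniq]] := bw _ (hw j).
have AC : A = C.
  apply/esym/Cuniq => c x ac cx; rewrite -[LHS]mul1r -delta.
  by apply: eq_bigr => l _; rewrite ffunE mulr1.
have BC : B = C.
  apply/esym/Cuniq => c x ac cx; rewrite /B; case: eqP => [ai0|/eqP ai0].
    under eq_bigr do rewrite ffunE mulrDl.
    rewrite big_split /=; under eq_bigr do rewrite -[_%:R]mulr1.
    rewrite delta mul1r; under [X in _ + X]eq_bigr do rewrite -[_%:R]mulr1.
    by rewrite delta mul1r aiE// ai0 mul0r addr0.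
  under eq_bigr do rewrite ffunE.
  by rewrite delta aiE// ajE// mulrA divfK.
have ji : (j == i) = false by [].
move: (etrans AC (esym BC)); rewrite /A /B; case: ifP => _ AB.
  have := congr1 (fun a : {ffun 'I_g.+2 -> R[i]} => a i) AB.
  by rewrite !ffunE eqxx (negbTE ij) add0r => /eqP; rewrite eq_sym oner_eq0.
have := congr1 (fun a : {ffun 'I_g.+2 -> R[i]} => a j) AB.
by rewrite !ffunE eqxx ji mul0r => /eqP; rewrite oner_eq0.
Qed.

Definition form_spans (X : riemann_surface R) (w : coef_form X) :=
  [/\ holomorphic_form w,
      forall e : coef_form X, holomorphic_form e -> exists a : R[i],
        forall c x, atlas X c -> cdom c x -> e c x = a * w c x &
      exists c x, [/\ atlas X c, cdom c x & w c x != 0]].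

Lemma arakelov_form_genus1 (X : riemann_surface R) (mu : coef_form X) :
  has_genus X 1 -> arakelov_form mu -> exists w : coef_form X,
  [/\ form_spans w, real_integral (fun c x => 'N (w c x) ^+ 2) 1 &
      mu = fun c x => 'i%C / 2 * ('N (w c x) ^+ 2)%:C].
Proof.
move=> gX [g [w [g0 bw ow muE]]]; have := forms_basis_size gX bw.
case: g w g0 bw ow muE => [|[|g]] w // _ [hw bw] ow muE _.
exists (w ord0); split.
- split => //.
    move=> e /bw [a [aE _]]; exists (a ord0) => c x ac cx.
    by rewrite aE// big_ord1.
  apply: contrapT => wn0; have w0 c x : atlas X c -> cdom c x -> w ord0 c x = 0.
    by move=> ac cx; apply: contrapT => /eqP wcx; apply: wn0; exists c, x.
  (* If w vanished identically, the coefficients 0 and 1 would both express it, against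
     uniqueness. *)
  have [C [_ Cuniq]] := bw _ (hw ord0).
  have : [ffun=> 0] = [ffun=> 1] :> {ffun 'I_1 -> R[i]}.
    transitivity C; [apply/esym|]; apply: Cuniq => c x ac cx;
      by rewrite big_ord1 w0// mulr0.
  move=> /ffunP/(_ ord0); rewrite !ffunE => /eqP.
  by rewrite eq_sym oner_eq0.
- have [+ _] := ow ord0 ord0; rewrite eqxx; congr real_integral.
  apply/funext => c; apply/funext => x; rewrite /wedge_conj.
  rewrite mulr_conj_normc; set n := ('N _ ^+ 2)%:C.
  rewrite (_ : - _ = n)// -[RHS]opprK; congr (- _).
  rewrite [LHS](_ : _ = 'i%C ^+ 2 * n); last by rewrite -complexiE; field.
  by rewrite sqr_i mulN1r.
- rewrite muE; apply/funext => c; apply/funext => x.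
  by rewrite mulr1 big_ord1 /wedge_conj mulr_conj_normc -complexiE.
Qed.

Section pullback.
Context (X Y : riemann_surface R) (h : X -> Y) (G : X -> X -> R).
Hypothesis smoothG : forall c1 c2, atlas X c1 -> atlas X c2 ->
  smooth_on (chart_image c1 (cdom c1) `*` chart_image c2 (cdom c2))
    (fun p => G (chart_param c1 p.1) (chart_param c2 p.2) ^+ 2).
Hypothesis zeroG : simple_zero_on_diagonal G.
Hypothesis hloc : local_biholomorphism h.

Lemma local_biholomorphism_transition (c : chart R X) (c' : chart R Y) x :
  atlas X c -> atlas Y c' -> cdom c x -> cdom c' (h x) ->
  exists c2, [/\ atlas X c2, cdom c2 x & c' \o h \o cinv c = c2 \o cinv c].
Proof.
move=> ac ac' cx cx'.
have [c2 [a2 d2 _ _ cE]] := hloc ac' cx' (filterT : nbhs x setT).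
by exists c2; rewrite cE.
Qed.

Lemma local_biholomorphism_cder (c : chart R X) (c' : chart R Y) x :
  atlas X c -> atlas Y c' -> cdom c x -> cdom c' (h x) ->
  cder (c' \o h \o cinv c) (c x) (derive1 (c' \o h \o cinv c) (c x)).
Proof.
move=> ac ac' cx cx'.
have [c2 [a2 d2 ->]] := local_biholomorphism_transition ac ac' cx cx'.
exact: transition_derivable.
Qed.

Lemma local_biholomorphism_derive_neq0 (c : chart R X) (c' : chart R Y) x :
  atlas X c -> atlas Y c' -> cdom c x -> cdom c' (h x) ->
  derive1 (c' \o h \o cinv c) (c x) != 0.
Proof.
move=> ac ac' cx cx'.
have [c2 [a2 d2 ->]] := local_biholomorphism_transition ac ac' cx cx'.
exact: transition_derive_neq0.
Qed.

(** The coefficient of the pullback is (w o T) T', with T the map h read in charts. As h is a local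
    biholomorphism, T is a transition map of X, so T' is holomorphic by [transition_derivable2]. *)
Lemma holomorphic_pullback (w : coef_form Y) : holomorphic_form w ->
  exists2 e : coef_form X, holomorphic_form e &
    forall c c' x, atlas X c -> atlas Y c' -> cdom c x -> cdom c' (h x) ->
      e c x = w c' (h x) * derive1 (c' \o h \o cinv c) (c x).
Proof.
move=> [w1 w2].
(* A chart of Y at h x is chosen; the transformation rule of w makes the value independent of the
   choice, which is [eE]. *)
pose e (c : chart R X) x := let c' := s2val (cid2 (atlas_cover (h x))) in
  w c' (h x) * derive1 (c' \o h \o cinv c) (c x).
have eE c c' x : atlas X c -> atlas Y c' -> cdom c x -> cdom c' (h x) ->
    e c x = w c' (h x) * derive1 (c' \o h \o cinv c) (c x).
  move=> ac ac' cx cx'; rewrite /e; case: cid2 => /= c1 a1 d1.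
  rewrite (w2 c1 c' (h x) a1 ac' d1 cx') -mulrA; congr (_ * _); apply/esym.
  apply: derive1_cder.
  have k1 := local_biholomorphism_cder ac a1 cx d1.
  have k2 := transition_derivable a1 ac' d1 cx'.
  have E : (c1 \o h \o cinv c) (c x) = c1 (h x) by rewrite /= cfunK.
  rewrite -E in k2; have := cder_comp k2 k1; rewrite E; apply: wder_near_eq.
  have := near_cinv cx (local_biholomorphism_continuous hloc (near_cdom d1)).
  by apply: filterS => z [_ _ /= /cfunK ->].
exists e; last exact: eE.
split.
  move=> c ac _ [x cx <-].
  have [c' ac' cx'] := atlas_cover (h x).
  have [c2 [a2 d2 cE]] := local_biholomorphism_transition ac ac' cx cx'.
  pose T := c' \o h \o cinv c.
  have Tx : T (c x) = c' (h x) by rewrite /T /= cfunK.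
  have k1 := local_biholomorphism_cder ac ac' cx cx'.
  have k2 : derivable (derive1 T) (c x) 1.
    by rewrite /T cE; exact: (transition_derivable2 smoothG zeroG).
  have k3 : derivable (w c' \o cinv c') (T (c x)) 1.
    by rewrite Tx; apply: w1 => //; exists (h x).
  have := wder_mul (cder_comp (derivable_cder k3) k1) (derivable_cder k2).
  rewrite !(mul0r, mulr0, addr0) => k4; apply/derivable_cderP; eexists.
  apply: wder_near_eq k4.
  have := near_cinv cx (local_biholomorphism_continuous hloc (near_cdom cx')).
  apply: filterS => z [z1 zE z2].
  transitivity (e c (cinv c z)); last reflexivity.
  by rewrite (eE c c' (cinv c z) ac ac' z1 z2) zE /T /= cfunK.
move=> c1 c2 x a1 a2 d1 d2; have [c' ac' cx'] := atlas_cover (h x).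
rewrite (eE c1 c' x a1 ac' d1 cx') (eE c2 c' x a2 ac' d2 cx') -mulrA; congr (_ * _).
apply: derive1_cder; apply: (@chain_rule_chart _ _ (c' \o h)) => //.
exact: local_biholomorphism_cder.
Qed.

End pullback.

(** The translation taking x to a point x0 with w(x0) != 0 pulls w back to a form that does not
    vanish at x and is a multiple of w. *)
Lemma form_spans_neq0 (X : riemann_surface R) (L : group_law X) (G : X -> X -> R)
    (w : coef_form X) :
  (forall c1 c2, atlas X c1 -> atlas X c2 ->
    smooth_on (chart_image c1 (cdom c1) `*` chart_image c2 (cdom c2))
    (fun p => G (chart_param c1 p.1) (chart_param c2 p.2) ^+ 2)) ->
  simple_zero_on_diagonal G -> form_spans w ->
  forall c x, atlas X c -> cdom c x -> w c x != 0.
Proof.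
move=> sG zG [hw wspan [c0 [x0 [a0 d0 w0]]]] c x ac cx.
pose a := gadd L x0 (gopp L x).
have ax : gadd L a x = x0 by rewrite /a -gaddA gaddN gaddC gadd0.
have hloc := @translation_local_biholomorphism _ _ L a.
have [e he eE] := holomorphic_pullback sG zG hloc hw.
have [b bE] := wspan e he.
have cx0 : cdom c0 (gadd L a x) by rewrite ax.
have : e c x != 0.
  rewrite (eE c c0)// mulf_neq0 ?ax//.
  exact: local_biholomorphism_derive_neq0.
by rewrite bE// mulf_eq0 negb_or => /andP[].
Qed.

(** Open sets on which f is injective cover X; each of the finitely many in a subcover meets the
    fibre in at most one point. *)
Lemma fiber_finite (X Y : riemann_surface R) (f : X -> Y) (Q : Y) :
  compact [set: X] -> local_biholomorphism f ->
  exists2 S : seq X, uniq S & forall x, (x \in S) <-> f x = Q.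
Proof.
move=> cX floc.
have /choice[U UP] x := local_biholomorphism_inj floc x.
have : finite_set (f @^-1` [set Q]).
  move: cX; rewrite compact_cover => /(_ X [set: X] U) [].
  - by move=> x _; have [] := UP x.
  - by move=> x _; exists x => //; have [] := UP x.
  move=> D _ Dcov.
  have sub : f @^-1` [set Q] `<=` \bigcup_(i in [set` D]) (U i `&` f @^-1` [set Q]).
    by move=> x fx; have [i Di Uix] := Dcov x I; exists i.
  apply: (sub_finite_set sub).
  apply: bigcup_finite => // i Di.
  suff : U i `&` f @^-1` [set Q] `<=` [set xget i (U i `&` f @^-1` [set Q])].
    by move=> /sub_finite_set; apply; exact: finite_set1.
  move=> x [Uix fx] /=; case: xgetP => [y _ [Uiy fy]|/(_ x) []]; last by [].
  by have [_ _] := UP i; apply=> //; rewrite fx fy.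
move=> /finite_seqP[S SE]; exists (undup S); first exact: undup_uniq.
move=> x; rewrite mem_undup; split=> [xS|fx].
  by have : [set` S] x by []; rewrite -SE.
by have : (f @^-1` [set Q]) x by []; rewrite SE.
Qed.

End forms.

(** * The maximum principle *)

Section max_principle.
Context {R : realType} (X : riemann_surface R) (G : X -> X -> R) (w : coef_form X).
Local Notation "'N z" := (Normc.normc z) (at level 10, z at level 8).
Hypothesis cX : compact [set: X].
Hypothesis smoothG : forall c1 c2, atlas X c1 -> atlas X c2 ->
  smooth_on (chart_image c1 (cdom c1) `*` chart_image c2 (cdom c2))
    (fun p => G (chart_param c1 p.1) (chart_param c2 p.2) ^+ 2).
Hypothesis zeroG : forall P Q, G P Q = 0 <-> P = Q.
Hypothesis w_neq0 : forall c x, atlas X c -> cdom c x -> w c x != 0.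

(** The square makes the argument of [ln] smooth everywhere. At x = P the potential should be -oo
    and the value given by [ln] carries no information. *)
Definition potential (Y : Type) (H : Y -> Y -> R) (P x : Y) : R := ln (H P x ^+ 2).

(** A relation rather than a function, so that sums and multiples carry along the derivability they
    require. *)
Definition laplacian_at (c : chart R X) (phi : X -> R) (x : X) (l : R) :=
  exists l1 l2, [/\ derivable2 (phi \o chart_param c) (chart_coord c x) (1, 0) l1,
    derivable2 (phi \o chart_param c) (chart_coord c x) (0, 1) l2 & l = l1 + l2].

Hypothesis laplacianG : forall P c x, atlas X c -> cdom c x -> x != P ->
  laplacian_at c (potential G P) x (- (4 * pi * 'N (w c x) ^+ 2)).

Lemma laplacian_atD c phi psi x a b : laplacian_at c phi x a ->
  laplacian_at c psi x b -> laplacian_at c (phi \+ psi) x (a + b).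
Proof.
move=> [a1 [a2 [h1 h2 ->]]] [b1 [b2 [k1 k2 ->]]].
exists (a1 + b1), (a2 + b2); split; [exact: derivable2D|exact: derivable2D|ring].
Qed.

Lemma laplacian_atZ c phi x k a : laplacian_at c phi x a ->
  laplacian_at c (fun y => k * phi y) x (k * a).
Proof.
move=> [a1 [a2 [h1 h2 ->]]]; exists (k * a1), (k * a2).
by split; [exact: (derivable2Z k h1)|exact: (derivable2Z k h2)|ring].
Qed.

Lemma laplacian_at_sum c (S : seq X) x : atlas X c -> cdom c x -> x \notin S ->
  laplacian_at c (fun y => \sum_(P <- S) potential G P y) x
    ((size S)%:R * (- (4 * pi * 'N (w c x) ^+ 2))).
Proof.
move=> ac cx; elim: S => [_|P S IH].
  have cst0 v : derivable2 (fun _ : R * R => 0 : R) (chart_coord c x) v 0.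
    split; first by apply: filterE => q; exact: derivable_cst.
    have -> : 'D_v (fun _ : R * R => 0 : R) = cst 0.
      by apply/funext => q; exact: derive_cst.
    by apply: DeriveDef; [exact: derivable_cst|exact: derive_cst].
  have -> : (fun y => \sum_(P <- [::]) potential G P y) = (fun _ => 0).
    by apply/funext => y; rewrite big_nil.
  exists 0, 0; split; [exact: cst0|exact: cst0|by rewrite mul0r addr0].
rewrite inE negb_or => /andP[xP /IH h].
have := laplacian_atD (laplacianG ac cx xP) h.
rewrite (_ : _ + _ = (size (P :: S))%:R * - (4 * pi * 'N (w c x) ^+ 2)); last first.
  by rewrite /= -natr1; ring.
by congr laplacian_at; apply/funext => y; rewrite big_cons.
Qed.

Lemma laplacian_at_max c phi x l : cdom c x -> laplacian_at c phi x l ->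
  (\forall y \near x, phi y <= phi x) -> l <= 0.
Proof.
move=> cx [l1 [l2 [[d1 e1] [d2 e2] ->]]] xmax.
have lmax : \forall q \near chart_coord c x,
    (phi \o chart_param c) q <= (phi \o chart_param c) (chart_coord c x).
  have := near_chart_param cx xmax; apply: filterS => q [_ _].
  by rewrite /= chart_paramK.
have := second_derivative_at_max d1 e1 lmax.
have := second_derivative_at_max d2 e2 lmax; lra.
Qed.

Lemma green_sqr_continuous P : continuous (fun x => G P x ^+ 2).
Proof.
move=> x; have [c ac cx] := atlas_cover x.
have := smooth_on_continuous (green_smooth smoothG P ac) (chart_image_coord cx).
rewrite /prop_for /continuous_at chart_paramK// => h A /h /=.
rewrite nbhs_simpl /= chart_coordE => /near_C_to_plane /(near_cfun cx).
by apply: filterS => y [cy]; rewrite /= /chart_param C_to_planeK cfunK.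
Qed.

Lemma green_sqr_gt0 P x : x != P -> 0 < G P x ^+ 2.
Proof.
move=> xP; rewrite exprn_even_gt0//=; apply: contra_neq xP => /zeroG ->.
by [].
Qed.

Lemma potential_continuous P x : x != P -> {for x, continuous (potential G P)}.
Proof.
move=> xP; apply: (@continuous_comp _ _ _ (fun x => G P x ^+ 2) (@ln R)).
  exact: green_sqr_continuous.
by apply: continuous_ln; exact: green_sqr_gt0.
Qed.

Lemma near_neq (P x : X) : x != P -> \forall y \near x, y != P.
Proof.
move=> xP; have /cvgr_gt/(_ _ (green_sqr_gt0 xP)) := @green_sqr_continuous P x.
apply: filterS => y; apply: contraTneq => ->.
by rewrite (zeroG P P).2// expr0n ltxx.
Qed.

Lemma near_notin (S : seq X) (x : X) : x \notin S -> \forall y \near x, y \notin S.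
Proof.
elim: S => [_|P S IH]; first by apply: filterE.
rewrite inE negb_or => /andP[xP /IH h].
by apply: filterS2 (near_neq xP) h => y yP yS; rewrite inE negb_or yP.
Qed.

Lemma potential_ubound P : exists M, forall x, x != P -> potential G P x <= M.
Proof.
have X0 : [set: X] !=set0 by exists point.
have cG : {within [set: X], continuous (fun x => G P x ^+ 2)}.
  by apply: continuous_subspaceT; exact: green_sqr_continuous.
have [c _ cmax] := compact_EVT_max X0 cX cG.
exists (ln (G P c ^+ 2)) => x xP.
have x0 := green_sqr_gt0 xP; have xc : G P x ^+ 2 <= G P c ^+ 2.
  by apply: cmax; rewrite inE.
by rewrite ler_ln ?posrE//; exact: lt_le_trans xc.
Qed.

Lemma potential_sum_ubound (S : seq X) : exists M : R,
  forall x, x \notin S -> \sum_(P <- S) potential G P x <= M.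
Proof.
elim: S => [|P S [M MS]]; first by exists 0 => x _; rewrite big_nil.
have [M1 hM1] := potential_ubound P; exists (M1 + M) => x.
rewrite inE negb_or => /andP[xP xS]; rewrite big_cons.
by rewrite lerD ?hM1 ?MS.
Qed.

Lemma potential_to_ninfty P (K : R) :
  \forall x \near P, x != P -> potential G P x <= K.
Proof.
have e0 : G P P ^+ 2 < expR K by rewrite (zeroG P P).2// expr0n expR_gt0.
have /cvgr_lt/(_ _ e0) := @green_sqr_continuous P P.
apply: filterS => x xK xP; rewrite -[K]expRK.
by rewrite ler_ln ?posrE ?expR_gt0 ?(ltW xK)// green_sqr_gt0.
Qed.

Lemma potential_sum_to_ninfty (S : seq X) s (K : R) : s \in S ->
  \forall x \near s, x \notin S -> \sum_(P <- S) potential G P x <= K.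
Proof.
move=> sS; have [M hM] := potential_sum_ubound (rem s S).
apply: filterS (potential_to_ninfty s (K - M)) => x xs xS.
have xs' : x != s by apply: contraNneq xS => ->.
rewrite (perm_big _ (perm_to_rem sS)) big_cons.
have xS' : x \notin rem s S by apply: contra xS; exact: mem_rem.
by rewrite -[K](subrK M) lerD ?xs ?hM.
Qed.

Lemma potential_sum_continuous (S : seq X) x : x \notin S ->
  {for x, continuous (fun y => \sum_(P <- S) potential G P y)}.
Proof.
elim: S => [_|P S IH].
  have -> : (fun y => \sum_(P <- [::]) potential G P y) = cst 0.
    by apply/funext => y; rewrite big_nil.
  exact: cst_continuous.
rewrite inE negb_or => /andP[xP /IH h].
have -> : (fun y => \sum_(Q <- P :: S) potential G Q y) =
    (fun y => potential G P y + \sum_(Q <- S) potential G Q y).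
  by apply/funext => y; rewrite big_cons.
by apply: continuousD => //; exact: potential_continuous.
Qed.

(* The potentials are strictly superharmonic as w != 0, so adding a small multiple
   of sum_{s in S} potential s - (#S + 1) potential P turns phi into a strictly
   subharmonic function with values -oo on S and +oo at P. *)
Lemma max_principle (S : seq X) (phi : X -> R) :
  (forall x, x \notin S -> {for x, continuous phi}) ->
  (forall s, s \in S -> exists B, \forall x \near s, x \notin S -> phi x <= B) ->
  (forall x, x \notin S -> exists c l,
     [/\ atlas X c, cdom c x, laplacian_at c phi x l & 0 <= l]) ->
  forall x P, x \notin S -> P \notin S -> phi x <= phi P.
Proof.
move=> cphi bphi lphi x P xS PS; rewrite leNgt; apply/negP => Px.
(* Since phi P < m < phi x, the set [V] is a neighbourhood of P without x. On its complement [K],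
   which contains x, the potential of P is bounded below. *)
pose m := (phi P + phi x) / 2.
pose V := [set y | y \notin S /\ phi y < m].
have VP : nbhs P V.
  apply: filterI; first exact: near_notin.
  by have /cvgr_lt := cphi P PS; apply; rewrite /m; lra.
pose K := ~` V°.
have cK : compact K.
  apply: (subclosed_compact _ cX) => //; apply: open_closedC; exact: open_interior.
have Kx : K x.
  by move=> /interior_subset [_]; rewrite /m; lra.
have KP y : K y -> y != P by apply: contra_notN => /eqP ->.
have [d dP] : exists d, forall y, K y -> d <= potential G P y.
  have K0 : K !=set0 by exists x.
  have cG : {within K, continuous (fun x => G P x ^+ 2)}.
    by apply: continuous_subspaceT; exact: green_sqr_continuous.
  have [y /[!inE] Ky ymin] := compact_EVT_min K0 cK cG.
  exists (ln (G P y ^+ 2)) => z Kz; rewrite /potential.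
  by rewrite ler_ln ?posrE ?green_sqr_gt0 ?KP//; apply: ymin; rewrite inE.
have [M hM] := potential_sum_ubound S.
pose n := (size S)%:R : R.
pose bar y := - (n + 1) * potential G P y + \sum_(s <- S) potential G s y.
(* On K the perturbation exceeds its value at x by less than e C = phi x - m. Hence psi y >= psi x
   forces phi y > m, away from the edge of [V]. *)
pose C := `| - (n + 1) * d + M - bar x| + 1.
have C0 : 0 < C by rewrite ltr_wpDl.
pose e := (phi x - m) / C.
have xm : 0 < phi x - m by rewrite /m; lra.
have e0 : 0 < e by rewrite divr_gt0.
have n0 : 0 <= n by [].
pose psi y := phi y + e * bar y.
have psi_m y : K y -> y \notin S -> psi x <= psi y -> m < phi y.
  move=> Ky yS; rewrite /psi => xy.
  have h1 : bar y <= - (n + 1) * d + M.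
    by rewrite /bar lerD ?hM// ler_wnM2l ?dP//; lra.
  have h2 : bar y - bar x < C.
    have := ler_norm (- (n + 1) * d + M - bar x); rewrite /C; lra.
  have h3 : e * (bar y - bar x) < phi x - m.
    by rewrite -[ltRHS](divfK (lt0r_neq0 C0)) ltr_pM2l.
  by rewrite mulrBr in h3; lra.
have cbar y : y != P -> y \notin S -> {for y, continuous bar}.
  move=> yP yS; apply: continuousD; last exact: potential_sum_continuous.
  by apply: continuousM; [exact: cst_continuous|exact: potential_continuous].
have cpsi y : y != P -> y \notin S -> {for y, continuous psi}.
  move=> yP yS; apply: continuousD; first exact: cphi.
  by apply: continuousM; [exact: cst_continuous|exact: cbar].
have psiS s : s \in S -> \forall y \near s, y \notin S -> psi y < psi x.
  move=> sS; have [B hB] := bphi s sS.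
  have sP : s != P by apply: contraNneq PS => <-.
  have h1 : \forall y \near s, potential G P s - 1 < potential G P y.
    by have /cvgr_gt := potential_continuous sP; apply; lra.
  pose c1 := (n + 1) * (potential G P s - 1).
  have h2 := potential_sum_to_ninfty ((psi x - 1 - B) / e + c1) sS.
  apply: filterS3 hB h1 h2 => y yB y1 y2 yS.
  have {}yB := yB yS; have {}y2 := y2 yS.
  have h3 : bar y <= (psi x - 1 - B) / e.
    have : c1 <= (n + 1) * potential G P y by rewrite ler_pM2l; lra.
    by rewrite /bar mulNr; lra.
  have : e * bar y <= psi x - 1 - B.
    by rewrite mulrC -ler_pdivlMr.
  by move=> h4; rewrite [psi y]/psi; lra.
(* This set is closed although S is removed, because psi tends to -oo at S; a maximum of psi on it
   therefore exists. *)
pose A := [set y | [/\ y \notin S, K y & psi x <= psi y]].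
have AX : closed A.
  rewrite -[A]setCK; apply: open_closedC; rewrite openE => y nAy.
  have [yS|yS] := boolP (y \in S).
    by apply: filterS (psiS _ yS) => z zx [zS _]; rewrite leNgt zx.
  have [Ky|nKy] := pselect (K y); last first.
    have Vy : V° y by apply: contrapT.
    by apply: filterS (nbhs_interior Vy) => z Vz [_ nVz _]; apply: nVz.
  have yx : psi y < psi x by rewrite ltNge; apply/negP => xy; apply: nAy.
  have /cvgr_lt/(_ _ yx) := cpsi y (KP _ Ky) yS.
  by apply: filterS => z zx [_ _]; rewrite leNgt zx.
have cA : compact A by apply: (subclosed_compact AX cX).
have A0 : A !=set0 by exists x.
have cpsiA : {within A, continuous psi}.
  by apply: continuous_in_subspaceT => y /[!inE] -[yS Ky _]; exact: cpsi (KP _ Ky) yS.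
have [y /[!inE] Ay ymax] := compact_EVT_max A0 cA cpsiA.
have [yS Ky yx] := Ay; have yP := KP _ Ky; have ym := psi_m _ Ky yS yx.
(* Near y one has phi > m, so the neighbours of y are outside V and thus in K: the maximum over [A]
   is a local maximum on X. *)
have locmax : \forall z \near y, psi z <= psi y.
  have h1 : \forall z \near y, m < phi z.
    by have /cvgr_gt := cphi y yS; apply.
  apply: filterS2 h1 (near_notin yS) => z zm zS.
  have [xz|/ltW zx] := leP (psi x) (psi z); last exact: le_trans yx.
  apply: ymax; rewrite inE; split=> // /interior_subset [_].
  by rewrite ltNge (ltW zm).
have [c [l [ac cy lc l0]]] := lphi y yS.
(* The weights n + 1 and n leave exactly one density: [bar] has Laplacian 4 pi |w|^2 > 0 at y. *)
have lbar := laplacian_atD (laplacian_atZ (- (n + 1)) (laplacianG ac cy yP))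
  (laplacian_at_sum ac cy yS).
have := laplacian_at_max cy (laplacian_atD lc (laplacian_atZ e lbar)) locmax.
have N0 : 0 < 'N (w c y) ^+ 2 by rewrite exprn_gt0// normc_gt0 w_neq0.
have p0 : 0 < pi :> R by exact: pi_gt0.
rewrite -/n (_ : _ + _ = l + e * (4 * pi * 'N (w c y) ^+ 2)); last by ring.
have q0 : 0 < 4 * pi * 'N (w c y) ^+ 2 by rewrite mulr_gt0// mulr_gt0// ltr0n.
by have := mulr_gt0 e0 q0; lra.
Qed.

End max_principle.

(** * The Green function in genus 1, in real terms *)

Section green_facts.
Context {R : realType}.
Local Notation "'N z" := (Normc.normc z) (at level 10, z at level 8).

(** In genus 1, mu has coefficient (i / 2) |w|^2, so 2 pi i mu has coefficient - pi |w|^2. The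
    Laplacian is four times the mixed derivative, whence - 4 pi |w|^2. *)
Record green_facts (X : riemann_surface R) (G : X -> X -> R) (w : coef_form X) : Prop :=
  GreenFacts {
    gf_ge0 : forall P Q, 0 <= G P Q;
    gf_smooth : forall c1 c2, atlas X c1 -> atlas X c2 ->
      smooth_on (chart_image c1 (cdom c1) `*` chart_image c2 (cdom c2))
        (fun p => G (chart_param c1 p.1) (chart_param c2 p.2) ^+ 2);
    gf_zero : forall P Q, G P Q = 0 <-> P = Q;
    gf_diag : simple_zero_on_diagonal G;
    gf_form : form_spans w;
    gf_mass : real_integral (fun c x => 'N (w c x) ^+ 2) 1;
    gf_laplacian : forall P c x, atlas X c -> cdom c x -> x != P ->
      laplacian_at c (potential G P) x (- (4 * pi * 'N (w c x) ^+ 2));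
    gf_integral : forall P,
      real_integral (fun c x => ln (G P x) * 'N (w c x) ^+ 2) 0 }.

Lemma potential_derivable2 (X : riemann_surface R) (G : X -> X -> R) P c x v :
  (forall c1 c2, atlas X c1 -> atlas X c2 ->
      smooth_on (chart_image c1 (cdom c1) `*` chart_image c2 (cdom c2))
        (fun p => G (chart_param c1 p.1) (chart_param c2 p.2) ^+ 2)) ->
  (forall P Q, G P Q = 0 <-> P = Q) -> atlas X c -> cdom c x -> x != P ->
  derivable2 (potential G P \o chart_param c) (chart_coord c x) v
    ('D_v ('D_v (potential G P \o chart_param c)) (chart_coord c x)).
Proof.
move=> sG zG ac cx xP; have sA := green_smooth sG P ac.
have cc := chart_image_coord cx.
have A0 : 0 < G P (chart_param c (chart_coord c x)) ^+ 2.
  by rewrite chart_paramK//; exact: green_sqr_gt0.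
have [l [d1 d2]] := @derivable2_ln R _ (fun q : R * R => G P (chart_param c q) ^+ 2)
  _ v _ A0 (smooth_on_continuous sA cc)
  (smooth_derivable2 v (@chart_image_open _ _ c) sA cc).
have [_ lE] := d2.
by split; [exact: d1|rewrite lE; exact: d2].
Qed.

Lemma arakelov_green_facts (X : riemann_surface R) (G : X -> X -> R) :
  has_genus X 1 -> arakelov_green G -> exists w, green_facts G w.
Proof.
move=> gX [G0 sG zG dG [mu /(arakelov_form_genus1 gX)[w [spw mw ->]] muG]].
exists w; split => //.
  move=> P c x ac cx xP; have [/(_ c x ac cx xP) h _] := muG P.
  have d1 := potential_derivable2 (1, 0) sG zG ac cx xP.
  have d2 := potential_derivable2 (0, 1) sG zG ac cx xP.
  exists ('D_(1, 0) ('D_(1, 0) (potential G P \o chart_param c)) (chart_coord c x)),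
    ('D_(0, 1) ('D_(0, 1) (potential G P \o chart_param c)) (chart_coord c x)).
  split; [exact: d1|exact: d2|].
  set l := _ + _; move: h; rewrite /ddbar -/(potential G P).
  rewrite -[X in X%:C = _]/(l / 4) => h.
  have : (l / 4)%:C = (- (pi * 'N (w c x) ^+ 2))%:C :> R[i].
    rewrite h -complexiE [LHS](_ : _ = 'i%C ^+ 2 * (pi%:C * ('N (w c x) ^+ 2)%:C)).
      by rewrite sqr_i mulN1r -rmorphM -rmorphN.
    by field.
  move=> /complexI l4; have -> : l = (l / 4) * 4 by rewrite divfK// pnatr_eq0.
  by rewrite l4; ring.
move=> P; have [_ [+ _]] := muG P; congr real_integral.
apply/funext => c; apply/funext => x.
rewrite -complexiE [X in complex.Re X](_ : _ =
  - 'i%C ^+ 2 * ((ln (G P x))%:C * ('N (w c x) ^+ 2)%:C)); last by field.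
by rewrite sqr_i opprK mul1r -rmorphM.
Qed.

End green_facts.

(** * Comparison of the Green functions *)

Section isogeny_green.
Context {R : realType} (X Y : riemann_surface R) (L : group_law X) (L' : group_law Y).
Context (f : X -> Y) (G : X -> X -> R) (G' : Y -> Y -> R).
Context (w : coef_form X) (w' : coef_form Y).
Local Notation "'N z" := (Normc.normc z) (at level 10, z at level 8).
Hypothesis cX : compact [set: X].
Hypothesis cY : compact [set: Y].
Hypothesis isog : isogeny L L' f.
Hypothesis gG : green_facts G w.
Hypothesis gG' : green_facts G' w'.

Let floc : local_biholomorphism f := isogeny_local_biholomorphism cX isog.

Lemma green_form_neq0 c x : atlas X c -> cdom c x -> w c x != 0.
Proof. exact: (form_spans_neq0 L (gf_smooth gG) (gf_diag gG) (gf_form gG)). Qed.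

Lemma green_form_neq0' (c' : chart R Y) (y : Y) : atlas Y c' -> cdom c' y ->
  w' c' y != 0.
Proof. exact: (form_spans_neq0 L' (gf_smooth gG') (gf_diag gG') (gf_form gG')). Qed.

(** f^* w' is a multiple a w. In a chart c = c' o f the derivative of f is 1, so the two
    coefficients are compared without a Jacobian; a is not 0 since w' has no zero. *)
Lemma isogeny_form : exists2 a : R[i], a != 0 &
  forall (c : chart R X) (c' : chart R Y) x, atlas X c -> atlas Y c' ->
    cdom c `<=` f @^-1` cdom c' -> cfun c = c' \o f -> cdom c x ->
    w' c' (f x) = a * w c x.
Proof.
have [hw' _ _] := gf_form gG'; have [hw wspan _] := gf_form gG.
have [e he eE] := holomorphic_pullback (gf_smooth gG) (gf_diag gG) floc hw'.
have [a aE] := wspan e he.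
have key c (c' : chart R Y) x : atlas X c -> atlas Y c' ->
    cdom c `<=` f @^-1` cdom c' -> cfun c = c' \o f -> cdom c x ->
    w' c' (f x) = a * w c x.
  move=> ac ac' cc' cE cx; have cx' : cdom c' (f x) by exact: cc'.
  rewrite -(aE c x ac cx) (eE c c' x ac ac' cx cx') -cE.
  by rewrite (derive1_cder (cder_cfun cx)) mulr1.
exists a => //; apply/eqP => a0; have x : X := point.
have [c' ac' cx'] := atlas_cover (f x).
have [c [ac cx _ cc' cE]] := floc ac' cx' (filterT : nbhs x setT).
have := key c c' x ac ac' cc' cE cx; rewrite a0 mul0r => /eqP.
by apply/negP; exact: green_form_neq0'.
Qed.

Section fiber.
Context (Q : Y) (S : seq X).
Hypothesis uS : uniq S.
Hypothesis SE : forall x, (x \in S) <-> f x = Q.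

Let phi (x : X) : R := \sum_(s <- S) potential G s x - potential G' Q (f x).

Lemma fiber_notin x : x \notin S -> f x != Q.
Proof. by move=> xS; apply/eqP => /SE xS'; rewrite xS' in xS. Qed.

Lemma green_ratio_continuous x : x \notin S -> {for x, continuous phi}.
Proof.
move=> xS; apply: continuousB.
  by apply: (potential_sum_continuous (gf_smooth gG) (gf_zero gG)).
apply: (@continuous_comp _ _ _ f (potential G' Q)).
  exact: (isogeny_continuous isog).
by apply: (potential_continuous (gf_smooth gG') (gf_zero gG')); exact: fiber_notin.
Qed.

(** In the chart c = c' o f both G(s, .) and G'(Q, f .) are |c s - c x| times a positive smooth
    function, so the singular factor cancels. The other points of the fibre contribute continuous
    terms at s because S has no repetition. *)
Lemma green_ratio_extends s : s \in S -> exists psi : X -> R,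
  {for s, continuous psi} /\ \forall x \near s, x \notin S -> phi x = psi x.
Proof.
move=> sS; have fs : f s = Q by apply/SE.
have [c' ac' cs'] := atlas_cover (f s).
have [c [ac cs _ cc' cE]] := floc ac' cs' (filterT : nbhs s setT).
have [u su uE] := gf_diag gG ac; have [u' su' uE'] := gf_diag gG' ac'.
have cs0 := chart_image_coord cs; have cs0' := chart_image_coord cs'.
pose v x := u (chart_coord c s, chart_coord c x).
pose v' x := u' (chart_coord c' (f s), chart_coord c' (f x)).
have coord_cts (Z : riemann_surface R) (d : chart R Z) z : cdom d z ->
    {for z, continuous (chart_coord d)}.
  move=> dz; apply: (@continuous_comp _ _ _ d (@C_to_plane R)).
    by apply: (@cfun_cts _ _ d); rewrite inE.
  exact: continuous_C_to_plane.
have cv : {for s, continuous v}.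
  apply: (@continuous_comp _ _ _ (chart_coord c) (fun q => u (chart_coord c s, q))).
    exact: coord_cts.
  exact: (smooth_on_continuous (smooth_on_slice su cs0) cs0).
have cv' : {for s, continuous v'}.
  apply: (@continuous_comp _ _ _ (chart_coord c' \o f)
    (fun q => u' (chart_coord c' (f s), q))).
    apply: continuous_comp; first exact: (isogeny_continuous isog).
    exact: coord_cts.
  exact: (smooth_on_continuous (smooth_on_slice su' cs0') cs0').
have v0 : 0 < v s by have [] := uE s s cs cs.
have v0' : 0 < v' s by have [] := uE' _ _ cs' cs'.
exists (fun x => ln (v x ^+ 2) - ln (v' x ^+ 2) + \sum_(r <- rem s S) potential G r x).
split.
  apply: continuousD.
    have csqr (b : X -> R) : 0 < b s -> {for s, continuous b} ->
        {for s, continuous (fun x => ln (b x ^+ 2))}.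
      move=> b0 cb; apply: (@continuous_comp _ _ _ (fun x => b x ^+ 2) (@ln R)).
        apply: (@continuous_comp _ _ _ b (fun t : R => t ^+ 2)) => //.
        exact: exprn_continuous.
      by apply: continuous_ln; rewrite exprn_gt0.
    by apply: continuousB; exact: csqr.
  apply: (potential_sum_continuous (gf_smooth gG) (gf_zero gG)).
  by rewrite mem_rem_uniq// inE eqxx.
apply: filterS (near_cdom cs) => x cx xS.
have xs : x != s by apply: contraNneq xS => ->.
have cx' : cdom c' (f x) by exact: cc'.
have [vx0 GE] := uE s x cs cx; have [vx0' GE'] := uE' (f s) (f x) cs' cx'.
have cE1 : c' (f x) = c x by rewrite cE.
have cE2 : c' (f s) = c s by rewrite cE.
rewrite cE1 cE2 in GE'.
have N0 : 0 < 'N (c s - c x).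
  rewrite normc_gt0 subr_eq0; apply: contra_neq xs => /(congr1 (cinv c)).
  by rewrite !cfunK// => ->.
have lnE (b d : R) : 0 < b -> 0 < d -> ln ((b * d) ^+ 2) = ln (b ^+ 2) + ln (d ^+ 2).
  by move=> b0 d0; rewrite exprMn lnM// posrE exprn_gt0.
have E1 : potential G s x = ln ('N (c s - c x) ^+ 2) + ln (v x ^+ 2).
  by rewrite /potential GE lnE.
have E2 : potential G' Q (f x) = ln ('N (c s - c x) ^+ 2) + ln (v' x ^+ 2).
  by rewrite /potential -fs GE' lnE.
transitivity (ln (v x ^+ 2) - ln (v' x ^+ 2) + \sum_(r <- rem s S) potential G r x).
  rewrite /phi (perm_big _ (perm_to_rem sS)) big_cons E1 E2.
  by rewrite addrAC; congr (_ + _); ring.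
by [].
Qed.

(** In a chart c = c' o f the functions G'(Q, f .) on X and G'(Q, .) on X' have the same coordinate
    expression, and |w'|^2 = |a|^2 |w|^2. *)
Lemma green_ratio_laplacian (a : R[i]) x :
  (forall (c : chart R X) (c' : chart R Y) x, atlas X c -> atlas Y c' ->
    cdom c `<=` f @^-1` cdom c' -> cfun c = c' \o f -> cdom c x ->
    w' c' (f x) = a * w c x) -> x \notin S ->
  exists c, [/\ atlas X c, cdom c x & laplacian_at c phi x
    (('N a ^+ 2 - (size S)%:R) * (4 * pi * 'N (w c x) ^+ 2))].
Proof.
move=> aE xS; have [c' ac' cx'] := atlas_cover (f x).
have [c [ac cx _ cc' cE]] := floc ac' cx' (filterT : nbhs x setT).
exists c; split=> //.
have h1 := laplacian_at_sum (gf_laplacian gG) ac cx xS.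
have [l1 [l2 [d1 d2 lE]]] := gf_laplacian gG' ac' cx' (fiber_notin xS).
have coordE : chart_coord c' (f x) = chart_coord c x.
  by rewrite !chart_coordE cE.
rewrite coordE in d1 d2.
have near_param : \forall q \near chart_coord c x,
    (potential G' Q \o chart_param c') q = ((potential G' Q \o f) \o chart_param c) q.
  have := open_nbhs_nbhs (conj (@chart_image_open _ _ c) (chart_image_coord cx)).
  apply: filterS => q cq; rewrite /= /chart_param.
  by rewrite (local_biholomorphism_cinv cc' cE cq).
have h2 : laplacian_at c (potential G' Q \o f) x (- (4 * pi * 'N (w' c' (f x)) ^+ 2)).
  exists l1, l2; split=> //.
    exact: (derivable2_near near_param d1).
  exact: (derivable2_near near_param d2).
have := laplacian_atD h1 (laplacian_atZ (-1) h2).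
rewrite (aE c c' x ac ac' cc' cE cx) Normc.normcM exprMn => h.
rewrite (_ : (_ - _) * _ = (size S)%:R * - (4 * pi * 'N (w c x) ^+ 2) +
  -1 * - (4 * pi * ('N a ^+ 2 * 'N (w c x) ^+ 2))); last by ring.
by move: h; congr laplacian_at; apply/funext => y; rewrite /phi /= mulN1r.
Qed.

Lemma green_ratio_constant : exists K : R, forall x, x \notin S -> phi x = K.
Proof.
have [a _ aE] := isogeny_form.
have p0 c x : 0 <= 4 * pi * 'N (w c x) ^+ 2 :> R.
  by rewrite mulr_ge0 ?sqr_ge0// mulr_ge0 ?ler0n// pi_ge0.
have le_phi x P : x \notin S -> P \notin S -> phi x <= phi P.
  (* The sign of |a|^2 - #S selects phi or -phi for the maximum principle; applied to all pairs of
     points off S, either gives constancy. *)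
  have [na|an] := leP (size S)%:R ('N a ^+ 2).
    apply: (max_principle cX (gf_smooth gG) (gf_zero gG) green_form_neq0
      (gf_laplacian gG)).
    - exact: green_ratio_continuous.
    - move=> s sS; have [psi [cpsi psiE]] := green_ratio_extends sS.
      exists (psi s + 1); have h : \forall y \near s, psi y < psi s + 1.
        by have /cvgr_lt := cpsi; apply; rewrite ltrDl.
      by apply: filterS2 h psiE => y yl yE /yE ->; exact: ltW.
    - move=> y yS; have [c [ac cy lc]] := green_ratio_laplacian aE yS.
      exists c; eexists; split; [exact: ac|exact: cy|exact: lc|].
      by rewrite mulr_ge0 ?subr_ge0.
  move=> xS PS; rewrite -lerN2 -[X in X <= _]mulN1r -[X in _ <= X]mulN1r.
  move: P x PS xS.
  apply: (max_principle cX (gf_smooth gG) (gf_zero gG) green_form_neq0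
    (gf_laplacian gG) (phi := fun y => -1 * phi y)).
  - move=> y yS; apply: continuousM; first exact: cst_continuous.
    exact: green_ratio_continuous.
  - move=> s sS; have [psi [cpsi psiE]] := green_ratio_extends sS.
    exists (- (psi s - 1)); have h : \forall y \near s, psi s - 1 < psi y.
      by have /cvgr_gt := cpsi; apply; lra.
    by apply: filterS2 h psiE => y yl yE /yE ->; rewrite mulN1r lerN2 ltW.
  - move=> y yS; have [c [ac cy lc]] := green_ratio_laplacian aE yS.
    exists c; eexists; split; [exact: ac|exact: cy|exact: (laplacian_atZ (-1) lc)|].
    rewrite mulN1r -mulNr opprB mulr_ge0 ?subr_ge0 ?(ltW an)//.
have [[x xS]|nx] := pselect (exists x, x \notin S); last first.
  by exists 0 => x xS; exfalso; apply: nx; exists x.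
by exists (phi x) => y yS; apply/eqP; rewrite eq_le !le_phi.
Qed.

Lemma green_log_constant : exists K : R, forall x, x \notin S ->
  \sum_(s <- S) ln (G s x) = K + ln (G' Q (f x)).
Proof.
(* The potentials are logarithms of squares, hence the half. *)
have [K KE] := green_ratio_constant; exists (K / 2) => x xS.
have GP s : s \in S -> potential G s x = 2 * ln (G s x).
  move=> sS; have xs : x != s by apply: contraNneq xS => ->.
  have G0 : 0 < G s x.
    rewrite lt_def (gf_ge0 gG) andbT; apply: contra_neq xs => /(gf_zero gG) ->.
    by [].
  by rewrite /potential expr2 lnM ?posrE//; ring.
have GP' : potential G' Q (f x) = 2 * ln (G' Q (f x)).
  have G0 : 0 < G' Q (f x).
    rewrite lt_def (gf_ge0 gG') andbT; apply: contra_neq (fiber_notin xS).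
    by move=> /(gf_zero gG') ->.
  by rewrite /potential expr2 lnM ?posrE//; ring.
have := KE x xS; rewrite /phi GP' (eq_big_seq _ GP) -mulr_sumr; lra.
Qed.

End fiber.
End isogeny_green.

(** * Pushforward of the canonical form *)

Section borel_plane.
Context {R : realType}.
Local Notation plane := (measurableTypeR R * measurableTypeR R)%type.

Lemma open_plane_measurable (U : set (R * R)) : open U -> measurable (U : set plane).
Proof.
move=> oU.
pose box (a b c d : rat) : set plane :=
  `]ratr a, ratr b[%classic `*` `]ratr c, ratr d[%classic.
(* The box if it lies in U and the empty set otherwise, so that the union can run over all
   quadruples of rationals. *)
pose F a b c d : set plane := [set p | box a b c d p /\ box a b c d `<=` U].
have mF a b c d : measurable (F a b c d).
  have [bU|nbU] := pselect (box a b c d `<=` U).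
    have -> : F a b c d = box a b c d by apply/seteqP; split=> p //= [].
    by apply: measurableX; exact: measurable_itv.
  have -> : F a b c d = set0 by apply/seteqP; split=> p //= [].
  exact: measurable0.
have -> : U = \bigcup_a \bigcup_b \bigcup_c \bigcup_d F a b c d.
  apply/seteqP; split=> [p Up|p [a _ [b _ [c _ [d _ [boxp boxU]]]]]]; last exact: boxU.
  have /near_planeP[r r0 rU] := open_nbhs_nbhs (conj oU Up).
  have [a a_itv] := @rat_in_itvoo R (p.1 - r) p.1 ltac:(lra).
  have [b b_itv] := @rat_in_itvoo R p.1 (p.1 + r) ltac:(lra).
  have [c c_itv] := @rat_in_itvoo R (p.2 - r) p.2 ltac:(lra).
  have [d d_itv] := @rat_in_itvoo R p.2 (p.2 + r) ltac:(lra).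
  move: a_itv b_itv c_itv d_itv; rewrite !in_itv/=.
  move=> /andP[a1 a2] /andP[b1 b2] /andP[c1 c2] /andP[d1 d2].
  exists a => //; exists b => //; exists c => //; exists d => //; split.
    by split; rewrite /= in_itv/= ?a2 ?b1 ?c2 ?d1.
  move=> q []; rewrite /= !in_itv/= => /andP[q1 q2] /andP[q3 q4].
  by apply: rU; rewrite ltr_norml; lra.
by do 4! (apply: bigcupT_measurable_rat => ?).
Qed.

Lemma plane_measure_set1 (q : R * R) : plane_measure [set q] = 0%E.
Proof.
have -> : [set q] = [set q.1] `*` [set q.2].
  apply/seteqP; split=> [p ->|p] //=; case: p q => a b [c d] /= [-> ->] //.
transitivity (@lebesgue_measure R [set q.1] * @lebesgue_measure R [set q.2])%E.
  exact: product_measure1E.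
by rewrite !lebesgue_measure_set1 mul0e.
Qed.

Lemma plane_measurable_set1 (q : R * R) : measurable ([set q] : set plane).
Proof.
have -> : [set q] = [set q.1] `*` [set q.2].
  apply/seteqP; split=> [p ->|p] //=; case: p q => a b [c d] /= [-> ->] //.
by apply: measurableX.
Qed.

(** Preimages are cut with D because the inverse of a chart is controlled only on the image of the
    chart. *)
Lemma borel_preimage (Y : ptopologicalType) d (Z : measurableType d)
   (h : Z -> Y) (D : set Z) : measurable D ->
  (forall B : set Y, open B -> measurable (D `&` h @^-1` B)) ->
  forall A : set (g_sigma_algebraType (@open Y)), measurable A ->
  measurable (D `&` h @^-1` A).
Proof.
move=> mD hD A mA.
apply: (smallest_sub (X := [set A | measurable (D `&` h @^-1` A)]) _ _ mA) => //.
split => /=.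
- by rewrite preimage_set0 setI0.
- move=> B mB; rewrite setTD preimage_setC -setDE.
  rewrite (_ : D `\` h @^-1` B = D `\` (D `&` h @^-1` B)); first exact: measurableD.
  apply/seteqP; split=> x [Dx nB]; split=> //.
    by move=> [_ Bx]; exact: nB.
  by move=> Bx; apply: nB.
- move=> F mF; rewrite preimage_bigcup setI_bigcupr.
  exact: bigcupT_measurable.
Qed.

End borel_plane.

Section borel_surface.
Context {R : realType}.
Local Notation plane := (measurableTypeR R * measurableTypeR R)%type.

Lemma open_borel (X : riemann_surface R) (A : set X) : open A ->
  measurable (A : set (borel X)).
Proof. exact: sub_sigma_algebra. Qed.

Lemma continuous_borel (X Y : riemann_surface R) (h : X -> Y) (A : set (borel Y)) :
  continuous h -> measurable A -> measurable (h @^-1` A : set (borel X)).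
Proof.
move=> ch mA; rewrite -[X in measurable X]setTI.
apply: (borel_preimage (Y := Y) (Z := borel X) (h := h) (D := setT)) => //.
by move=> B oB; rewrite setTI; apply: open_borel; apply: open_comp.
Qed.

Lemma chart_image_measurable (X : riemann_surface R) (c : chart R X)
    (A : set (borel X)) : measurable A -> A `<=` cdom c ->
  measurable (chart_image c A : set plane).
Proof.
move=> mA Ac; pose D := chart_image c (cdom c).
have mD : measurable (D : set plane).
  by apply: open_plane_measurable; exact: chart_image_open.
have -> : chart_image c A = D `&` chart_param c @^-1` A.
  apply/seteqP; split=> [q [x Ax xq]|q [[x cx xq]]] /=.
    by split; [exists x => //; exact: Ac|rewrite /= /chart_param -xq cfunK//; exact: Ac].
  by rewrite /chart_param -xq cfunK// => Ax; exists x.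
apply: (borel_preimage (Y := X) (Z := plane) (h := chart_param c) (D := D)) => // B oB.
apply: open_plane_measurable; rewrite openE => q [Dq Bq].
have [cq cqE] := chart_imgP Dq.
have qE : chart_coord c (chart_param c q) = q by rewrite chart_coordE cqE plane_to_CK.
have := near_chart_param cq (open_nbhs_nbhs (conj oB Bq)); rewrite qE.
apply: filterS => p [cp pE Bp]; split=> //.
by rewrite -pE; exact: chart_image_coord.
Qed.

End borel_surface.

Section real_charge.
Context {R : realType} (X : riemann_surface R).
Implicit Type nu : {charge set (borel X) -> \bar R}.

(** A charge has finite values, so [fine] loses nothing and the identities below can be treated by
    field arithmetic. *)
Definition rcharge nu (A : set (borel X)) : R := fine (nu A).

Lemma rchargeU nu A B : measurable A -> measurable B -> A `&` B = set0 ->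
  rcharge nu (A `|` B) = rcharge nu A + rcharge nu B.
Proof.
move=> mA mB AB; rewrite /rcharge chargeU// fineD//; exact: fin_num_measure.
Qed.

Lemma rcharge0 nu : rcharge nu set0 = 0.
Proof. by rewrite /rcharge charge0. Qed.

End real_charge.

Section integral_constant.
Context {R : realType} (X Y : riemann_surface R) (L : group_law X) (L' : group_law Y).
Context (f : X -> Y) (G : X -> X -> R) (G' : Y -> Y -> R).
Context (w : coef_form X) (w' : coef_form Y).
Local Notation "'N z" := (Normc.normc z) (at level 10, z at level 8).
Local Notation plane := (measurableTypeR R * measurableTypeR R)%type.
Hypothesis cX : compact [set: X].
Hypothesis cY : compact [set: Y].
Hypothesis isog : isogeny L L' f.
Hypothesis gG : green_facts G w.
Hypothesis gG' : green_facts G' w'.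
Context (Q : Y) (S : seq X) (K : R).
Hypothesis SE : forall x, (x \in S) <-> f x = Q.
Hypothesis log_constant : forall x, x \notin S ->
  \sum_(s <- S) ln (G s x) = K + ln (G' Q (f x)).

Let floc : local_biholomorphism f := isogeny_local_biholomorphism cX isog.

Context (a : R[i]) (ker : seq X).
Hypothesis a_neq0 : a != 0.
Hypothesis formE : forall (c : chart R X) (c' : chart R Y) x,
  atlas X c -> atlas Y c' -> cdom c `<=` f @^-1` cdom c' -> cfun c = c' \o f ->
  cdom c x -> w' c' (f x) = a * w c x.
Hypothesis uker : uniq ker.
Hypothesis kerE : forall x, (x \in ker) <-> f x = f (gzero L).

Definition represents (Z : riemann_surface R) (nu : {charge set (borel Z) -> \bar R})
    (h : chart R Z -> Z -> R) :=
  forall c (A : set (borel Z)), atlas Z c -> measurable A -> A `<=` cdom c ->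
    (@plane_measure R).-integrable (chart_image c A) (fun p => (h c (chart_param c p))%:E) /\
    nu A = (\int[@plane_measure R]_(p in chart_image c A) (h c (chart_param c p))%:E)%E.

Context (nu : X -> {charge set (borel X) -> \bar R}).
Context (nu1 nuQ : {charge set (borel Y) -> \bar R}).
Hypothesis nuP : forall s, represents (nu s) (fun c x => ln (G s x) * 'N (w c x) ^+ 2).
Hypothesis nu1P : represents nu1 (fun c x => 'N (w' c x) ^+ 2).
Hypothesis nuQP : represents nuQ (fun c x => ln (G' Q x) * 'N (w' c x) ^+ 2).

(** f has as many sheets as its kernel has elements, and in a chart c' o f each sheet carries |w|^2
    = |a|^{-2} |w'|^2. *)
Let C : R := (size ker)%:R * ('N a ^+ 2)^-1.

Let pushforward_eq (A : set (borel Y)) :=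
  \sum_(s <- S) rcharge (nu s) (f @^-1` A) = C * (K * rcharge nu1 A + rcharge nuQ A).

Lemma pushforward_eqU A B : measurable A -> measurable B -> A `&` B = set0 ->
  pushforward_eq A -> pushforward_eq B -> pushforward_eq (A `|` B).
Proof.
move=> mA mB AB hA hB; have cf := isogeny_continuous isog.
rewrite /pushforward_eq preimage_setU !rchargeU//.
rewrite (eq_bigr (fun s => rcharge (nu s) (f @^-1` A) + rcharge (nu s) (f @^-1` B))).
  by rewrite big_split /= hA hB; ring.
move=> s _; apply: rchargeU; [exact: continuous_borel|exact: continuous_borel|].
by rewrite -preimage_setI AB preimage_set0.
Qed.

Lemma sum_Rintegral (I : eqType) (l : seq I) (D : set plane) (g : I -> R * R -> R) :
  measurable D ->
  (forall i, (@plane_measure R).-integrable D (fun p => (g i p)%:E)) ->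
  (@plane_measure R).-integrable D (fun p => (\sum_(i <- l) g i p)%:E) /\
  \sum_(i <- l) Rintegral (@plane_measure R) D (g i) =
  Rintegral (@plane_measure R) D (fun p => \sum_(i <- l) g i p).
Proof.
move=> mD ig; elim: l => [|i l [IH1 IH2]].
  have E : (fun p => (\sum_(i <- [::]) g i p)%:E) = cst 0%E.
    by apply/funext => p; rewrite big_nil.
  by rewrite big_nil /Rintegral E integral0; split=> //; exact: integrable0.
have E : (fun p => (\sum_(j <- i :: l) g j p)%:E) =
    (fun p => (g i p + \sum_(j <- l) g j p)%:E).
  by apply/funext => p; rewrite big_cons.
rewrite big_cons IH2 /Rintegral E; split.
  by have := integrableD mD (ig i) IH1; congr integrable; apply/funext => p.
exact: (esym (RintegralD mD (ig i) IH1)).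
Qed.

(** V = f(U) is evenly covered: its preimage is the disjoint union of the translates k + U, for k in
    the kernel. In the charts c' o f all sheets over A have the same image D in the plane as A has
    in c', so the identity reduces to one between integrands. *)
Lemma pushforward_local y : exists V : set Y, [/\ open V, V y &
  forall A : set (borel Y), measurable A -> A `<=` V -> pushforward_eq A].
Proof.
have [x0 fx0] := isogeny_surjective cX isog y.
have [U0 [oU0 U0x Uinj]] := isogeny_locally_injective isog x0.
have [c' ac' cy'] := atlas_cover (f x0).
have cf := isogeny_continuous isog.
pose U := U0 `&` f @^-1` cdom c'.
have oU : open U by apply: openI => //; apply: open_comp => //; exact: cdom_open.
have Ux : U x0 by [].
exists (f @` U); split.
- rewrite openE => _ [u Uu <-]; apply: (isogeny_open cX isog).
  exact: open_nbhs_nbhs.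
- by exists x0.
move=> A mA AV.
have Ac' : A `<=` cdom c' by move=> z /AV [u [_ cu] <-].
pose tr k x := gadd L (gopp L k) x.
pose Uk k := tr k @^-1` U.
pose Ub k : set (borel X) := Uk k.
have oUk k : open (Uk k).
  by apply: open_comp => // x _; exact: translation_continuous.
have ftr k x : k \in ker -> f (tr k x) = f x.
  move=> /kerE fk; have f0 z : gadd L' (f (gzero L)) z = z.
    have h : gadd L' (f (gzero L)) (f (gzero L)) = f (gzero L).
      by rewrite -(isogenyD isog) gadd0.
    by apply: (@gaddI _ _ L' (f (gzero L))); rewrite gaddA h.
  by rewrite -[LHS]f0 -fk -(isogenyD isog) gaddNKl.
have trK k u : tr k (gadd L k u) = u by exact: gaddKl.
have UkP k u : U u -> Uk k (gadd L k u).
  by move=> Uu; rewrite -[Uk k _]/(U (tr k (gadd L k u))) trK.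
have Ukinj k : k \in ker -> forall x z, Uk k x -> Uk k z -> f x = f z -> x = z.
  move=> kk x z Ux' Uz fxz; apply: (@gaddI _ _ L (gopp L k)).
  by case: Ux' Uz => ? _ [? _]; apply: Uinj => //; rewrite !ftr.
have Ukdisj k l x : k \in ker -> l \in ker -> Uk k x -> Uk l x -> k = l.
  move=> kk kl [Ux1 _] [Ux2 _].
  have : tr k x = tr l x by apply: Uinj => //; rewrite !ftr.
  rewrite /tr ![gadd L _ x]gaddC => /gaddI h.
  have : gadd L k (gopp L k) = gadd L l (gopp L k).
    by rewrite {2}h !(gaddC _ _ (gopp L _)) !gaddN.
  by rewrite ![gadd L _ (gopp L k)]gaddC => /gaddI.
have Ukc k : k \in ker -> Uk k `<=` f @^-1` cdom c'.
  by move=> kk x [_]; rewrite /= ftr.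
have /choice[ck ckP] k : exists c, k \in ker ->
    [/\ atlas X c, cdom c = Uk k & cfun c = c' \o f].
  have [kk|] := boolP (k \in ker); last first.
    by have [c _ _] := atlas_cover k; exists c.
  have [c cP] := isogeny_chart cX isog ac' (oUk k) (Ukc k kk) (Ukinj k kk).
  by exists c.
pose fA : set (borel X) := f @^-1` A.
have mfA : measurable fA by exact: continuous_borel.
have mUk k : measurable (fA `&` Ub k).
  by apply: measurableI => //; exact: open_borel.
(* The part of the preimage of A on the sheets listed in [l], so that additivity over the sheets
   follows by induction on [l]. *)
pose W (l : seq X) : set (borel X) := [set x | fA x /\ exists2 k, k \in l & Uk k x].
have Wcons (k : X) (l : seq X) : W (k :: l) = (fA `&` Ub k) `|` W l.
  apply/seteqP; split=> x.
    move=> [Ax [j + Uj]]; rewrite inE => /predU1P[jk|jl].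
      by left; rewrite -jk.
    by right; split=> //; exists j.
  move=> [[Ax Ux']|[Ax [j jl Uj]]]; split=> //; first by exists k; rewrite ?mem_head.
  by exists j => //; rewrite inE jl orbT.
have W0 : W [::] = set0 by apply/seteqP; split=> x // [_ []].
have mW l : measurable (W l).
  by elim: l => [|k l IH]; rewrite ?W0// Wcons; exact: measurableU.
have sumW s (l : seq X) : uniq l -> {subset l <= ker} ->
    rcharge (nu s) (W l) = \sum_(k <- l) rcharge (nu s) (fA `&` Ub k).
  elim: l => [_ _|k l IH /= /andP[kl ul] lk]; first by rewrite W0 rcharge0 big_nil.
  rewrite Wcons big_cons rchargeU// ?IH//.
    by move=> j jl; apply: lk; rewrite inE jl orbT.
  apply/seteqP; split=> x // [[_ Ukx] [_ [j jl Ujx]]].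
  have kj : k = j.
    by apply: (Ukdisj _ _ x) => //; apply: lk; rewrite inE ?eqxx ?jl ?orbT.
  by rewrite kj jl in kl.
have WfA : W ker = fA.
  apply/seteqP; split=> x; first by case.
  move=> Ax; split=> //; have [u Uu fu] := AV _ Ax.
  (* x and u have the same image, so k = x - u is in the kernel and x lies on the sheet k + U. *)
  pose k := gadd L x (gopp L u).
  have xE : x = gadd L k u by rewrite /k -gaddA gaddN gaddC gadd0.
  have kk : k \in ker.
    apply/kerE; have : gadd L' (f k) (f u) = gadd L' (f (gzero L)) (f u).
      by rewrite -!(isogenyD isog) -xE gadd0 fu.
    by rewrite ![gadd L' _ (f u)]gaddC => /gaddI.
  by exists k => //; rewrite xE; exact: UkP.
pose D := chart_image c' A.
have mD : measurable (D : set plane) by exact: chart_image_measurable.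
pose g k s (p : R * R) := ln (G s (chart_param (ck k) p)) *
  'N (w (ck k) (chart_param (ck k) p)) ^+ 2.
pose m1 (p : R * R) := 'N (w' c' (chart_param c' p)) ^+ 2.
pose mQ (p : R * R) := ln (G' Q (chart_param c' p)) * m1 p.
have [i1 E1] := nu1P ac' mA Ac'; have [iQ EQ] := nuQP ac' mA Ac'.
have DE k : k \in ker -> chart_image (ck k) (fA `&` Ub k) = D.
  move=> kk; have [ac cU cE] := ckP k kk.
  apply/seteqP; split=> [q [x [Ax Ukx] xq]|q [z Az zq]].
    by exists (f x) => //; rewrite -xq cE.
  have [u Uu fu] := AV _ Az.
  have fku : f (gadd L k u) = z by rewrite -(ftr k)// trK.
  exists (gadd L k u); last by rewrite cE /= fku.
  by split; [rewrite /fA /= fku|exact: UkP].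
have gP k s : k \in ker ->
    (@plane_measure R).-integrable D (fun p => (g k s p)%:E) /\
    rcharge (nu s) (fA `&` Ub k) = Rintegral (@plane_measure R) D (g k s).
  move=> kk; have [ac cU cE] := ckP k kk.
  have sub : fA `&` Ub k `<=` cdom (ck k) by rewrite cU => x [].
  by have := nuP s ac (mUk k) sub; rewrite DE// /rcharge => -[? ->].
have key k : k \in ker -> \sum_(s <- S) rcharge (nu s) (fA `&` Ub k) =
    ('N a ^+ 2)^-1 * (K * rcharge nu1 A + rcharge nuQ A).
  move=> kk; have [ac cU cE] := ckP k kk.
  rewrite (eq_bigr (fun s => Rintegral (@plane_measure R) D (g k s))); last first.
    by move=> s _; have [] := gP k s kk.
  have [ig ->] := sum_Rintegral S mD (fun s => (gP k s kk).1).
  have iK := integrableZl mD K i1.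
  have iKQ := integrableD mD iK iQ.
  have -> : K * rcharge nu1 A + rcharge nuQ A =
      Rintegral (@plane_measure R) D (fun p => K * m1 p + mQ p).
    by rewrite RintegralD// RintegralZl// /rcharge E1 EQ.
  rewrite -RintegralZl//; congr fine; apply: ae_eq_integral => //.
  - exact: (measurable_int _ ig).
  - exact: (measurable_int _ (integrableZl mD ('N a ^+ 2)^-1 iKQ)).
  (* [log_constant] says nothing at points of the fibre S; in this chart they can only sit at the
     coordinate of Q, a null set. *)
  exists [set chart_coord c' Q]; split.
  - exact: plane_measurable_set1.
  - exact: plane_measure_set1.
  move=> p /= np; apply: contrapT => pQ; apply: np => Dp.
  have [x [Ax Ukx] xp] : chart_image (ck k) (fA `&` Ub k) p by rewrite DE.
  have pk : chart_param (ck k) p = x.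
    by rewrite /chart_param -xp cfunK// cU.
  have pk' : chart_param c' p = f x.
    by rewrite /chart_param -xp cE /= cfunK//; exact: Ukc Ukx.
  have xS : x \notin S.
    apply/negP => /SE fxQ; apply: pQ; rewrite /= -fxQ chart_coordE.
    by rewrite -[c' (f x)]/((c' \o f) x) -cE xp plane_to_CK.
  congr EFin; rewrite /g /mQ /m1 pk pk' -mulr_suml log_constant//.
  rewrite (formE ac ac' _ cE)//; [|by rewrite cU; exact: Ukc|by rewrite cU].
  rewrite Normc.normcM exprMn; field.
  by rewrite normc_eq0.
rewrite /pushforward_eq (eq_bigr (fun s => \sum_(k <- ker) rcharge (nu s) (fA `&` Ub k))).
  rewrite exchange_big /= (eq_big_seq _ key) big_const_seq count_predT.
  by rewrite iter_addr_0 -[LHS]mulr_natl /C -!mulrA.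
by move=> s _; rewrite -[f @^-1` A]WfA sumW.
Qed.

(** Finitely many of the local open sets cover Y. The identity is additive on disjoint sets, so A is
    split into its part in the first of them and the rest, which the others cover. *)
Lemma pushforward_global : pushforward_eq setT.
Proof.
have /choice[V VP] := pushforward_local.
move: cY; rewrite compact_cover => /(_ Y [set: Y] V) [].
- by move=> y _; have [] := VP y.
- by move=> y _; exists y => //; have [] := VP y.
move=> D _ Dcov.
suff key (l : seq Y) (A : set (borel Y)) : measurable A ->
    (forall y, A y -> exists2 i, i \in l & V i y) -> pushforward_eq A.
  apply: (key (finmap.enum_fset D)); first exact: measurableT.
  move=> y _; by have [i iD Viy] := Dcov y I; exists i.
elim: l A => [|i l IH] A mA Al.
  have -> : A = set0 by apply/seteqP; split=> y // /Al[].
  rewrite /pushforward_eq preimage_set0 !rcharge0 mulr0 addr0 mulr0.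
  by rewrite big1// => s _; exact: rcharge0.
have [oV _ hV] := VP i.
have mV : measurable (V i : set (borel Y)) by exact: open_borel.
rewrite -(setUIDK A (V i)); apply: pushforward_eqU.
- exact: measurableI.
- exact: measurableD.
- by rewrite setDE setIACA setICr setI0.
- by apply: hV; [exact: measurableI|move=> y []].
apply: IH; first exact: measurableD.
move=> y [/Al[j + Vj] nVy]; rewrite inE => /predU1P[ji|jl]; last by exists j.
by rewrite ji in Vj.
Qed.

End integral_constant.

(** * The projection formula *)

Section projection_formula.
Context {R : realType} (X Y : riemann_surface R) (L : group_law X) (L' : group_law Y).
Context (f : X -> Y) (G : X -> X -> R) (G' : Y -> Y -> R).
Context (w : coef_form X) (w' : coef_form Y).
Local Notation "'N z" := (Normc.normc z) (at level 10, z at level 8).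
Hypothesis cX : compact [set: X].
Hypothesis cY : compact [set: Y].
Hypothesis isog : isogeny L L' f.
Hypothesis gG : green_facts G w.
Hypothesis gG' : green_facts G' w'.

Let floc : local_biholomorphism f := isogeny_local_biholomorphism cX isog.

Lemma green_gt0 x s : x != s -> 0 < G s x.
Proof.
move=> xs; rewrite lt_def (gf_ge0 gG) andbT.
by apply: contra_neq xs => /(gf_zero gG) ->.
Qed.

Lemma green_gt0' x s : x != s -> 0 < G' s x.
Proof.
move=> xs; rewrite lt_def (gf_ge0 gG') andbT.
by apply: contra_neq xs => /(gf_zero gG') ->.
Qed.

(* The constant is 0, by integrating against the canonical form of X. *)
Lemma green_log_fiber (Q : Y) (S : seq X) : uniq S ->
  (forall x, (x \in S) <-> f x = Q) ->
  forall x, x \notin S -> \sum_(s <- S) ln (G s x) = ln (G' Q (f x)).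
Proof.
move=> uS SE; have [K KE] := green_log_constant cX isog gG gG' uS SE.
have [a a0 aE] := isogeny_form cX isog gG gG'.
have [ker uker kerE] := fiber_finite (f (gzero L)) cX floc.
have /choice[nu nuP] := gf_integral gG.
have [nu1 [nu1P nu1T]] := gf_mass gG'.
have [nuQ [nuQP nuQT]] := gf_integral gG' Q.
have := @pushforward_global R X Y L L' f G G' w w' cX cY isog Q S K SE KE a ker a0
  aE uker kerE nu nu1 nuQ (fun s => (nuP s).1) nu1P nuQP.
(* Each [nu s] has total mass 0 by the normalisation of G; [nu1] has mass 1 and [nuQ] mass 0. There
   remains 0 = C K, where C is not 0 because the kernel contains the origin. *)
rewrite preimage_setT big1 => [|s _]; last by rewrite /rcharge (nuP s).2.
rewrite /rcharge nu1T nuQT /= addr0 mulr1 => /esym/eqP.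
rewrite !mulf_eq0 invr_eq0 expf_eq0 /= normc_eq0 (negbTE a0) orbF => /orP[|/eqP K0].
  rewrite pnatr_eq0 size_eq0 => /eqP ker0.
  by have := (kerE (gzero L)).2 erefl; rewrite ker0.
by move=> x xS; rewrite KE// K0 add0r.
Qed.

Lemma green_prod_fiber (Q : Y) (S : seq X) : uniq S ->
  (forall x, (x \in S) <-> f x = Q) ->
  forall x, \prod_(s <- S) G s x = G' Q (f x).
Proof.
move=> uS SE x; have [xS|xS] := boolP (x \in S).
  have Gxx : G x x = 0 by exact: (gf_zero gG x x).2 erefl.
  have GQQ : G' Q Q = 0 by exact: (gf_zero gG' Q Q).2 erefl.
  rewrite ((SE x).1 xS) GQQ (perm_big _ (perm_to_rem xS)) big_cons Gxx.
  exact: mul0r.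
have fxQ : f x != Q by apply/eqP => /SE; exact/negP.
have prod_gt0 (l : seq X) : {subset l <= S} ->
    0 < \prod_(s <- l) G s x /\
    ln (\prod_(s <- l) G s x) = \sum_(s <- l) ln (G s x).
  elim: l => [_|s l IH lS]; first by rewrite !big_nil ltr01 ln1.
  have [l0 lE] := IH (fun y yl => lS y (mem_behead (s := s :: l) yl)).
  have s0 : 0 < G s x.
    apply: green_gt0; apply: contraNneq xS => ->; apply: lS.
    exact: mem_head.
  by rewrite !big_cons mulr_gt0// lnM ?posrE// lE.
have [p0 pE] := prod_gt0 S (fun y yS => yS).
apply: (@ln_inj R); rewrite ?posrE ?green_gt0'//.
by rewrite pE (green_log_fiber uS SE).
Qed.

(** * Ramification and pullback of divisors *)

Lemma cvgCP (T : Type) (F : set_system T) (g : T -> R[i]) (l : R[i]) : Filter F ->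
  (g @ F --> l) <-> forall e : R, 0 < e -> \forall t \near F, 'N (g t - l) < e.
Proof.
move=> FF; split=> [gl e e0|gl A /nearCP[r r0 rA]].
  by have /gl : nbhs l [set v | 'N (v - l) < e] by apply/nearCP; exists e.
by have := gl r r0; apply: filterS => t /rA.
Qed.

Lemma cder_cvg (F : R[i] -> R[i]) z d : cder F z d ->
  (F v - F z) / (v - z) @[v --> z^'] --> d.
Proof.
move=> /cderE Fz; apply/cvgCP => e e0; have e20 : 0 < e / 2 by lra.
rewrite near_withinE; apply: filterS (Fz _ e20) => v vz vz0.
have vz1 : v - z != 0 by rewrite subr_eq0.
rewrite (_ : _ / _ - d = (F v - F z - d * (v - z)) / (v - z)); last by field.
rewrite Normc.normcM Normc.normcV ltr_pdivrMr ?normc_gt0//.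
by apply: le_lt_trans vz _; rewrite ltr_pM2r ?normc_gt0//; lra.
Qed.

(** Order 0 contradicts F v - F z -> 0, and an order n >= 2 would make the difference quotient tend
    to 0 instead of d. *)
Lemma has_zero_of_order_cder (F : R[i] -> R[i]) z d n : d != 0 -> cder F z d ->
  has_zero_of_order (fun v => F v - F z) z n <-> n = 1%N.
Proof.
move=> d0 Fz; have Fd := cder_cvg Fz; split=> [[l l0 Fl]|->]; last by exists d.
have c0 : v - z @[v --> z^'] --> (0 : R[i]).
  apply/cvgCP => e e0; rewrite near_withinE; apply/nearCP; exists e => // v vz _.
  by rewrite subr0.
have cX' m : (v - z) ^+ m.+1 @[v --> z^'] --> (0 : R[i]).
  elim: m => [|m IH]; first exact: c0.
  rewrite -[X in _ --> X](mulr0 0).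
  under eq_fun do rewrite exprS.
  exact: (cvgM c0 IH).
case: n Fl => [|[|n]] Fl //; exfalso.
  have : F v - F z @[v --> z^'] --> (0 : R[i]).
    have E : \forall v \near z^',
        (F v - F z) / (v - z) * (v - z) = F v - F z.
      by rewrite near_withinE; apply: filterE => v vz; rewrite divfK// subr_eq0.
    have /(_ (dnbhs_filter z)) h := cvgM Fd c0; rewrite mulr0 in h.
    exact: (cvg_trans (near_eq_cvg E) h).
  move=> F0; have Fl' : F v - F z @[v --> z^'] --> l.
    by move: Fl; under eq_fun do rewrite expr0 divr1.
  by move/eqP: l0; apply; exact: (cvg_unique _ Fl' F0).
have /(_ (dnbhs_filter z)) F0 := cvgM Fl (cX' n); rewrite mulr0 in F0.
have Fd0 : (F v - F z) / (v - z) @[v --> z^'] --> (0 : R[i]).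
  have E : \forall v \near z^',
      (F v - F z) / (v - z) ^+ n.+2 * (v - z) ^+ n.+1 = (F v - F z) / (v - z).
    rewrite near_withinE; apply: filterE => v vz.
    have vz0 : v - z != 0 by rewrite subr_eq0.
    by rewrite [_ ^+ n.+2]exprS; field; rewrite vz0 expf_neq0.
  exact: (cvg_trans (near_eq_cvg E) F0).
by move/eqP: d0; apply; exact: (cvg_unique _ Fd Fd0).
Qed.

Lemma ramification_index1 x : ramification_index f x = 1%N.
Proof.
have key c (c' : chart R Y) n : atlas X c -> atlas Y c' -> cdom c x -> cdom c' (f x) ->
    has_zero_of_order (fun z => c' (f (cinv c z)) - c' (f x)) (c x) n <-> n = 1%N.
  move=> ac ac' cx cx'.
  have := has_zero_of_order_cder n
    (local_biholomorphism_derive_neq0 floc ac ac' cx cx')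
    (local_biholomorphism_cder floc ac ac' cx cx').
  by rewrite /= cfunK.
rewrite /ramification_index; case: xgetP => [n _ /= hn|/(_ 1%N)/= n1].
  have [c ac cx] := atlas_cover x; have [c' ac' cx'] := atlas_cover (f x).
  exact: ((key c c' n ac ac' cx cx').1 (hn c c' ac ac' cx cx')).
by exfalso; apply: n1 => c c' ac ac' cx cx'; apply/(key c c').
Qed.

Lemma pullback_divE (D : Y -> int) x : pullback_div f D x = D (f x).
Proof. by rewrite /pullback_div ramification_index1 mulr1. Qed.

Lemma prod_exprz (I : eqType) (l : seq I) (g : I -> R) (n : int) :
  \prod_(i <- l) (g i) ^ n = (\prod_(i <- l) g i) ^ n.
Proof.
elim: l => [|i l IH]; first by rewrite !big_nil exp1rz.
by rewrite !big_cons IH expfzMl.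
Qed.

(** The points of the support of f^*D are grouped by their image Q; all multiplicities over Q equal
    D Q, so each group is the fibre product [green_prod_fiber] raised to the power D Q. *)
Lemma green_div_pullback (D : Y -> int) : is_divisor D ->
  forall P, green_div G (pullback_div f D) P = green_div G' D (f P).
Proof.
move=> finD P; pose A := [set Q | D Q != 0].
have /choice[Sq SqP] Q : exists S : seq X, uniq S /\ forall x, (x \in S) <-> f x = Q.
  by have [S uS SE] := fiber_finite Q cX floc; exists S.
have fE : [set x | pullback_div f D x != 0] = f @^-1` A.
  by apply/seteqP; split=> x; rewrite /= pullback_divE.
have finA : finite_set (f @^-1` A).
  apply: (sub_finite_set (B := \bigcup_(Q in A) [set` Sq Q])).
    by move=> x Ax; exists (f x) => //=; exact: ((SqP (f x)).2 x).2 erefl.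
  by apply: bigcup_finite => // Q _; exact: finite_seq.
rewrite /green_div fE !fsbig_finite//=.
set lA := fset_set (f @^-1` A); set l := fset_set A.
have lAE x : (x \in lA) = (f x \in l) by rewrite !in_fset_set// !inE.
have ulA : uniq (finmap.enum_fset lA) by exact: finmap.fset_uniq.
have ul : uniq (finmap.enum_fset l) by exact: finmap.fset_uniq.
transitivity (\prod_(s <- lA) \prod_(Q <- l | Q == f s) (G s P ^ D Q)).
  apply: eq_big_seq => s sA; rewrite pullback_divE.
  by rewrite -big_filter filter_pred1_uniq ?big_seq1// -lAE.
rewrite (exchange_big_dep predT)//=; apply: eq_big_seq => Q Ql.
transitivity (\prod_(s <- Sq Q) G s P ^ D Q).
  rewrite -big_filter; apply: perm_big; apply: uniq_perm.
  - exact: filter_uniq.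
  - by have [] := SqP Q.
  move=> s; rewrite mem_filter lAE; apply/andP/idP => [[/eqP Qs _]|].
    by apply/(SqP Q).2.
  by move=> /(SqP Q).2 ->.
have [uS SE] := SqP Q.
by rewrite prod_exprz (green_prod_fiber uS SE).
Qed.

(** * Germs, null germs and norms of sections under pullback *)

Lemma isogeny_dnbhs x : f @ x^' = (f x)^'.
Proof.
have [U [oU Ux Uinj]] := local_biholomorphism_inj floc x.
(* One inclusion is the openness of f; the other is its continuity, with injectivity on U keeping
   the point f x out of the image of a punctured neighbourhood. *)
apply/seteqP; split=> A hA.
  have {}hA : nbhs x [set u | u != x -> A (f u)] by exact: hA.
  change (nbhs (f x) [set y | y != f x -> A y]).
  have := local_biholomorphism_open floc hA.
  apply: filterS => _ [u uA <-] fux; apply: uA; apply: contra_neq fux => ->.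
  by [].
have {}hA : nbhs (f x) [set y | y != f x -> A y] by exact: hA.
have h1 := local_biholomorphism_continuous floc hA.
change (nbhs x [set u | u != x -> A (f u)]).
apply: filterS2 (open_nbhs_nbhs (conj oU Ux)) h1 => u Uu uA ux.
by apply: uA; apply: contra_neq ux; exact: Uinj.
Qed.

Lemma chart_dnbhs (Z : riemann_surface R) (c : chart R Z) x : cdom c x ->
  cinv c @ (c x)^' = x^'.
Proof.
move=> cx; apply/seteqP; split=> A hA.
  have {}hA : nbhs (c x) [set z | z != c x -> A (cinv c z)] by exact: hA.
  change (nbhs x [set y | y != x -> A y]).
  have := near_cfun cx hA; apply: filterS => y [cy yA] yx.
  rewrite /= cfunK// in yA; apply: yA; apply: contra_neq yx.
  by move=> /(congr1 (cinv c)); rewrite !cfunK.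
have {}hA : nbhs x [set y | y != x -> A y] by exact: hA.
change (nbhs (c x) [set z | z != c x -> A (cinv c z)]).
have := near_cinv cx hA; apply: filterS => z [cz zE zA] zx.
by apply: zA; apply: contra_neq zx => <-; rewrite zE.
Qed.

Lemma cvg_chart (Z : riemann_surface R) (c : chart R Z) x (h : Z -> R[i]) (n : int)
    (l : R[i]) : cdom c x ->
  (h (cinv c z) * (z - c x) ^ n @[z --> (c x)^'] --> l) <->
  (h y * (c y - c x) ^ n @[y --> x^'] --> l).
Proof.
move=> cx; rewrite -[in X in _ <-> X](chart_dnbhs cx).
have E : \forall z \near (c x)^',
    h (cinv c z) * (z - c x) ^ n = h (cinv c z) * (c (cinv c z) - c x) ^ n.
  rewrite near_withinE; have := near_cinv cx (near_cdom cx).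
  by apply: filterS => z [_ -> _].
have E' : \forall z \near (c x)^',
    h (cinv c z) * (c (cinv c z) - c x) ^ n = h (cinv c z) * (z - c x) ^ n.
  by apply: filterS E => z ->.
split=> H; apply: cvg_trans H.
  exact: (near_eq_cvg (F := (c x)^') E).
exact: (near_eq_cvg (F := (c x)^') E').
Qed.

Lemma cvg_exprz (T : Type) (F : set_system T) (g : T -> R[i]) (l : R[i]) (n : int) :
  Filter F -> l != 0 -> g t @[t --> F] --> l -> g t ^ n @[t --> F] --> l ^ n.
Proof.
move=> FF l0 gl.
have cvgX m : g t ^+ m @[t --> F] --> l ^+ m.
  elim: m => [|m IH]; first by rewrite expr0; under eq_fun do rewrite expr0; exact: cvg_cst.
  have -> : (fun t => g t ^+ m.+1) = (fun t => g t * g t ^+ m).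
    by apply/funext => t; rewrite exprS.
  by rewrite exprS; exact: (cvgM gl IH).
case: n => m; first exact: cvgX.
exact: (cvgV (expf_neq0 m.+1 l0) (cvgX m.+1)).
Qed.

Lemma isogeny_coordinate_ratio (c : chart R X) (c' : chart R Y) x :
  atlas X c -> atlas Y c' -> cdom c x -> cdom c' (f x) ->
  exists2 d : R[i], d != 0 &
    (c' (f y) - c' (f x)) / (c y - c x) @[y --> x^'] --> d.
Proof.
move=> ac ac' cx cx'.
exists (derive1 (c' \o f \o cinv c) (c x)).
  exact: local_biholomorphism_derive_neq0.
have := cder_cvg (local_biholomorphism_cder floc ac ac' cx cx').
rewrite -(chart_dnbhs cx) /= cfunK// => H.
apply: cvg_trans H; apply: (near_eq_cvg (F := (c x)^')).
rewrite near_withinE; have := near_cinv cx (near_cdom cx).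
by apply: filterS => z [_ -> _].
Qed.

(* The two trivialisations of the pulled back bundle at x given by coordinates
   of X and of Y differ by the unit d ^ n. *)
Lemma cvg_pullback (c : chart R X) (c' : chart R Y) x (h : Y -> R[i]) (n : int) :
  atlas X c -> atlas Y c' -> cdom c x -> cdom c' (f x) ->
  exists2 d : R[i], d != 0 &
    (forall l : R[i], h y * (c' y - c' (f x)) ^ n @[y --> (f x)^'] --> l ->
       h (f y) * (c y - c x) ^ n @[y --> x^'] --> l * d) /\
    (forall l : R[i], h (f y) * (c y - c x) ^ n @[y --> x^'] --> l ->
       h y * (c' y - c' (f x)) ^ n @[y --> (f x)^'] --> l / d).
Proof.
move=> ac ac' cx cx'.
have [d d0 rd] := isogeny_coordinate_ratio ac ac' cx cx'.
have rn := cvg_exprz (n := - n) (dnbhs_filter x) d0 rd.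
exists (d ^ (- n)); first exact: expfz_neq0.
have [U [oU Ux Uinj]] := local_biholomorphism_inj floc x.
have ne : \forall y \near x^', c y - c x != 0 /\ c' (f y) - c' (f x) != 0.
  rewrite near_withinE.
  have h1 := local_biholomorphism_continuous floc (near_cdom cx').
  apply: filterS3 (open_nbhs_nbhs (conj oU Ux)) (near_cdom cx) h1.
  move=> y Uy cy cy' yx; rewrite !subr_eq0; split; apply: contra_neq yx => E.
    by rewrite -(cfunK cy) E cfunK.
  by apply: Uinj => //; rewrite -(cfunK cy') E cfunK.
rewrite -(isogeny_dnbhs x); split=> l hl.
  have {}hl : h (f y) * (c' (f y) - c' (f x)) ^ n @[y --> x^'] --> l by exact: hl.
  have /(_ (dnbhs_filter x)) H := cvgM hl rn; apply: cvg_trans H.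
  apply: (near_eq_cvg (F := x^')).
  apply: filterS ne => y [y1 y2].
  rewrite /= expfzMl exprz_inv opprK -mulrA; congr (_ * _).
  by rewrite mulrA -expfzDr// subrr expr0z mul1r.
suff : h (f y) * (c' (f y) - c' (f x)) ^ n @[y --> x^'] --> l / d ^ (- n) by [].
have /(_ (dnbhs_filter x)) rnV := cvgV (expfz_neq0 (- n) d0) rn.
have /(_ (dnbhs_filter x)) H := cvgM hl rnV; apply: cvg_trans H.
apply: (near_eq_cvg (F := x^')); apply: filterS ne => y [y1 y2].
rewrite /= -mulrA; congr (_ * _); rewrite invr_expz opprK expfzMl exprz_inv.
by rewrite mulrCA -expfzDr// subrr expr0z mulr1.
Qed.

Lemma OD_germ_pullback (D : Y -> int) P (h : Y -> R[i]) :
  OD_germ D (f P) h -> OD_germ (pullback_div f D) P (canonical_map f h).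
Proof.
move=> [h1 h2]; split.
  have {}h1 : \forall y \near P^', forall c', atlas Y c' -> cdom c' (f y) ->
      derivable (h \o cinv c') (c' (f y)) 1.
    by move: h1; rewrite -isogeny_dnbhs.
  apply: filterS h1 => y hy c ac cy; have [c' ac' cy'] := atlas_cover (f y).
  have k1 := derivable_cder (hy c' ac' cy').
  have k2 := local_biholomorphism_cder floc ac ac' cy cy'.
  have E : (c' \o f \o cinv c) (c y) = c' (f y) by rewrite /= cfunK.
  rewrite -E in k1; apply/derivable_cderP; eexists.
  apply: wder_near_eq (cder_comp k1 k2).
  have := near_cinv cy (local_biholomorphism_continuous floc (near_cdom cy')).
  by apply: filterS => z [_ _ /= /cfunK ->].
move=> c ac cP; rewrite pullback_divE.
have [c' ac' cP'] := atlas_cover (f P).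
have [d d0 [H _]] := cvg_pullback h (D (f P)) ac ac' cP cP'.
have /cvg_ex[l /(cvg_chart _ _ _ cP') /H hl] := h2 c' ac' cP'.
by apply/cvg_ex; exists (l * d); apply/(cvg_chart (canonical_map f h) _ _ cP).
Qed.

Lemma OD_null_pullback (D : Y -> int) P (h : Y -> R[i]) :
  OD_null D (f P) h <-> OD_null (pullback_div f D) P (canonical_map f h).
Proof.
split=> h0.
  move=> c ac cP; rewrite pullback_divE.
  have [c' ac' cP'] := atlas_cover (f P).
  have [d d0 [H _]] := cvg_pullback h (D (f P)) ac ac' cP cP'.
  have := H 0; rewrite mul0r => {}H; apply/(cvg_chart (canonical_map f h) _ _ cP).
  by apply: H; apply/(cvg_chart _ _ _ cP'); exact: h0.
move=> c' ac' cP'; have [c ac cP] := atlas_cover P.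
have [d d0 [_ H]] := cvg_pullback h (D (f P)) ac ac' cP cP'.
have := H 0; rewrite mul0r => {}H; apply/(cvg_chart _ _ _ cP'); apply: H.
have := h0 c ac cP; rewrite pullback_divE.
by move=> /(cvg_chart (canonical_map f h) _ _ cP).
Qed.

(** A germ at P descends along the local inverse k of f: the germ h o k at f P pulls back to h near
    P. *)
Lemma OD_pullback_surjective (D : Y -> int) P (h : X -> R[i]) :
  OD_germ (pullback_div f D) P h ->
  exists2 s : Y -> R[i], OD_germ D (f P) s &
    OD_null (pullback_div f D) P (h - canonical_map f s).
Proof.
move=> [h1 h2].
have [U [oU UP Uinj]] := local_biholomorphism_inj floc P.
pose k (y : Y) := xget point [set u | U u /\ f u = y].
have kf u : U u -> k (f u) = u.
  move=> Uu; rewrite /k; case: xgetP => [v _ [Uv fv]|/(_ u)/=]; first exact: Uinj.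
  by move=> /(_ (conj Uu erefl)).
pose s := h \o k.
have nU : \forall u \near P^', U u.
  by rewrite near_withinE; apply: filterS (open_nbhs_nbhs (conj oU UP)) => u.
exists s.
  split.
    rewrite -isogeny_dnbhs.
    suff : \forall u \near P^', forall c', atlas Y c' -> cdom c' (f u) ->
        derivable (s \o cinv c') (c' (f u)) 1 by [].
    apply: filterS2 nU h1 => u Uu hu c' ac' cu'.
    have [c [ac cu cU cc' cE]] := floc ac' cu' (open_nbhs_nbhs (conj oU Uu)).
    have := hu c ac cu; have cuE : c u = c' (f u) by rewrite cE.
    rewrite cuE; apply: near_eq_derivable.
    have im : (c @` cdom c) (c' (f u)) by exists u.
    apply: filterS (open_nbhs_nbhs (conj (@cimg_open _ _ c) im)) => z cz.
    have [cz1 cz2] := chart_imgP cz.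
    by rewrite /s /= -(local_biholomorphism_cinv cc' cE cz) kf//; exact: cU.
  move=> c' ac' cP'; have [c ac cP] := atlas_cover P.
  have [d d0 [_ H]] := cvg_pullback s (D (f P)) ac ac' cP cP'.
  have /cvg_ex[l] := h2 c ac cP; rewrite pullback_divE => /(cvg_chart _ _ _ cP) hl.
  apply/cvg_ex; exists (l / d); apply/(cvg_chart _ _ _ cP'); apply: H.
  apply: cvg_trans hl; apply: (near_eq_cvg (F := P^')).
  by apply: filterS nU => u Uu; rewrite /s /= kf.
move=> c ac cP; apply/(cvg_chart _ _ _ cP).
apply: (@cvg_trans _ (cst (0 : R[i]) @ P^')); last exact: cvg_cst.
apply: (near_eq_cvg (F := P^')); apply: filterS nU => u Uu.
rewrite -[(h - _) u]/(h u - h (k (f u))) kf// subrr mul0r.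
by [].
Qed.

(** By [green_div_pullback] and [isogeny_dnbhs] both norms are the [lim] of one and the same image
    filter. *)
Lemma OD_norm_pullback (D : Y -> int) P (h : Y -> R[i]) : is_divisor D ->
  OD_norm G (pullback_div f D) P (canonical_map f h) = OD_norm G' D (f P) h.
Proof.
move=> hD; have E : (fun Q => Normc.normc (canonical_map f h Q) * green_div G (pullback_div f D) Q) =
         (fun Q => Normc.normc (h Q) * green_div G' D Q) \o f.
  by apply/funext => Q; rewrite /= green_div_pullback.
by rewrite /OD_norm E -isogeny_dnbhs.
Qed.

End projection_formula.

Theorem theorem3p2 (R : realType) (X X' : riemann_surface R)
  (cX : compact [set: X]%classic) (cX' : compact [set: X']%classic)
  (gX : has_genus X 1) (gX' : has_genus X' 1)
  (L : group_law X) (L' : group_law X')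
  (G : X -> X -> R) (hG : arakelov_green G)
  (G' : X' -> X' -> R) (hG' : arakelov_green G')
  (f : X -> X') (hf : isogeny L L' f)
  (D : X' -> int) (hD : is_divisor D) :
  isometric_isomorphism (pullback_bundle f (OD G' D))
                        (OD G (pullback_div f D))
                        (canonical_map f) /\
  (forall P : X, green_div G (pullback_div f D) P = green_div G' D (f P)).
Proof.
have [w gG] := arakelov_green_facts gX hG.
have [w' gG'] := arakelov_green_facts gX' hG'.
split; last exact: (green_div_pullback cX cX' hf gG gG' hD).
split=> [a h1 h2|P]; first exact/funext.
split.
- by move=> h hh; apply: (OD_germ_pullback cX hf).
- by move=> h _; exact: (OD_null_pullback cX hf).
- by move=> h; exact: (OD_pullback_surjective cX hf).
- by move=> h _; exact: (OD_norm_pullback cX cX' hf gG gG' P h hD).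
Qed.
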